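(* Let $\delta=\delta(n)>0$ satisfy $\delta^2 n\to\infty$ as $n\to\infty$, and let $\beta=1-\delta$. Then the Glauber dynamics for the mean-field Ising model on $n$ vertices with parameter $\beta$ exhibits cutoff at time $\frac{1}{2}\frac{n}{\delta}\log(\delta^2 n)$ with window of order $n/\delta$. Moreover, the spectral gap of this dynamics is $(1+o(1))\delta/n$, where the $o(1)$ term tends to $0$ as $n\to\infty$.
   Context: For $n\ge1$ and $\beta\ge0$, the mean-field (Curie–Weiss) Ising measure $\mu_n$ on $\Omega=\{1,-1\}^n$ is $\mu_n(\sigma)\propto\exp\big(\frac{\beta}{n}\sum_{x<y}\sigma(x)\sigma(y)\big)$. The (heat-bath) Glauber dynamics $(X_t)$ is the Markov chain on $\Omega$ which at each step chooses a vertex $i$ uniformly at random and replaces $\sigma(i)$ by a spin drawn from $\mu_n$ conditioned on the spins at all other vertices (so $\sigma(i)$ becomes $+1$ with probability $\frac{1}{2}(1+\tanh(\beta(S(\sigma)-\sigma(i)/n)))$, where $S(\sigma)=\frac1n\sum_i\sigma(i)$). Let $d_n(t)=\max_{\sigma\in\Omega}\|\mathbb{P}_\sigma(X_t\in\cdot)-\mu_n\|_{\mathrm{TV}}$ and $t_{\mathrm{mix}}(\epsilon)=\min\{t:d_n(t)\le\epsilon\}$. The spectral gap is $1-\lambda$ where $\lambda$ is the largest absolute value of a nontrivial eigenvalue of the transition kernel. ''Cutoff at time $t_n$ with window $w_n$'' means: $w_n=o(t_n)$ and for every $0<\epsilon<1$ there is $c_\epsilon>0$ with $|t_{\mathrm{mix}}(\epsilon)-t_n|\le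 c_\epsilon w_n$ for all $n$. *)

(* Defs.v *)
From HB Require Import structures.
From mathcomp Require Import all_boot all_order all_algebra.
From mathcomp Require Import all_classical all_reals all_analysis.
Set Implicit Arguments. Unset Strict Implicit. Unset Printing Implicit Defensive.
Import Order.TTheory GRing.Theory Num.Theory.
Import numFieldNormedType.Exports.
Local Open Scope ring_scope.
Local Open Scope classical_set_scope.

Section CurieWeiss.
Variable R : realType.

Definition config (n : nat) := {ffun 'I_n -> bool}.

Definition spin n (s : config n) (i : 'I_n) : R := if s i then 1 else -1.

Definition cw_energy n (beta : R) (s : config n) : R :=
  beta / n%:R * \sum_(x < n) \sum_(y < n | (x < y)%N) spin s x * spin s y.

Definition cw_weight n (beta : R) (s : config n) : R := expR (cw_energy beta s).

Definition cw_mu n (beta : R) (s : config n) : R :=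
  cw_weight beta s / \sum_(t : config n) cw_weight beta t.

Definition setspin n (s : config n) (i : 'I_n) (b : bool) : config n :=
  [ffun j => if j == i then b else s j].

(* Probability that the new spin at i equals b: mu conditioned on the
   spins at all other vertices. *)
Definition heat_bath n (beta : R) (s : config n) (i : 'I_n) (b : bool) : R :=
  cw_mu beta (setspin s i b) /
    (cw_mu beta (setspin s i true) + cw_mu beta (setspin s i false)).

Definition glauber n (beta : R) (s t : config n) : R :=
  n%:R^-1 * \sum_(i < n) \sum_(b : bool)
      (if t == setspin s i b then heat_bath beta s i b else 0).

Fixpoint glauber_dist n (beta : R) (s : config n) (k : nat) : config n -> R :=
  match k with
  | 0 => fun t => if t == s then 1 else 0
  | k'.+1 => fun t => \sum_(r : config n) glauber_dist beta s k' r * glauber beta r t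
  end.

Definition tv_to_stat n (beta : R) (s : config n) (k : nat) : R :=
  2^-1 * \sum_(t : config n) `|glauber_dist beta s k t - cw_mu beta t|.

Definition dmix n (beta : R) (k : nat) : R :=
  \big[Num.max/0]_(s : config n) tv_to_stat beta s k.

(* t_mix(eps) = min { t : d_n(t) <= eps } (0 if no such t, which does not happen) *)
Definition tmix n (beta : R) (eps : R) : nat :=
  match pselect (exists k, dmix n beta k <= eps) with
  | left P => ex_minn P
  | right _ => 0%N
  end.

Definition glauber_eigenvalue n (beta : R) (a : R) : Prop :=
  exists f : config n -> R, (exists t, f t != 0) /\
    forall s, \sum_(t : config n) glauber beta s t * f t = a * f s.

Definition glauber_lambda n (beta : R) : R :=
  sup [set `|a| | a in [set a | glauber_eigenvalue n beta a /\ a != 1]].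

Definition spectral_gap n (beta : R) : R := 1 - glauber_lambda n beta.

Definition cutoff (beta : nat -> R) (tn wn : nat -> R) : Prop :=
  (fun n => wn n / tn n) @ \oo --> 0 /\
  forall eps : R, 0 < eps < 1 ->
    exists2 c : R, 0 < c &
      forall n : nat, (1 <= n)%N ->
        `| (tmix n (beta n) eps)%:R - tn n | <= c * wn n.

End CurieWeiss.

(* Main.v *)
(** The numbers [U] and [V] of pluses inside and outside the plus set of the
    initial configuration [A] form a Markov chain, and since the law of the
    dynamics started at [A] is invariant under the permutations that preserve [A],
    the total variation distance to equilibrium is attained on functions of
    [(U, V)].

    Upper bound.  Write [S] for the magnetization and [w = n / delta].  The drift of
    [S] is dissipative like [- S ^ 3] even when [delta] vanishes, so after [gam * w]
    steps [S ^ 2] is small on average and one may start from a configuration with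
    many spins of each sign.  After [w] further steps [S ^ 2] is of order [delta] on
    average, and it contracts at rate [2 delta / n], so that after [tn] more steps it
    has its equilibrium order [1 / (delta n)].  Then two independent copies of the
    birth-and-death chain [S] at distance [h] are coupled within [O(h ^ 2)] steps,
    which takes [gam * w] steps because typical distances are [sqrt w] in units of
    spin flips, and once the magnetizations agree the pairs [(U, V)] and [(U', V')]
    are coupled in the same way while keeping [U + V = U' + V'].  No process is
    coupled explicitly: for each coupling, a concave quadratic function of the
    distance is shown to dominate the oscillation of the iterates of the kernel.

    Lower bound.  Started at [S] of order [sqrt delta], the mean of [S] decays no
    faster than [(1 - delta / n) ^ t], up to third moment corrections, so at time
    [tn - gam * w] it still exceeds the stationary standard deviation by a factor
    [expR gam]; Chebyshev's inequality concludes.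

    Spectral gap.  The kernel contracts Lipschitz constants by [1 - delta / n], which
    bounds all eigenvalues; conversely the Rayleigh quotient of [S] is at least
    [1 - (1 + o(1)) delta / n]. *)

Require Import Defs.
From HB Require Import structures.
From mathcomp Require Import all_boot all_order all_algebra.
From mathcomp Require Import all_classical all_reals all_analysis.
From mathcomp Require Import ring lra zify.
Set Implicit Arguments. Unset Strict Implicit. Unset Printing Implicit Defensive.
Import Order.TTheory GRing.Theory Num.Theory.
Import numFieldNormedType.Exports.
Local Open Scope ring_scope.
Local Open Scope classical_set_scope.

(** Up to constants the drift of [S] is [- (delta * S + S ^ 3) / n]. The two terms balance at [S] of
    order [sqrt delta]: above, the cubic term brings [S] down within [O(n / delta)] steps; below,
    the decay is exponential at rate [delta / n]. Decaying from [sqrt delta] to the equilibrium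
    scale [(delta * n) ^ (-1/2)] takes [n / (2 delta) * ln (delta ^ 2 * n)] steps, the cutoff time,
    and [delta ^ 2 * n -> oo] says that the two scales separate. The certificates are optional
    stopping in disguise: a concave quadratic in the distance loses a fixed amount [c] on average
    per step, so the chances of exceeding distance [H] and of not meeting within [s] steps are of
    order [V / H ^ 2] and [V / (c * s)]. For iterates of the kernel this becomes an induction on
    [s]. An extreme start such as all pluses leaves one block empty, while the coupling of block
    counts needs minuses in both blocks; hence the preliminary burn-in. Everything must be uniform
    in [delta]; numerical constants are explicit but mostly not optimized. *)

(** * Hyperbolic tangent and heat-bath probabilities *)

Section Tanh.
Variable R : realType.
Implicit Types x y : R.

(** This is tanh, with a single exponential so that monotonicity and the bounds by 1 and -1 are
    immediate. *)
Definition th x : R := 1 - 2 / (expR (2 * x) + 1).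

Lemma expR_add1_gt0 x : 0 < expR x + 1.
Proof. by rewrite addr_gt0 ?expR_gt0. Qed.

Lemma is_derive_th x : is_derive x (1 : R) th (1 - th x ^+ 2).
Proof.
rewrite /th.
have h : expR (2 * x) + 1 != 0 by rewrite gt_eqF ?expR_add1_gt0.
have e : is_derive x (1 : R) (fun t : R => expR (2 * t) + 1) (2 * expR (2 * x)).
  apply: is_derive_eq; rewrite ?scaler0 ?addr0 ?add0r //.
  rewrite /GRing.scale /=; ring.
have e2 : is_derive x (1 : R) (fun t : R => (expR (2 * t) + 1)^-1)
  (- (expR (2 * x) + 1) ^- 2 *: (2 * expR (2 * x))).
  exact: is_deriveV.
apply: is_derive_eq; rewrite ?scaler0 ?addr0 ?add0r //.
rewrite /GRing.scale /=.
by field.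
Qed.

Lemma ge0_of_derive (F dF : R -> R) (x : R) :
  (forall y : R, is_derive y (1 : R) F (dF y)) ->
  (forall y, 0 <= y <= x -> 0 <= dF y) -> 0 <= x -> F 0 <= F x.
Proof.
move=> hF hd x0.
have [//|c cx] := @MVT_segment R F dF 0 x x0 (fun y _ => hF y).
  apply: continuous_subspaceT => y.
  by apply: differentiable_continuous; apply/derivable1_diffP; apply: ex_derive.
by rewrite subr0 => e; rewrite -subr_ge0 e mulr_ge0 // hd // (itvP cx).
Qed.

Lemma th0 : th 0 = 0.
Proof. rewrite /th mulr0 expR0; by field. Qed.

Lemma thN x : th (- x) = - th x.
Proof.
rewrite /th mulrN expRN; have h := expR_gt0 (2 * x).
set e := expR _ in h *; field; apply/andP; split; rewrite gt_eqF //; lra.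
Qed.

Lemma th_lt1 x : th x < 1.
Proof. by rewrite /th; have := divr_gt0 (@ltr0n R 2) (expR_add1_gt0 (2 * x)); lra. Qed.

Lemma th_gtN1 x : -1 < th x.
Proof. have := th_lt1 (- x); rewrite thN; lra. Qed.

Lemma ler_th x y : x <= y -> th x <= th y.
Proof.
move=> xy; rewrite /th lerD2l lerN2 ler_pM2l // lef_pV2 ?posrE ?expR_add1_gt0 //.
by rewrite lerD2r ler_expR ler_pM2l.
Qed.

Lemma th_ge0 x : 0 <= x -> 0 <= th x.
Proof. by move=> x0; rewrite -th0 ler_th. Qed.

Lemma th_lip x y : x <= y -> th y - th x <= y - x.
Proof.
move=> xy; pose F (t : R) := (t + x) - th (t + x).
have := @ge0_of_derive F (fun t => th (t + x) ^+ 2) (y - x).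
rewrite /F add0r subrK => H.
suff : x - th x <= y - th y by lra.
apply: H; last by rewrite subr_ge0.
  move=> t; rewrite /F.
  have e : is_derive t (1 : R) (fun t : R => t + x) 1.
    by apply: is_derive_eq; rewrite addr0.
  have e' : is_derive t (1 : R) (th \o (fun t : R => t + x)) (1 - th (t + x) ^+ 2).
    have := @is_derive1_comp R th (fun t : R => t + x) t _ _ (is_derive_th _) e.
    by rewrite /GRing.scale /= mulr1.
  have e2 := is_deriveB e e'.
  apply: is_derive_eq; lra.
by move=> t _; rewrite sqr_ge0.
Qed.

Lemma th_lip_norm x y : `|th x - th y| <= `|x - y|.
Proof.
wlog xy : x y / x <= y.
  move=> H; have [|/ltW] := leP x y; first exact: H.
  by rewrite distrC (distrC x); exact: H.
rewrite ler0_norm ?ler0_norm ?subr_le0 ?ler_th //; have := th_lip xy; lra.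
Qed.

Lemma th_le x : 0 <= x -> th x <= x.
Proof. by move=> /th_lip; rewrite th0 !subr0. Qed.

Lemma th_ge_cubic x : 0 <= x -> x - x ^+ 3 / 3 <= th x.
Proof.
move=> x0; pose F (t : R) := th t - (t - t ^+ 3 / 3).
have := @ge0_of_derive F (fun t => t ^+ 2 - th t ^+ 2) x.
rewrite /F th0 => H.
suff : 0 - (0 - 0 ^+ 3 / 3) <= th x - (x - x ^+ 3 / 3) by lra.
apply: H => //.
  move=> t; rewrite /F.
  have e := is_derive_th t.
  apply: is_derive_eq; rewrite /GRing.scale /=; by field.
move=> t /andP[t0 _]; rewrite subr_ge0 lerXn2r ?nnegrE ?th_ge0 ?th_le //.
Qed.

(** On the unit interval the cubic lower bound gives [th t >= 2/3 * t], so the derivative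
    [1 - th t ^ 2] is at most [1 - 4/9 * t ^ 2]; integration produces [4 / 27]. This is the
    dissipation that survives when [delta] vanishes. *)
Lemma th_le_cubic x : 0 <= x <= 1 -> th x <= x - 4 / 27 * x ^+ 3.
Proof.
move=> /andP[x0 x1]; pose F (t : R) := (t - 4 / 27 * t ^+ 3) - th t.
have := @ge0_of_derive F (fun t => th t ^+ 2 - 4 / 9 * t ^+ 2) x.
rewrite /F th0 => H.
suff : 0 - 4 / 27 * 0 ^+ 3 - 0 <= (x - 4 / 27 * x ^+ 3) - th x by lra.
apply: H => //.
  move=> t; rewrite /F.
  have e := is_derive_th t.
  apply: is_derive_eq; rewrite /GRing.scale /=; by field.
move=> t /andP[t0 tx].
have h : 2 / 3 * t <= th t by apply: le_trans (th_ge_cubic t0); nra.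
nra.
Qed.

(* Probability that the heat bath picks [+1] in a local field [x]. *)
Definition lg x : R := (1 + th x) / 2.

Lemma lg_gt0 x : 0 < lg x.
Proof. by rewrite /lg; have := th_gtN1 x; lra. Qed.

Lemma lg_lt1 x : lg x < 1.
Proof. by rewrite /lg; have := th_lt1 x; lra. Qed.

Lemma lgN x : lg (- x) = 1 - lg x.
Proof. by rewrite /lg thN; field. Qed.

Lemma lgE a b : lg ((a - b) / 2) = expR a / (expR a + expR b).
Proof.
have e : 2 * ((a - b) / 2) = a - b by field.
rewrite /lg /th e expRB; have := expR_gt0 a; have := expR_gt0 b.
set u := expR a; set v := expR b => v0 u0; field.
by rewrite !gt_eqF //; lra.
Qed.

Lemma ler_lg x y : x <= y -> lg x <= lg y.
Proof. by move=> /ler_th; rewrite /lg; lra. Qed.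

Lemma lg_lip x y : x <= y -> lg y - lg x <= (y - x) / 2.
Proof. by move=> /th_lip; rewrite /lg; lra. Qed.

End Tanh.

(** * The heat-bath chain *)

Section Glauber.
Variables (R : realType) (n : nat) (beta : R).
Hypothesis n_gt0 : (0 < n)%N.
Implicit Types (s t : config n) (i j : 'I_n) (b : bool) (f g : config n -> R).

Let n_neq0 : n%:R != 0 :> R.
Proof. by rewrite pnatr_eq0 -lt0n. Qed.

Definition sp b : R := if b then 1 else -1.

Definition magn s : R := \sum_i spin R s i.

Lemma spin_sqr s i : spin R s i ^+ 2 = 1.
Proof. by rewrite /spin; case: (s i); rewrite ?sqrrN expr1n. Qed.

Lemma spin_setspin s i j b :
  spin R (setspin s i b) j = if j == i then sp b else spin R s j.
Proof. by rewrite /spin ffunE; case: eqP. Qed.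

Lemma setspin_id s i : setspin s i (s i) = s.
Proof. by apply/ffunP => j; rewrite ffunE; case: eqP => // ->. Qed.

Lemma setspin_setspin s i b b' : setspin (setspin s i b) i b' = setspin s i b'.
Proof. by apply/ffunP => j; rewrite !ffunE; case: eqP. Qed.

Lemma setspinC s i j b b' : i != j ->
  setspin (setspin s i b) j b' = setspin (setspin s j b') i b.
Proof.
move=> ij; apply/ffunP => k; rewrite !ffunE.
by have [->|//] := eqVneq k j; rewrite eq_sym (negbTE ij).
Qed.

Lemma magn_setspin s i b : magn (setspin s i b) = magn s - spin R s i + sp b.
Proof.
rewrite /magn (bigD1 i) //= [in RHS](bigD1 i) //= spin_setspin eqxx.
rewrite (eq_bigr (fun j => spin R s j)) => [|j /negbTE ji].
  by ring.
by rewrite spin_setspin ji.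
Qed.

(** Spins square to 1, so the squared magnetization is twice the pair sum plus [n]. Hence the heat
    bath sees only the magnetization and the updated spin. *)
Lemma energyE s : cw_energy beta s = beta / (2 * n%:R) * (magn s ^+ 2 - n%:R).
Proof.
rewrite /cw_energy.
set E := \sum_(x < n) _.
suff -> : magn s ^+ 2 = 2 * E + n%:R by field.
have eE : E = \sum_(x < n) \sum_(y < n | (y < x)%N) spin R s x * spin R s y.
  rewrite /E (exchange_big_dep predT) //=.
  by apply: eq_bigr => x _; apply: eq_bigr => y _; rewrite mulrC.
have -> : 2 * E + n%:R = \sum_(x < n) (\sum_(y < n | (x < y)%N) spin R s x * spin R s y
   + \sum_(y < n | (y < x)%N) spin R s x * spin R s y + 1).
  rewrite !big_split /= -eE -/E sumr_const card_ord; ring.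
rewrite expr2 {1}/magn mulr_suml; apply: eq_bigr => x _.
rewrite /magn mulr_sumr (bigD1 x) //= -expr2 spin_sqr addrC; congr (_ + _).
rewrite (bigID (fun y : 'I_n => (x < y)%N)) /=; congr (_ + _); apply: eq_bigl => y.
  by case: ltngtP => // xy; rewrite ?andbT ?andbF //; apply/eqP => e; rewrite e ltnn in xy.
by rewrite -leqNgt [RHS]ltn_neqAle.
Qed.

(** Subtracting the spin at [i] makes this independent of that spin, as a conditional probability
    given the others must be. *)
Definition prs s i : R := lg (beta * (magn s - spin R s i) / n%:R).

Lemma weight_gt0 s : 0 < cw_weight beta s.
Proof. exact: expR_gt0. Qed.

Lemma partition_gt0 : 0 < \sum_(t : config n) cw_weight beta t.
Proof.
rewrite (bigD1 [ffun=> true]) //= ltr_wpDr ?weight_gt0 // sumr_ge0 // => t _.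
exact/ltW/weight_gt0.
Qed.

Lemma mu_gt0 s : 0 < cw_mu beta s.
Proof. by rewrite divr_gt0 ?weight_gt0 ?partition_gt0. Qed.

Lemma mu_sum1 : \sum_(s : config n) cw_mu beta s = 1.
Proof. by rewrite -mulr_suml divff // gt_eqF ?partition_gt0. Qed.

Lemma heat_bathE s i b :
  heat_bath beta s i b = if b then prs s i else 1 - prs s i.
Proof.
have H c : cw_mu beta (setspin s i c) /
    (cw_mu beta (setspin s i true) + cw_mu beta (setspin s i false)) =
  lg ((cw_energy beta (setspin s i c) - cw_energy beta (setspin s i (~~ c))) / 2).
  rewrite lgE -/(cw_weight _ _) -/(cw_weight _ _).
  have Z0 := partition_gt0; have a0 := weight_gt0 (setspin s i true).
  have b0 := weight_gt0 (setspin s i false).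
  rewrite /cw_mu; case: c => /=; set Z := \sum_t _ in Z0 *.
    field; rewrite !gt_eqF //; lra.
  by field; rewrite !gt_eqF //; lra.
rewrite /heat_bath H !energyE !magn_setspin /prs; case: b => /=.
  by congr (lg _); rewrite /sp; field.
by rewrite -lgN; congr (lg _); rewrite /sp; field.
Qed.

(** The transition operator acting on functions, with the matrix eliminated; [Ex k f s] below is
    then the expectation of [f] after [k] steps from [s]. *)
Definition gstep f s : R := n%:R^-1 *
  \sum_i (prs s i * f (setspin s i true) + (1 - prs s i) * f (setspin s i false)).

Lemma glauber_gstep f s : \sum_(t : config n) glauber beta s t * f t = gstep f s.
Proof.
rewrite /gstep /glauber.
under eq_bigr do rewrite -mulrA mulr_suml.
rewrite -mulr_sumr exchange_big /=; congr (_ * _); apply: eq_bigr => i _.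
under eq_bigr do rewrite mulr_suml.
rewrite exchange_big /= big_bool /= !heat_bathE /=; congr (_ + _).
  rewrite (bigD1 (setspin s i true)) //= eqxx big1 ?addr0 // => t /negbTE ->.
  by rewrite mul0r.
rewrite (bigD1 (setspin s i false)) //= eqxx big1 ?addr0 // => t /negbTE ->.
by rewrite mul0r.
Qed.

Lemma eq_gstep f g : f =1 g -> gstep f =1 gstep g.
Proof. by move=> fg s; rewrite /gstep; congr (_ * _); apply: eq_bigr => i _; rewrite !fg. Qed.

Definition Ex (k : nat) f : config n -> R := iter k gstep f.

Lemma glauber_distE k f s : \sum_(t : config n) glauber_dist beta s k t * f t = Ex k f s.
Proof.
elim: k f => [|k IH] f /=.
  rewrite (bigD1 s) //= eqxx mul1r big1 ?addr0 // => t /negbTE ->.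
  by rewrite mul0r.
under eq_bigr do rewrite mulr_suml.
rewrite exchange_big /=.
under eq_bigr => r _.
  under eq_bigr do rewrite -mulrA.
  rewrite -mulr_sumr glauber_gstep; over.
by rewrite IH /Ex -iterSr.
Qed.

Lemma prs_gt0 s i : 0 < prs s i. Proof. exact: lg_gt0. Qed.
Lemma prs_lt1 s i : prs s i < 1. Proof. exact: lg_lt1. Qed.

Lemma gstep_le f g : (forall s, f s <= g s) -> forall s, gstep f s <= gstep g s.
Proof.
move=> fg s; rewrite /gstep ler_pM2l ?invr_gt0 ?ltr0n //; apply: ler_sum => i _.
apply: lerD; apply: ler_wpM2l; rewrite ?fg //; first exact/ltW/prs_gt0.
by rewrite subr_ge0; exact/ltW/prs_lt1.
Qed.

Lemma gstep_lin (a c : R) f g s :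
  gstep (fun t => a * f t + c * g t) s = a * gstep f s + c * gstep g s.
Proof.
have E (v x y : R) : a * (v * x) + c * (v * y) = v * (a * x + c * y) by ring.
rewrite /gstep E; congr (_ * _); rewrite !mulr_sumr -big_split /=.
by apply: eq_bigr => i _; ring.
Qed.

Lemma gstep_cst (c : R) s : gstep (fun=> c) s = c.
Proof.
rewrite /gstep.
rewrite (eq_bigr (fun=> c)) => [|i _]; last by ring.
by rewrite sumr_const card_ord -[c *+ n]mulr_natr; field.
Qed.

Lemma Ex_le k f g : (forall s, f s <= g s) -> forall s, Ex k f s <= Ex k g s.
Proof. by move=> fg; elim: k => [|k IH] s //=; apply: gstep_le. Qed.

Lemma eq_Ex k f g : f =1 g -> Ex k f =1 Ex k g.
Proof. by move=> fg; elim: k => [|k IH] s //=; apply: eq_gstep. Qed.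

Lemma Ex_lin k (a c : R) f g s :
  Ex k (fun t => a * f t + c * g t) s = a * Ex k f s + c * Ex k g s.
Proof.
elim: k s => [|k IH] s //=; rewrite -gstep_lin; exact: eq_gstep.
Qed.

Lemma Ex_cst k (c : R) s : Ex k (fun=> c) s = c.
Proof. by elim: k s => [|k IH] s //=; rewrite (eq_gstep IH) gstep_cst. Qed.

Lemma ExS k f s : Ex k.+1 f s = Ex k (gstep f) s.
Proof. by rewrite /Ex iterSr. Qed.

Lemma ExD k l f s : Ex (k + l) f s = Ex k (Ex l f) s.
Proof. by rewrite /Ex iterD. Qed.

Lemma ExN k f s : Ex k (fun t => - f t) s = - Ex k f s.
Proof.
have := Ex_lin k (-1) 0 f f s; rewrite [0 * Ex _ _ _]mul0r addr0 mulN1r => <-.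
by apply: eq_Ex => t; rewrite mul0r addr0 mulN1r.
Qed.

Lemma ExZ k (a : R) f s : Ex k (fun t => a * f t) s = a * Ex k f s.
Proof.
have := Ex_lin k a 0 f f s; rewrite [0 * Ex _ _ _]mul0r addr0 => <-.
by apply: eq_Ex => t; rewrite mul0r addr0.
Qed.

Lemma ExDf k f g s : Ex k (fun t => f t + g t) s = Ex k f s + Ex k g s.
Proof.
have := Ex_lin k 1 1 f g s; rewrite !mul1r => <-.
by apply: eq_Ex => t; rewrite !mul1r.
Qed.

Lemma ExB k f g s : Ex k (fun t => f t - g t) s = Ex k f s - Ex k g s.
Proof. by rewrite ExDf ExN. Qed.

Lemma Ex_norm k f s : `|Ex k f s| <= Ex k (fun t => `|f t|) s.
Proof.
rewrite ler_norml -ExN; apply/andP; split; apply: Ex_le => t; rewrite ?ler_norm //.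
by rewrite lerNl -normrN ler_norm.
Qed.

Lemma Ex_ge0 k f s : (forall t, 0 <= f t) -> 0 <= Ex k f s.
Proof. by move=> f0; rewrite -[leLHS](Ex_cst k 0 s); apply: Ex_le. Qed.

Lemma Ex_sqr_le k f s : Ex k f s ^+ 2 <= Ex k (fun t => f t ^+ 2) s.
Proof.
set m := Ex k f s; rewrite -subr_ge0.
suff <- : Ex k (fun t => (f t - m) ^+ 2) s = Ex k (fun t => f t ^+ 2) s - m ^+ 2.
  by apply: Ex_ge0 => t; exact: sqr_ge0.
rewrite (@eq_Ex k _ (fun t => f t ^+ 2 + ((- 2 * m) * f t + m ^+ 2))).
  by rewrite ExDf ExDf ExZ Ex_cst -/m; ring.
by move=> t /=; ring.
Qed.

Lemma Ex_step (a c : R) k f s : (forall t, gstep f t <= a * f t + c) ->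
  Ex k.+1 f s <= a * Ex k f s + c.
Proof.
move=> H; rewrite ExS; have := @Ex_le k _ (fun t => a * f t + c) H s.
by rewrite ExDf ExZ Ex_cst.
Qed.

End Glauber.

(** * Reversibility and contraction of Lipschitz constants *)

Section Reversible.
Variables (R : realType) (n : nat) (beta : R).
Hypothesis n_gt0 : (0 < n)%N.
Implicit Types (s t : config n) (i j : 'I_n) (b : bool) (f g : config n -> R).

Let n_neq0 : n%:R != 0 :> R.
Proof. by rewrite pnatr_eq0 -lt0n. Qed.

Let n_gt0R : 0 < n%:R :> R.
Proof. by rewrite ltr0n. Qed.

Definition Emu f : R := \sum_s cw_mu beta s * f s.

(** Configurations are paired by flipping [i]; each pair is counted by both of its members, whence
    the factor 1/2. *)
Lemma sum_setspin (h : config n -> R) i :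
  \sum_s h s = 2^-1 * \sum_s (h (setspin s i true) + h (setspin s i false)).
Proof.
pose flip s := setspin s i (~~ s i).
have flipK : involutive flip.
  move=> s; rewrite /flip setspin_setspin -[RHS](setspin_id s i).
  by congr (setspin _ _ _); rewrite ffunE eqxx negbK.
have -> : \sum_s (h (setspin s i true) + h (setspin s i false))
    = \sum_s (h s + h (flip s)).
  apply: eq_bigr => s _; rewrite /flip -{3}(setspin_id s i).
  by case: (s i) => //=; rewrite addrC.
have e : \sum_s h (flip s) = \sum_s h s by rewrite [RHS](reindex_inj (inv_inj flipK)).
by rewrite big_split /= e; field.
Qed.

Lemma prs_mu s i : prs beta s i = cw_mu beta (setspin s i true) /
  (cw_mu beta (setspin s i true) + cw_mu beta (setspin s i false)).
Proof. by rewrite -[LHS](heat_bathE beta n_gt0 s i true). Qed.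

Lemma prs_setspin s i b : prs beta (setspin s i b) i = prs beta s i.
Proof. by rewrite /prs magn_setspin spin_setspin eqxx addrK. Qed.

(** Detailed balance, checked one site at a time: the update at [i] is the conditional expectation
    under [mu] given the other spins, an orthogonal projection. *)
Lemma Emu_gstepA f g :
  Emu (fun s => f s * gstep beta g s) = Emu (fun s => gstep beta f s * g s).
Proof.
pose e f i s := prs beta s i * f (setspin s i true) + (1 - prs beta s i) * f (setspin s i false).
have H i : \sum_s cw_mu beta s * (f s * e g i s) = \sum_s cw_mu beta s * (e f i s * g s).
  rewrite (sum_setspin _ i) [RHS](sum_setspin _ i); congr (_ * _).
  apply: eq_bigr => s _; rewrite /e !prs_setspin !setspin_setspin prs_mu.
  have := mu_gt0 beta (setspin s i true); have := mu_gt0 beta (setspin s i false).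
  set u := cw_mu _ _; set v := cw_mu _ _ => u0 v0.
  by field; rewrite gt_eqF //; lra.
transitivity (n%:R^-1 * \sum_i \sum_s cw_mu beta s * (f s * e g i s)).
  rewrite exchange_big mulr_sumr; apply: eq_bigr => s _ /=.
  by rewrite /gstep -/(e g) -!mulr_sumr; ring.
under eq_bigr do rewrite H.
rewrite exchange_big mulr_sumr; apply: eq_bigr => s _ /=.
by rewrite /gstep -mulr_sumr -mulr_suml; ring.
Qed.

Lemma Emu_gstep f : Emu (gstep beta f) = Emu f.
Proof.
have := Emu_gstepA (fun=> 1) f; rewrite /Emu.
under eq_bigr do rewrite mul1r; move=> ->.
by apply: eq_bigr => s _; rewrite gstep_cst // mul1r.
Qed.

Lemma Emu_ExA k f g :
  Emu (fun s => f s * Ex beta k g s) = Emu (fun s => Ex beta k f s * g s).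
Proof.
elim: k f g => [|k IH] f g //.
rewrite [RHS](eq_bigr (fun s => cw_mu beta s * (Ex beta k (gstep beta f) s * g s))).
  by rewrite -/(Emu _) -IH -Emu_gstepA.
by move=> s _; rewrite ExS.
Qed.

Lemma Emu_Ex k f : Emu (Ex beta k f) = Emu f.
Proof. by elim: k => // k IH; rewrite /= Emu_gstep. Qed.

Lemma Emu_le f g : (forall s, f s <= g s) -> Emu f <= Emu g.
Proof. by move=> fg; apply: ler_sum => s _; rewrite ler_pM2l ?mu_gt0. Qed.

Lemma eq_Emu f g : f =1 g -> Emu f = Emu g.
Proof. by move=> fg; apply: eq_bigr => s _; rewrite fg. Qed.

Lemma EmuD f g : Emu (fun s => f s + g s) = Emu f + Emu g.
Proof. by rewrite /Emu -big_split; apply: eq_bigr => s _ /=; rewrite mulrDr. Qed.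

Lemma EmuZ (a : R) f : Emu (fun s => a * f s) = a * Emu f.
Proof. by rewrite /Emu mulr_sumr; apply: eq_bigr => s _; rewrite mulrCA. Qed.

Lemma EmuN f : Emu (fun s => - f s) = - Emu f.
Proof. by rewrite -mulN1r -EmuZ; apply: eq_Emu => s; rewrite mulN1r. Qed.

Lemma EmuB f g : Emu (fun s => f s - g s) = Emu f - Emu g.
Proof. by rewrite EmuD EmuN. Qed.

Lemma Emu_cst (c : R) : Emu (fun=> c) = c.
Proof. by rewrite /Emu -mulr_suml mu_sum1 mul1r. Qed.

Lemma Emu_step (a c : R) f : (forall t, gstep beta f t <= a * f t + c) ->
  Emu f <= a * Emu f + c.
Proof.
move=> H; rewrite -{1}Emu_gstep; apply: le_trans (Emu_le H) _.
by rewrite EmuD EmuZ Emu_cst.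
Qed.

Definition lipc (L : R) f :=
  forall i s, `|f (setspin s i true) - f (setspin s i false)| <= L.

Lemma prs_setspin_other s i j : i != j -> 0 <= beta ->
  0 <= prs beta (setspin s i true) j - prs beta (setspin s i false) j <= beta / n%:R.
Proof.
move=> ij b0; rewrite /prs !magn_setspin !spin_setspin eq_sym (negbTE ij).
set x := _ - spin R s i; set y := spin R s j.
have e : beta * (x + sp R true - y) / n%:R - beta * (x + sp R false - y) / n%:R
   = 2 * (beta / n%:R) by rewrite /sp; field.
have h : 0 <= beta / n%:R by rewrite divr_ge0.
have xy : beta * (x + sp R false - y) / n%:R <= beta * (x + sp R true - y) / n%:R.
  by rewrite -subr_ge0 e; lra.
have := ler_lg xy; have := lg_lip xy; rewrite e; lra.
Qed.

(** Take two configurations that differ at [i]. Updating [i] removes the difference; updating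
    another [j] keeps it and creates a second one with probability at most [beta / n]. The average
    [(1 - 1 / n) * (1 + beta / n)] is at most [1 - (1 - beta) / n]. *)
Lemma lipc_gstep (L : R) f : 0 <= beta -> lipc L f ->
  lipc ((1 - (1 - beta) / n%:R) * L) (gstep beta f).
Proof.
move=> b0 fL i s.
have L0 : 0 <= L by apply: le_trans (fL i s).
rewrite /gstep -mulrBr -sumrB normrM gtr0_norm ?invr_gt0 //.
pose c j := if j == i then 0 else (1 + beta / n%:R) * L.
apply: (@le_trans _ _ (n%:R^-1 * \sum_j c j)).
  rewrite ler_pM2l ?invr_gt0 //; apply: le_trans (ler_norm_sum _ _ _) _.
  apply: ler_sum => j _; rewrite /c; have [->|ji] := eqVneq j i.
    by rewrite !prs_setspin !setspin_setspin subrr normr0.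
  have ij : i != j by rewrite eq_sym.
  have /andP[] := prs_setspin_other s ij b0.
  have := prs_gt0 beta (setspin s i true) j; have := prs_lt1 beta (setspin s i true) j.
  have h1 := fL i (setspin s j true); have h2 := fL i (setspin s j false).
  have h3 := fL j (setspin s i false).
  rewrite !(setspinC _ _ _ ji) in h1 h2.
  set q := prs _ (setspin s i true) _; set p := prs _ (setspin s i false) _.
  move: h1 h2 h3.
  set att := f (setspin (setspin s i true) j true).
  set atf := f (setspin (setspin s i true) j false).
  set aft := f (setspin (setspin s i false) j true).
  set aff := f (setspin (setspin s i false) j false).
  clearbody q p att atf aft aff; move=> h1 h2 h3 p1 q0 pq qp.
  (* The monotone coupling of the two updates of [j]: [q - p] is the probability that they
     disagree. *)
  have -> : q * att + (1 - q) * atf - (p * aft + (1 - p) * aff) =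
    q * (att - aft) + (1 - q) * (atf - aff) + (q - p) * (aft - aff) by ring.
  apply: le_trans (ler_normD _ _) _; apply: le_trans (lerD (ler_normD _ _) (lexx _)) _.
  rewrite !normrM (gtr0_norm q0) (ger0_norm pq) (@gtr0_norm _ (1 - q)) ?subr_gt0 //.
  have -> : (1 + beta / n%:R) * L = q * L + (1 - q) * L + beta / n%:R * L by ring.
  apply: lerD; first by apply: lerD; apply: ler_wpM2l => //; lra.
  by apply: ler_pM.
rewrite (bigD1 i) //= {1}/c eqxx add0r.
rewrite (eq_bigr (fun=> (1 + beta / n%:R) * L)) => [|j /negbTE]; last by rewrite /c => ->.
have e : \sum_(j < n | j != i) (1 + beta / n%:R) * L = (n%:R - 1) * ((1 + beta / n%:R) * L).
  have : \sum_(j < n) (1 + beta / n%:R) * L = n%:R * ((1 + beta / n%:R) * L).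
    by rewrite sumr_const card_ord mulr_natl.
  by rewrite (bigD1 i) //= => h; rewrite mulrBl mul1r -h; ring.
rewrite e -subr_ge0.
have -> : (1 - (1 - beta) / n%:R) * L - n%:R^-1 * ((n%:R - 1) * ((1 + beta / n%:R) * L))
   = beta * L / (n%:R * n%:R) by field.
by rewrite divr_ge0 ?mulr_ge0.
Qed.

(* Two configurations are joined by changing the spins one at a time. *)
Lemma lipc0_cst f : lipc 0 f -> forall s t, f s = f t.
Proof.
move=> f0 s t.
have H i b u : f (setspin u i b) = f u.
  have e : f (setspin u i true) = f (setspin u i false).
    by apply/eqP; rewrite -subr_eq0 -normr_eq0 eq_le normr_ge0 f0.
  by rewrite -[in RHS](setspin_id u i); case: b (u i) => [] [].
suff K (r : seq 'I_n) : f [ffun j => if j \in r then t j else s j] = f s.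
  rewrite -(K (enum 'I_n)); congr f; apply/ffunP => j; rewrite ffunE.
  by rewrite mem_enum.
elim: r => [|i r IH]; first by congr f; apply/ffunP => j; rewrite ffunE in_nil.
rewrite -IH -[RHS](H i (t i)); congr f; apply/ffunP => j; rewrite !ffunE in_cons.
by case: eqP => [->|].
Qed.

(** The kernel multiplies the largest single-flip variation [L] of an eigenfunction by [|a|], and
    contracts it as well; [L] is positive because [f] is not constant. *)
Lemma lipc_abs_eigen (a : R) f : 0 <= beta -> ~ (forall s t, f s = f t) ->
  (forall s, gstep beta f s = a * f s) -> `|a| <= 1 - (1 - beta) / n%:R.
Proof.
move=> b0 fn0 ef.
have i0 : 'I_n by exact: (Ordinal n_gt0).
pose D (p : 'I_n * config n) := `|f (setspin p.2 p.1 true) - f (setspin p.2 p.1 false)|.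
have [[i s] _ hmax] := @arg_maxP _ R ('I_n * config n)%type (i0, [ffun=> true]) predT D isT.
set L := D (i, s) in hmax.
have fL : lipc L f by move=> j t; apply: (hmax (j, t)).
have L0 : 0 < L.
  rewrite lt_def normr_ge0 andbT; apply/eqP => L0; rewrite L0 in fL.
  exact: fn0 (lipc0_cst fL).
have := lipc_gstep b0 fL i s; rewrite !ef -mulrBr normrM -/(D (i, s)) -/L.
by rewrite ler_pM2r.
Qed.

(* The quadratic variation of the martingale [k |-> P^(k - t) f (X_t)] is controlled
   by the contraction of the Lipschitz constant. *)
Lemma Ex_var (L : R) f k s : 0 <= beta <= 1 -> lipc L f -> 0 <= L ->
  Ex beta k (fun t => f t ^+ 2) s - Ex beta k f s ^+ 2 <=
  L ^+ 2 * \sum_(j < k) (1 - (1 - beta) / n%:R) ^+ j.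
Proof.
move=> /andP[b0 b1]; set r := 1 - _.
have d0 : 0 <= (1 - beta) / n%:R by rewrite divr_ge0 ?subr_ge0.
have d1 : (1 - beta) / n%:R <= 1.
  rewrite ler_pdivrMr // mul1r; have : 1 <= n%:R :> R by rewrite ler1n.
  lra.
have r0 : 0 <= r by rewrite subr_ge0.
have r1 : r <= 1 by rewrite /r gerBl.
elim: k L f s => [|k IH] L f s fL L0; first by rewrite subrr big_ord0 mulr0.
rewrite !ExS.
have h t : gstep beta (fun t => f t ^+ 2) t - gstep beta f t ^+ 2 <= L ^+ 2.
  have e : gstep beta (fun u => (f u - f t) ^+ 2) t = gstep beta (fun u => f u ^+ 2) t
       + ((- 2 * f t) * gstep beta f t + f t ^+ 2).
    have := @ExDf _ _ beta 1 (fun u => f u ^+ 2) (fun u => (- 2 * f t) * f u + f t ^+ 2) t.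
    rewrite (@ExDf _ _ beta 1 (fun u => (- 2 * f t) * f u)) ExZ Ex_cst // /Ex /= => <-.
    by apply: eq_gstep => u /=; ring.
  apply: (@le_trans _ _ (gstep beta (fun u => (f u - f t) ^+ 2) t)).
    by rewrite e; have := sqr_ge0 (gstep beta f t - f t); nra.
  rewrite -[leRHS](gstep_cst beta n_gt0 (L ^+ 2) t) /gstep ler_pM2l ?invr_gt0 //.
  have fL' i b : (f (setspin t i b) - f t) ^+ 2 <= L ^+ 2.
    rewrite -real_normK ?num_real // lerXn2r ?nnegrE //.
    rewrite -{2}(setspin_id t i); have := fL i t.
    by case: b (t i) => [] [] //; rewrite ?subrr ?normr0 // distrC.
  apply: ler_sum => i _; have := prs_gt0 beta t i; have := prs_lt1 beta t i.
  by move=> p1 p0; apply: lerD; rewrite ler_pM2l // subr_gt0.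
have fr : lipc (r * L) (gstep beta f) by apply: lipc_gstep.
have := IH _ _ s fr (mulr_ge0 r0 L0).
have : Ex beta k (gstep beta (fun t => f t ^+ 2)) s <=
    Ex beta k (fun t => gstep beta f t ^+ 2) s + L ^+ 2.
  rewrite -[X in _ + X](Ex_cst beta n_gt0 k _ s) -ExDf.
  by apply: Ex_le => // t; have := h t; lra.
have -> : \sum_(j < k.+1) r ^+ j = 1 + r * \sum_(j < k) r ^+ j.
  by rewrite big_ord_recl expr0 mulr_sumr; congr (_ + _); apply: eq_bigr => j _; rewrite -exprS.
set Sg := \sum_(j < k) _.
have S0 : 0 <= Sg by apply: sumr_ge0 => j _; apply: exprn_ge0.
rewrite exprMn => h1 h2.
have : r ^+ 2 * L ^+ 2 * Sg <= r * L ^+ 2 * Sg.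
  by do 2 (apply: ler_wpM2r => //); rewrite ?sqr_ge0 // expr2 ler_piMr.
lra.
Qed.

End Reversible.

(** * Magnetization and block chains *)

Section Lumping.
Variables (R : realType) (n : nat) (beta : R).
Implicit Types (s A : config n) (i : 'I_n) (k l U V : nat).

(** With [k] pluses the magnetization is [2 k - n]; the [+ 1] discards a minus about to be updated,
    the [- 1] in [down_rate] a plus. *)
Definition up_rate k : R := lg (beta * (2 * k%:R - n%:R + 1) / n%:R).
Definition down_rate k : R := 1 - lg (beta * (2 * k%:R - n%:R - 1) / n%:R).

(* The action of the chain on functions of [(U, V)], where [U] and [V] count the
   pluses inside and outside a fixed set of [a] vertices, and [a + b = n]. *)
Definition bstep (a b : nat) (G : nat -> nat -> R) U V : R :=
  G U V
  + up_rate (U + V) / n%:R *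
    ((a%:R - U%:R) * (G U.+1 V - G U V) + (b%:R - V%:R) * (G U V.+1 - G U V))
  + down_rate (U + V) / n%:R *
    (U%:R * (G U.-1 V - G U V) + V%:R * (G U V.-1 - G U V)).

Definition birth k : R := (1 - k%:R / n%:R) * up_rate k.
Definition death k : R := k%:R / n%:R * down_rate k.

(** The magnetization chain in the coordinate [k], the number of pluses. The truncation [0.-1 = 0]
    is harmless since [death 0 = 0]. *)
Definition mstep (F : nat -> R) k : R :=
  F k + birth k * (F k.+1 - F k) + death k * (F k.-1 - F k).

Definition pluses s : nat := \sum_i s i.
Definition pluses_in A s : nat := \sum_i (A i && s i).
Definition pluses_out A s : nat := \sum_i (~~ A i && s i).
Definition minuses s : nat := \sum_i ~~ s i.

Lemma pluses_minuses s : (pluses s + minuses s)%N = n.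
Proof.
rewrite /pluses /minuses -big_split /= (eq_bigr (fun=> 1%N)) => [|i _]; last by case: (s i).
by rewrite sum_nat_const card_ord muln1.
Qed.

Lemma pluses_split A s : (pluses_in A s + pluses_out A s)%N = pluses s.
Proof. by rewrite -big_split; apply: eq_bigr => i _ /=; case: (A i); rewrite ?addn0. Qed.

Lemma pluses_in_le A s : (pluses_in A s <= pluses A)%N.
Proof. by apply: leq_sum => i _; case: (A i) => //=; case: (s i). Qed.

Lemma pluses_out_le A s : (pluses_out A s <= minuses A)%N.
Proof. by apply: leq_sum => i _; case: (A i) => //=; case: (s i). Qed.

Lemma pluses_le s : (pluses s <= n)%N.
Proof. by rewrite -[leqRHS](pluses_minuses s) leq_addr. Qed.

Lemma pluses_in_self A : pluses_in A A = pluses A.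
Proof. by apply: eq_bigr => i _; rewrite andbb. Qed.

Lemma pluses_out_self A : pluses_out A A = 0%N.
Proof. by rewrite /pluses_out big1 // => i _; rewrite andNb. Qed.

Lemma pluses_in_out_self A s :
  pluses_in A s = pluses A -> pluses_out A s = 0%N -> s = A.
Proof.
move=> hi /eqP; rewrite sum_nat_eq0 => /forallP ho.
apply/ffunP => i; have := ho i; rewrite implyTb; case Ai : (A i) => /=; last first.
  by case: (s i).
move=> _; apply/negPn/negP => si.
have : (pluses_in A s < pluses A)%N; last by rewrite hi ltnn.
rewrite /pluses_in /pluses (bigD1 i) //= [ltnRHS](bigD1 i) //= Ai (negbTE si) /= add0n add1n ltnS.
by apply: leq_sum => j _; case: (A j) => //=; case: (s j).
Qed.

Lemma magnE s : magn R s = 2 * (pluses s)%:R - n%:R.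
Proof.
have e : n%:R = (pluses s)%:R + (minuses s)%:R :> R by rewrite -natrD pluses_minuses.
have -> : magn R s = (pluses s)%:R - (minuses s)%:R; last by rewrite e; ring.
rewrite /pluses /minuses !natr_sum -sumrB; apply: eq_bigr => i _.
by rewrite /spin; case: (s i); rewrite /= ?subr0 ?sub0r.
Qed.

Lemma pluses_in_setspin A s i b :
  (pluses_in A (setspin s i b) + (A i && s i) = pluses_in A s + (A i && b))%N.
Proof.
rewrite /pluses_in (bigD1 i) //= [in RHS](bigD1 i) //= ffunE eqxx.
rewrite (eq_bigr (fun j : 'I_n => nat_of_bool (A j && s j))) => [|j /negbTE ji].
  by lia.
by rewrite ffunE ji.
Qed.

Lemma pluses_out_setspin A s i b :
  (pluses_out A (setspin s i b) + (~~ A i && s i) = pluses_out A s + (~~ A i && b))%N.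
Proof.
rewrite /pluses_out (bigD1 i) //= [in RHS](bigD1 i) //= ffunE eqxx.
rewrite (eq_bigr (fun j : 'I_n => nat_of_bool (~~ A j && s j))) => [|j /negbTE ji].
  by lia.
by rewrite ffunE ji.
Qed.

Lemma sum_by_class A s (Phi : bool -> bool -> R) :
  \sum_i Phi (A i) (s i) =
  (pluses_in A s)%:R * Phi true true
  + ((pluses A)%:R - (pluses_in A s)%:R) * Phi true false
  + (pluses_out A s)%:R * Phi false true
  + ((minuses A)%:R - (pluses_out A s)%:R) * Phi false false.
Proof.
rewrite /pluses_in /pluses_out /pluses /minuses !natr_sum -!sumrB !mulr_suml -!big_split.
apply: eq_bigr => i _ /=.
by case: (A i); case: (s i); rewrite /= ?subrr ?subr0 ?mul0r ?mul1r ?addr0 ?add0r.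
Qed.

Hypothesis n_gt0 : (0 < n)%N.

Let n_neq0 : n%:R != 0 :> R.
Proof. by rewrite pnatr_eq0 -lt0n. Qed.

(** The effect of updating a vertex on the two counts depends only on its block and its current
    spin, so the average over vertices collapses to four classes. *)
Lemma gstep_lump A (G : nat -> nat -> R) s :
  gstep beta (fun t => G (pluses_in A t) (pluses_out A t)) s =
  bstep (pluses A) (minuses A) G (pluses_in A s) (pluses_out A s).
Proof.
set U := pluses_in A s; set V := pluses_out A s; set k := (U + V)%N.
pose Phi (x y : bool) : R := G U V + (if y then
    down_rate k * (G (U - x)%N (V - ~~ x)%N - G U V)
  else up_rate k * (G (U + x)%N (V + ~~ x)%N - G U V)).
have -> : gstep beta (fun t => G (pluses_in A t) (pluses_out A t)) s =
    n%:R^-1 * \sum_i Phi (A i) (s i).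
  congr (_ * _); apply: eq_bigr => i _.
  have hk : pluses s = k by rewrite -(pluses_split A).
  have h1 := pluses_in_setspin A s i; have h2 := pluses_out_setspin A s i.
  have e : setspin s i (s i) = s := setspin_id s i.
  rewrite /prs magnE hk /spin /Phi.
  case si : (s i) e h1 h2 => e h1 h2; rewrite e -/U -/V.
    have -> : pluses_in A (setspin s i false) = (U - A i)%N.
      by have := h1 false; rewrite !andbF andbT -/U; lia.
    have -> : pluses_out A (setspin s i false) = (V - ~~ A i)%N.
      by have := h2 false; rewrite !andbF andbT -/V; lia.
    by rewrite /down_rate; ring.
  have -> : pluses_in A (setspin s i true) = (U + A i)%N.
    by have := h1 true; rewrite !andbF andbT -/U; lia.
  have -> : pluses_out A (setspin s i true) = (V + ~~ A i)%N.
    by have := h2 true; rewrite !andbF andbT -/V; lia.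
  by rewrite opprK /up_rate; ring.
rewrite sum_by_class -/U -/V /Phi /bstep -/k !addn0 !addn1 !subn0 !subn1 /=.
have -> : (minuses A)%:R = n%:R - (pluses A)%:R :> R.
  have e : n%:R = (pluses A)%:R + (minuses A)%:R :> R by rewrite -natrD pluses_minuses.
  by rewrite e; ring.
by field.
Qed.

Lemma Ex_lump A (G : nat -> nat -> R) k s :
  Ex beta k (fun t => G (pluses_in A t) (pluses_out A t)) s =
  iter k (bstep (pluses A) (minuses A)) G (pluses_in A s) (pluses_out A s).
Proof.
elim: k s => [//|k IH] s /=; rewrite -gstep_lump; exact: eq_gstep.
Qed.

Lemma bstep_sum a b (F : nat -> R) U V : (a + b)%N = n ->
  bstep a b (fun x y => F (x + y)%N) U V = mstep F (U + V).
Proof.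
move=> abn; rewrite /bstep /mstep /birth /death -abn addSn addnS.
have eU : U%:R * (F (U.-1 + V)%N - F (U + V)%N) = U%:R * (F (U + V).-1 - F (U + V)%N).
  by case: U => [|U]; rewrite ?mul0r.
have eV : V%:R * (F (U + V.-1)%N - F (U + V)%N) = V%:R * (F (U + V).-1 - F (U + V)%N).
  by case: V {eU} => [|V]; rewrite ?mul0r // addnS.
rewrite eU eV natrD; have : (a%:R + b%:R) != 0 :> R by rewrite -natrD abn.
by rewrite natrD => h; field.
Qed.

Lemma gstep_pluses (F : nat -> R) s :
  gstep beta (fun t => F (pluses t)) s = mstep F (pluses s).
Proof.
rewrite -(pluses_split s) -(@bstep_sum (pluses s) (minuses s)) ?pluses_minuses //.
by rewrite -gstep_lump; apply: eq_gstep => t; rewrite pluses_split.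
Qed.

Lemma Ex_pluses (F : nat -> R) k s :
  Ex beta k (fun t => F (pluses t)) s = iter k mstep F (pluses s).
Proof. by elim: k s => [//|k IH] s /=; rewrite -gstep_pluses; exact: eq_gstep. Qed.

End Lumping.

(** * One-step drift of the moments of the magnetization *)

Section Moments.
Variables (R : realType) (n : nat) (beta : R).
Hypothesis n_gt0 : (0 < n)%N.
Hypothesis beta01 : 0 <= beta <= 1.
Implicit Types (s : config n) (k : nat).

Let n_neq0 : n%:R != 0 :> R.
Proof. by rewrite pnatr_eq0 -lt0n. Qed.

Let n_gt0R : 0 < n%:R :> R.
Proof. by rewrite ltr0n. Qed.

Local Notation nu := (n%:R^-1 : R).

Let nu_gt0 : 0 < nu. Proof. by rewrite invr_gt0. Qed.

Definition sg k : R := (2 * k%:R - n%:R) / n%:R.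

Lemma sg_bound k : (k <= n)%N -> -1 <= sg k <= 1.
Proof.
move=> kn; have kn' : k%:R <= n%:R :> R by rewrite ler_nat.
have k0 : 0 <= k%:R :> R by [].
by rewrite /sg ler_pdivlMr // ler_pdivrMr //; lra.
Qed.

(** The fields that occur, multiplied by [beta <= 1], lie in [[-1, 1]], so [lg (-1)] bounds the
    heat-bath probabilities away from 0 and 1. *)
Definition c0 : R := lg (-1).

Lemma c0_gt0 : 0 < c0. Proof. exact: lg_gt0. Qed.

Lemma c0_le_half : c0 <= 2^-1.
Proof. by rewrite /c0 /lg thN; have := @th_ge0 R 1 ler01; lra. Qed.

Lemma up_rate_bound k : (k < n)%N -> c0 <= up_rate n beta k <= 1 - c0.
Proof.
move=> kn; have kn' : k%:R + 1 <= n%:R :> R by rewrite natr1 ler_nat.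
have k0 : 0 <= k%:R :> R by [].
rewrite /c0 -lgN opprK /up_rate.
have [b0 b1] := andP beta01.
have e : -1 <= ((2 * k%:R - n%:R + 1) / n%:R : R) <= 1.
  by rewrite ler_pdivlMr // ler_pdivrMr //; lra.
rewrite -mulrA; have [e1 e2] := andP e.
by apply/andP; split; apply: ler_lg; nra.
Qed.

Lemma down_rate_bound k : (0 < k <= n)%N -> c0 <= down_rate n beta k <= 1 - c0.
Proof.
move=> /andP[k0 kn]; have kn' : k%:R <= n%:R :> R by rewrite ler_nat.
have k0' : 1 <= k%:R :> R by rewrite ler1n.
rewrite /down_rate.
have [b0 b1] := andP beta01.
have e : -1 <= ((2 * k%:R - n%:R - 1) / n%:R : R) <= 1.
  by rewrite ler_pdivlMr // ler_pdivrMr //; lra.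
rewrite -mulrA; have [e1 e2] := andP e.
have h1 : c0 <= lg (beta * ((2 * k%:R - n%:R - 1) / n%:R)) by apply: ler_lg; nra.
have : lg (beta * ((2 * k%:R - n%:R - 1) / n%:R)) <= lg (- (- 1)) by apply: ler_lg; nra.
by rewrite lgN -/c0; lra.
Qed.

Lemma frac_bound k : (k <= n)%N -> 0 <= (k%:R / n%:R : R) <= 1.
Proof. by move=> kn; rewrite divr_ge0 //= ler_pdivrMr // mul1r ler_nat. Qed.

Lemma birth_bound k : (k <= n)%N ->
  (1 - k%:R / n%:R) * c0 <= birth n beta k <= (1 - k%:R / n%:R) * (1 - c0).
Proof.
rewrite leq_eqVlt => /orP[/eqP ->|kn]; first by rewrite /birth divff // subrr !mul0r lexx.
have /andP[_ h] := frac_bound (ltnW kn); have /andP[h1 h2] := up_rate_bound kn.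
by rewrite /birth; apply/andP; split; apply: ler_wpM2l => //; rewrite subr_ge0.
Qed.

Lemma death_bound k : (k <= n)%N ->
  k%:R / n%:R * c0 <= death n beta k <= k%:R / n%:R * (1 - c0).
Proof.
case: k => [|k] kn; first by rewrite /death !mul0r lexx.
have /andP[h _] := frac_bound kn; have /andP[h1 h2] := @down_rate_bound k.+1 kn.
by rewrite /death; apply/andP; split; apply: ler_wpM2l.
Qed.

(** At the end levels one of the two moves is absent, so only the sum of the rates is bounded below;
    the chain also holds with probability at least [c0]. *)
Lemma rates_bound k : (k <= n)%N ->
  [/\ 0 <= birth n beta k, 0 <= death n beta k,
      c0 <= birth n beta k + death n beta k & birth n beta k + death n beta k <= 1 - c0].
Proof.
move=> kn; have /andP[f0 f1] := frac_bound kn.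
have /andP[b0 b1] := birth_bound kn; have /andP[d0 d1] := death_bound kn.
have := c0_gt0; have := c0_le_half; split; nra.
Qed.

(** The mean displacement of [S] is [nu] times [2 * (birth - death)]. Excluding the updated spin
    shifts the local field by [beta * nu], and [th] is 1-Lipschitz, whence the error [nu]. *)
Lemma drift_bound k : (k <= n)%N ->
  `|2 * (birth n beta k - death n beta k) - (th (beta * sg k) - sg k)| <= nu.
Proof.
move=> kn; have /andP[s0 s1] := sg_bound kn; have [b0 b1] := andP beta01.
rewrite /birth /death /up_rate /down_rate /lg.
have -> : k%:R / n%:R = (1 + sg k) / 2 :> R by rewrite /sg; field.
have -> : beta * (2 * k%:R - n%:R + 1) / n%:R = beta * sg k + beta * nu.
  by rewrite /sg; field.
have -> : beta * (2 * k%:R - n%:R - 1) / n%:R = beta * sg k - beta * nu.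
  by rewrite /sg; field.
have h : beta * nu <= nu by rewrite ler_piMl // ltW.
have h0 : 0 <= beta * nu by rewrite mulr_ge0 // ltW.
have h1 : `|th (beta * sg k + beta * nu) - th (beta * sg k)| <= nu.
  apply: le_trans (th_lip_norm _ _) _; rewrite addrAC subrr add0r ger0_norm //.
have h2 : `|th (beta * sg k - beta * nu) - th (beta * sg k)| <= nu.
  by apply: le_trans (th_lip_norm _ _) _; rewrite addrAC subrr add0r normrN ger0_norm.
move: h1 h2; rewrite !ler_norml => /andP[p1 p2] /andP[m1 m2].
set x := th (_ + _) in p1 p2 *; set y := th (_ - _) in m1 m2 *; set z := th _ in p1 p2 m1 m2 *.
by apply/andP; split; nra.
Qed.

Lemma mstep_sg (f : R -> R) k : (k <= n)%N ->
  mstep n beta (fun j => f (sg j)) k = f (sg k)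
   + birth n beta k * (f (sg k + 2 * nu) - f (sg k))
   + death n beta k * (f (sg k - 2 * nu) - f (sg k)).
Proof.
move=> kn; rewrite /mstep; congr (_ + _ * (f _ - _) + _).
  by rewrite /sg -natr1; field.
case: k kn => [|k] kn; first by rewrite /death !mul0r.
by congr (_ * (f _ - _)); rewrite /sg /= -natr1; field.
Qed.

(** The first bound keeps the linear rate [1 - beta], the second the cubic dissipation that remains
    at [beta = 1]; the third serves the spectral gap and the fourth the lower bound on mixing.
    Oddness of [th] transfers the case [x >= 0] to negative [x]. *)
Lemma sth_bounds (x : R) : -1 <= x <= 1 ->
  [/\ x * th (beta * x) <= beta * x ^+ 2, x * th (beta * x) <= x ^+ 2 - 4 / 27 * x ^+ 4,
      beta * x ^+ 2 - x ^+ 4 / 3 <= x * th (beta * x) &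
      beta * x - `|x| ^+ 3 / 3 <= th (beta * x) ].
Proof.
have [b0 b1] := andP beta01.
have main y : 0 <= y <= 1 -> [/\ th (beta * y) <= beta * y,
     th (beta * y) <= y - 4 / 27 * y ^+ 3 & beta * y - y ^+ 3 / 3 <= th (beta * y) ].
  move=> /andP[y0 y1]; have by0 : 0 <= beta * y by rewrite mulr_ge0.
  have byy : beta * y <= y by rewrite ler_piMl.
  split; first exact: th_le.
    by apply: le_trans (ler_th byy) _; apply: th_le_cubic; rewrite y0.
  apply: le_trans (th_ge_cubic by0); rewrite lerD2l lerN2 ler_pM2r ?invr_gt0 //.
  by rewrite lerXn2r ?nnegrE.
have main2 y : 0 <= y <= 1 -> [/\ y * th (beta * y) <= beta * y ^+ 2,
     y * th (beta * y) <= y ^+ 2 - 4 / 27 * y ^+ 4 & beta * y ^+ 2 - y ^+ 4 / 3 <= y * th (beta * y) ].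
  move=> y01; have [h1 h2 h3] := main _ y01; have /andP[y0 y1] := y01.
  split.
  - have -> : beta * y ^+ 2 = y * (beta * y) by ring.
    exact: ler_wpM2l.
  - have -> : y ^+ 2 - 4 / 27 * y ^+ 4 = y * (y - 4 / 27 * y ^+ 3) by ring.
    exact: ler_wpM2l.
  - have -> : beta * y ^+ 2 - y ^+ 4 / 3 = y * (beta * y - y ^+ 3 / 3) by ring.
    exact: ler_wpM2l.
move=> /andP[x0 x1]; have [xp|xn] := leP 0 x.
  have x01 : 0 <= x <= 1 by rewrite xp.
  have [h1 h2 h3] := main2 x x01; have [_ _ h4] := main x x01.
  by split => //; rewrite ger0_norm.
have nx01 : 0 <= - x <= 1 by lra.
have [h1 h2 h3] := main2 _ nx01; have [h4 _ _] := main _ nx01.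
rewrite !mulrN !thN ?mulrNN ?mulNr ?opprK in h1 h2 h3 h4.
have e2 : (- x) ^+ 2 = x ^+ 2 by ring.
have e4 : (- x) ^+ 4 = x ^+ 4 by ring.
rewrite e2 e4 in h1 h2 h3; split => //.
have : 0 <= `|x| ^+ 3 by rewrite exprn_ge0.
lra.
Qed.

Local Notation S s := (sg (pluses s)).
Local Notation P := (gstep beta).

Lemma gstep_sg (f : R -> R) s :
  P (fun t => f (S t)) s = f (S s)
   + birth n beta (pluses s) * (f (S s + 2 * nu) - f (S s))
   + death n beta (pluses s) * (f (S s - 2 * nu) - f (S s)).
Proof. by rewrite -mstep_sg ?pluses_le // -gstep_pluses. Qed.

Lemma gstep_mean_ge s :
  (1 - (1 - beta) * nu) * S s - (`|S s| ^+ 3 / 3 + nu) * nu <= P (fun t => S t) s.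
Proof.
rewrite (gstep_sg id) /=; have kn := pluses_le s.
have := drift_bound kn; have [_ _ _] := sth_bounds (sg_bound kn).
rewrite ler_norml; move: (birth _ _ _) (death _ _ _) => b d; set x := sg _; set T := th _.
move=> h1 /andP[h2 _].
have -> : x + b * (x + 2 * nu - x) + d * (x - 2 * nu - x) = x + nu * (2 * (b - d)) by ring.
have : nu * (beta * x - x - `|x| ^+ 3 / 3 - nu) <= nu * (2 * (b - d)).
  by rewrite ler_pM2l //; lra.
by lra.
Qed.

Lemma gstep_corr_ge s :
  (1 - (1 - beta) * nu) * S s ^+ 2 - (S s ^+ 4 / 3 + `|S s| * nu) * nu
    <= S s * P (fun t => S t) s.
Proof.
rewrite (gstep_sg id) /=; have kn := pluses_le s.
have := drift_bound kn; have [_ _ + _] := sth_bounds (sg_bound kn).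
move: (birth _ _ _) (death _ _ _) => b d; set x := sg _; set T := th _.
move=> h1 h2.
have h3 : `|x * (2 * (b - d) - (T - x))| <= `|x| * nu by rewrite normrM ler_wpM2l.
move: h3; rewrite ler_norml => /andP[h3 _].
have -> : x * (x + b * (x + 2 * nu - x) + d * (x - 2 * nu - x)) =
  x ^+ 2 + nu * (x * (2 * (b - d))) by ring.
have : nu * (beta * x ^+ 2 - x ^+ 2 - x ^+ 4 / 3 - `|x| * nu) <= nu * (x * (2 * (b - d))).
  by rewrite ler_pM2l //; lra.
by lra.
Qed.

Lemma gstep_sqrE s (x := S s) (b := birth n beta (pluses s)) (d := death n beta (pluses s)) :
  P (fun t => S t ^+ 2) s = x ^+ 2 + 2 * nu * (x * (2 * (b - d))) + 4 * nu ^+ 2 * (b + d).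
Proof. by rewrite (gstep_sg (fun y => y ^+ 2)) -/x -/b -/d; ring. Qed.

Lemma gstep_sqr_ge s :
  S s ^+ 2 - 2 * nu * ((1 - beta) * S s ^+ 2 + S s ^+ 4 / 3 + `|S s| * nu)
   + 4 * c0 * nu ^+ 2 <= P (fun t => S t ^+ 2) s.
Proof.
rewrite gstep_sqrE; have kn := pluses_le s.
have [_ _ ] := rates_bound kn.
have := drift_bound kn; have [_ _ + _] := sth_bounds (sg_bound kn).
move: (birth _ _ _) (death _ _ _) => b d; set x := sg _; set T := th _.
move=> h1 h2 h4 _.
have h3 : `|x * (2 * (b - d) - (T - x))| <= `|x| * nu by rewrite normrM ler_wpM2l.
move: h3; rewrite ler_norml => /andP[h3 _].
have : nu * (beta * x ^+ 2 - x ^+ 2 - x ^+ 4 / 3 - `|x| * nu) <= nu * (x * (2 * (b - d))).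
  by rewrite ler_pM2l //; lra.
have : nu ^+ 2 * c0 <= nu ^+ 2 * (b + d) by rewrite ler_pM2l ?exprn_gt0.
by lra.
Qed.

Lemma gstep_sqr_le_aux s (v : R) : S s * th (beta * S s) <= v ->
  P (fun t => S t ^+ 2) s <= S s ^+ 2 + 2 * nu * (v - S s ^+ 2) + 6 * nu ^+ 2.
Proof.
rewrite gstep_sqrE; have kn := pluses_le s.
have [_ _ _ ] := rates_bound kn; have := c0_gt0; have := sg_bound kn; rewrite -ler_norml.
have := drift_bound kn.
move: (birth _ _ _) (death _ _ _) => b d; set x := sg _; set T := th _.
move=> h1 h2 c0p h4 hv.
have h3 : `|x * (2 * (b - d) - (T - x))| <= 1 * nu by rewrite normrM; apply: ler_pM.
move: h3; rewrite ler_norml => /andP[_ h3].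
have : nu * (x * (2 * (b - d))) <= nu * (v - x ^+ 2 + nu).
  by rewrite ler_pM2l //; lra.
have : nu ^+ 2 * (b + d) <= nu ^+ 2 * 1 by rewrite ler_pM2l ?exprn_gt0 //; lra.
by lra.
Qed.

Lemma gstep_sqr_le s :
  P (fun t => S t ^+ 2) s <= (1 - 2 * (1 - beta) * nu) * S s ^+ 2 + 6 * nu ^+ 2.
Proof.
have [h _ _ _] := sth_bounds (sg_bound (pluses_le s)).
by apply: le_trans (gstep_sqr_le_aux h) _; lra.
Qed.

Lemma gstep_sqr_le_quartic s :
  P (fun t => S t ^+ 2) s <= S s ^+ 2 - 8 / 27 * nu * S s ^+ 4 + 6 * nu ^+ 2.
Proof.
have [_ h _ _] := sth_bounds (sg_bound (pluses_le s)).
by apply: le_trans (gstep_sqr_le_aux h) _; lra.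
Qed.

(** Of the coefficient 44, 24 comes from the second difference of [y ^ 4], 4 from the error in the
    drift, and 16 from the third-order term, split by [2 * nu * |x| <= x ^ 2 + nu ^ 2]; this
    splitting also gives half of [32 * nu ^ 4]. *)
Lemma gstep_quartic_le s :
  P (fun t => S t ^+ 4) s <=
  (1 - 4 * (1 - beta) * nu) * S s ^+ 4 + 44 * nu ^+ 2 * S s ^+ 2 + 32 * nu ^+ 4.
Proof.
rewrite (gstep_sg (fun y => y ^+ 4)); have kn := pluses_le s.
have [] := rates_bound kn; have := c0_gt0; have := sg_bound kn; rewrite -ler_norml.
have := drift_bound kn; have [+ _ _ _] := sth_bounds (sg_bound kn).
move: (birth _ _ _) (death _ _ _) => b d; set x := sg _; set T := th _.
move=> h0 h1 x1 c0p b0 d0 _ bd.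
have -> : x ^+ 4 + b * ((x + 2 * nu) ^+ 4 - x ^+ 4) + d * ((x - 2 * nu) ^+ 4 - x ^+ 4)
  = x ^+ 4 + 4 * nu * (x ^+ 3 * (2 * (b - d))) + 32 * nu ^+ 3 * (x * (b - d))
  + (24 * (nu ^+ 2 * x ^+ 2) + 16 * nu ^+ 4) * (b + d) by ring.
have x2 : x ^+ 2 <= 1 by rewrite -real_normK ?num_real // expr_le1.
have h3 : `|x ^+ 3 * (2 * (b - d) - (T - x))| <= x ^+ 2 * nu.
  rewrite normrM; apply: ler_pM => //; rewrite exprS normrM normrX real_normK ?num_real //.
  by rewrite ler_piMl // sqr_ge0.
move: h3; rewrite ler_norml => /andP[_ h3].
have h4 : x ^+ 2 * (x * T) <= x ^+ 2 * (beta * x ^+ 2) by rewrite ler_wpM2l ?sqr_ge0.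
have h5 : nu * (x ^+ 3 * (2 * (b - d))) <= nu * (beta * x ^+ 4 - x ^+ 4 + x ^+ 2 * nu).
  by rewrite ler_pM2l //; lra.
have h6 : x * (b - d) <= `|x|.
  apply: le_trans (ler_norm _) _; rewrite normrM ler_piMr //.
  by rewrite ler_norml; lra.
have h7 : 2 * nu * `|x| <= x ^+ 2 + nu ^+ 2.
  by rewrite -[x ^+ 2]real_normK ?num_real //; have := sqr_ge0 (`|x| - nu); lra.
have h8 : nu ^+ 3 * (x * (b - d)) <= nu ^+ 3 * `|x| by rewrite ler_wpM2l ?exprn_ge0 // ltW.
have h9 : nu ^+ 2 * (2 * nu * `|x|) <= nu ^+ 2 * (x ^+ 2 + nu ^+ 2).
  by rewrite ler_wpM2l ?sqr_ge0.
have h10 : (24 * (nu ^+ 2 * x ^+ 2) + 16 * nu ^+ 4) * (b + d) <= (24 * (nu ^+ 2 * x ^+ 2) + 16 * nu ^+ 4) * 1.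
  apply: ler_wpM2l; last lra.
  have n0 := ltW nu_gt0; apply: addr_ge0; apply: mulr_ge0; rewrite ?exprn_ge0 //.
  by apply: mulr_ge0; exact: sqr_ge0.
by lra.
Qed.

End Moments.

(** * Coupling certificates *)

(* The right-hand side is the second moment of the difference of two independent
   steps in {-1, 0, 1} with up and down probabilities [b1], [d1] and [b2], [d2]. *)
Lemma indep_var (R : realType) (c b1 d1 b2 d2 : R) :
  0 < c -> 0 <= b1 -> 0 <= d1 -> b1 + d1 <= 1 - c -> c <= b1 + d1 ->
  0 <= b2 -> 0 <= d2 -> b2 + d2 <= 1 - c -> c <= b2 + d2 ->
  c ^+ 2 <= (b1 + d1) + (b2 + d2) - 2 * (b1 - d1) * (b2 - d2).
Proof.
move=> cg b10 d10 m1 m1' b20 d20 m2 m2'.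
have xp : `|b1 - d1| <= b1 + d1 by rewrite ler_norml; lra.
have yq : `|b2 - d2| <= b2 + d2 by rewrite ler_norml; lra.
have : (b1 - d1) * (b2 - d2) <= (b1 + d1) * (b2 + d2).
  by apply: le_trans (ler_norm _) _; rewrite normrM; apply: ler_pM.
have : c * c <= (b1 + d1) * (1 - (b2 + d2)) by apply: ler_pM; lra.
have : 0 <= (b2 + d2) * (1 - (b1 + d1)) by apply: mulr_ge0; lra.
lra.
Qed.

(** * Independent coupling of a birth-and-death chain *)

Section BirthDeathCoupling.
Variables (R : realType) (n : nat) (b d : nat -> R) (c : R).
Hypothesis c_gt0 : 0 < c.
Hypothesis c_half : c <= 2^-1.
Hypothesis b_ge0 : forall k, (k <= n)%N -> 0 <= b k.
Hypothesis d_ge0 : forall k, (k <= n)%N -> 0 <= d k.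
Hypothesis move_ge : forall k, (k <= n)%N -> c <= b k + d k.
Hypothesis move_le : forall k, (k <= n)%N -> b k + d k <= 1 - c.
Hypothesis bn : b n = 0.
Hypothesis d0 : d 0 = 0.
Hypothesis drift_noninc : forall k, (k < n)%N -> b k.+1 - d k.+1 <= b k - d k.

Definition bdstep (F : nat -> R) k : R := F k + b k * (F k.+1 - F k) + d k * (F k.-1 - F k).

Lemma bdstep_norm (F : nat -> R) : (forall k, (k <= n)%N -> `|F k| <= 1) ->
  forall k, (k <= n)%N -> `|bdstep F k| <= 1.
Proof.
move=> F1 k kn; rewrite /bdstep.
have -> : F k + b k * (F k.+1 - F k) + d k * (F k.-1 - F k) =
  (1 - b k - d k) * F k + b k * F k.+1 + d k * F k.-1 by ring.
have cg := c_gt0; have b0 := b_ge0 kn; have dk0 := d_ge0 kn; have ml := move_le kn.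
have h0 : 0 <= 1 - b k - d k by lra.
apply: le_trans (ler_normD _ _) _; apply: le_trans (lerD (ler_normD _ _) (lexx _)) _.
rewrite !normrM (ger0_norm h0) (ger0_norm b0) (ger0_norm dk0).
have e1 : (1 - b k - d k) * `|F k| <= 1 - b k - d k by rewrite ler_piMr ?F1.
have e2 : b k * `|F k.+1| <= b k.
  move: kn b0; rewrite leq_eqVlt => /orP[/eqP -> _|kn b0]; first by rewrite bn mul0r.
  by rewrite ler_piMr ?F1.
have e3 : d k * `|F k.-1| <= d k.
  by rewrite ler_piMr ?F1 // (leq_trans (leq_pred k)).
lra.
Qed.

Lemma iter_bdstep_norm s (F : nat -> R) : (forall k, (k <= n)%N -> `|F k| <= 1) ->
  forall k, (k <= n)%N -> `|iter s bdstep F k| <= 1.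
Proof. by move=> F1; elim: s => [//|s IH]; apply: bdstep_norm. Qed.

Lemma drift_le k l : (k <= l <= n)%N -> b l - d l <= b k - d k.
Proof.
move=> /andP[]; elim: l => [|l IH]; first by rewrite leqn0 => /eqP ->.
rewrite leq_eqVlt => /orP[/eqP -> //|]; rewrite ltnS => kl ln.
by apply: le_trans (drift_noninc ln) _; apply: IH => //; exact: ltnW.
Qed.

(* The bound is used at distances [x >= 1] only; the jump at [0] pays for the
   possibility that two independent walkers at distance [1] cross each other. *)
Definition bdV (H x : R) : R := 4 / c * H + 2 * H * x - x ^+ 2.

(** Let two walkers at distance [w] move independently. As [bdV] is quadratic, its mean change is
    [2 * (H - w)] times the difference of the drifts, at most 0 because the drift is nonincreasing,
    minus the second moment of the relative move, at least [c ^ 2] by [indep_var]. The condition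
    [w <= H - 2] keeps all reachable distances at most [H]. *)
Lemma bdV_step (F : nat -> R) (a H : R) k l : 0 <= a -> 0 <= H ->
  (forall x y, (x < y <= n)%N -> y%:R - x%:R <= H ->
     `|F x - F y| <= a * bdV H (y%:R - x%:R)) ->
  (k < l <= n)%N -> l%:R - k%:R <= H - 2 ->
  `|bdstep F k - bdstep F l| <= a * (bdV H (l%:R - k%:R) - c ^+ 2).
Proof.
move=> a0 H0 hF /andP[kl ln] wH.
have kn : (k <= n)%N by rewrite ltnW // (leq_trans kl).
have := drift_le (introT andP (conj (ltnW kl) ln)).
have cg := c_gt0; have ch := c_half; have bk := b_ge0 kn; have dk := d_ge0 kn; have mk := move_le kn; have mk' := move_ge kn.
have bl := b_ge0 ln; have dl := d_ge0 ln; have ml := move_le ln; have ml' := move_ge ln.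
pose hk := 1 - b k - d k; pose hl := 1 - b l - d l.
have hk0 : 0 <= hk by rewrite /hk; lra.
have hl0 : 0 <= hl by rewrite /hl; lra.
move=> dr; set w := l%:R - k%:R in wH *.
have w1 : 1 <= w by rewrite /w -natrB ?(ltnW kl) // ler1n subn_gt0.
have wH2 : w + 2 <= H by rewrite -lerBrDr.
have wH1 : w + 1 <= H by apply: le_trans wH2; rewrite lerD2l ler1n.
have wH0 : w <= H by apply: le_trans wH1; rewrite lerDl.
have wHm : w - 1 <= H by apply: le_trans wH0; rewrite gerBl.
have bk1 : b k <= 1 by lra.
have hkc : c <= hk by rewrite /hk; lra.
have h4 : 0 <= 4 / c by rewrite divr_ge0 // ltW.
have tri (p q : R) x y (v : R) : 0 <= p -> 0 <= q ->
   (p != 0 -> q != 0 -> `|F x - F y| <= a * v) -> `|p * q * (F x - F y)| <= p * q * (a * v).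
  move=> p0 q0 h; rewrite !normrM (ger0_norm p0) (ger0_norm q0).
  have [->|pn] := eqVneq p 0; first by rewrite !mul0r.
  have [->|qn] := eqVneq q 0; first by rewrite mulr0 !mul0r.
  by rewrite ler_wpM2l ?mulr_ge0 ?h.
have hF' x y (v : R) : (x <= y <= n)%N -> y%:R - x%:R = v -> v <= H -> `|F x - F y| <= a * bdV H v.
  move=> /andP[]; rewrite leq_eqVlt => /orP[/eqP ->|xy] yn <-.
    rewrite !subrr normr0 => _; by rewrite mulr_ge0 // /bdV mulr0 addr0 expr0n subr0 mulr_ge0.
  by move=> vH; apply: hF => //; rewrite xy.
have dk_pos j : d j != 0 -> (0 < j)%N by case: j => [|//]; rewrite d0 eqxx.
have bl_pos : b l != 0 -> (l < n)%N.
  by move=> bl0; rewrite ltn_neqAle ln andbT; apply: contraNneq bl0 => ->; rewrite bn.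
have l0 : (0 < l)%N by rewrite (leq_ltn_trans _ kl).
have eS j : j.+1%:R = j%:R + 1 :> R by rewrite -natr1.
have eP j : (0 < j)%N -> j.-1%:R = j%:R - 1 :> R by case: j => // j _; rewrite -natr1 addrK.
have t1 : `|hk * hl * (F k - F l)| <= hk * hl * (a * bdV H w).
  by apply: tri => // _ _; apply: hF'; rewrite ?ln ?(ltnW kl) //.
have t2 : `|hk * b l * (F k - F l.+1)| <= hk * b l * (a * bdV H (w + 1)).
  apply: tri => // _ /bl_pos bln; apply: hF'; rewrite ?bln ?andbT ?leqW ?(ltnW kl) //.
  by rewrite eS /w; ring.
have t4 : `|d k * hl * (F k.-1 - F l)| <= d k * hl * (a * bdV H (w + 1)).
  apply: tri => // /dk_pos k0 _; apply: hF'; rewrite ?ln ?andbT //.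
    by rewrite (leq_trans (leq_pred _)) // ltnW.
  by rewrite eP // /w; ring.
have t5 : `|d k * b l * (F k.-1 - F l.+1)| <= d k * b l * (a * bdV H (w + 2)).
  apply: tri => // /dk_pos k0 /bl_pos bln; apply: hF'; rewrite ?bln ?andbT //.
    by rewrite leqW // (leq_trans (leq_pred _)) // ltnW.
  by rewrite eP // eS /w; ring.
have t6 : `|d k * d l * (F k.-1 - F l.-1)| <= d k * d l * (a * bdV H w).
  apply: tri => // /dk_pos k0 _; apply: hF' => //.
    by rewrite (leq_trans (leq_pred _) ln) andbT -!subn1 leq_sub2r // ltnW.
  by rewrite !eP // /w; ring.
have t7 : `|b k * b l * (F k.+1 - F l.+1)| <= b k * b l * (a * bdV H w).
  apply: tri => // _ /bl_pos bln; apply: hF'; rewrite ?ltnS ?bln ?(ltnW kl) //.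
  by rewrite !eS /w; ring.
have kpl : (k <= l.-1)%N by rewrite -ltnS prednK.
have lpn : (l.-1 <= n)%N by rewrite (leq_trans (leq_pred _)).
have t3 : `|hk * d l * (F k - F l.-1)| <= hk * d l * (a * bdV H (w - 1)).
  apply: tri => // _ _; apply: hF'; rewrite ?kpl ?lpn //.
  by rewrite eP // /w; ring.
have t8 : `|b k * hl * (F k.+1 - F l)| <= b k * hl * (a * bdV H (w - 1)).
  apply: tri => // _ _; apply: hF'; rewrite ?kl ?ln //.
  by rewrite eS /w; ring.
have decomp : bdstep F k - bdstep F l =
    hk * hl * (F k - F l) + hk * b l * (F k - F l.+1) + hk * d l * (F k - F l.-1)
  + b k * hl * (F k.+1 - F l) + b k * b l * (F k.+1 - F l.+1) + b k * d l * (F k.+1 - F l.-1)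
  + d k * hl * (F k.-1 - F l) + d k * b l * (F k.-1 - F l.+1) + d k * d l * (F k.-1 - F l.-1).
  by rewrite /bdstep /hk /hl; ring.
pose p := b k + d k; pose q := b l + d l; pose x := b k - d k; pose y := b l - d l.
have var : c ^+ 2 <= p + q - 2 * x * y by apply: indep_var.
have dr' : 0 <= (H - w) * (x - y) by apply: mulr_ge0; rewrite subr_ge0 // (le_trans wH) // gerBl.
have ca : 0 <= a * (p + q - 2 * x * y - c ^+ 2) by apply: mulr_ge0; rewrite ?subr_ge0.
have da : 0 <= a * ((H - w) * (x - y)) by apply: mulr_ge0.
rewrite decomp; have := kl; rewrite leq_eqVlt => /orP[/eqP kl1|kl2].
  have w1E : w = 1 by rewrite /w -kl1 eS; ring.
  have t9 : `|b k * d l * (F k.+1 - F l.-1)| <= b k * d l * (a * bdV H 1).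
    apply: tri => // _ _; rewrite -w1E kl1 -[in l.-1]kl1 /= distrC.
    by apply: (hF' k l w) => //; rewrite (ltnW kl) ln.
  have z3 : `|hk * d l * (F k - F l.-1)| <= 0 by rewrite -kl1 subrr mulr0 normr0.
  have z8 : `|b k * hl * (F k.+1 - F l)| <= 0 by rewrite -kl1 subrr mulr0 normr0.
  apply: (@le_trans _ _ (hk * hl * (a * bdV H w) + hk * b l * (a * bdV H (w + 1)) + 0
    + 0 + b k * b l * (a * bdV H w) + b k * d l * (a * bdV H 1)
    + d k * hl * (a * bdV H (w + 1)) + d k * b l * (a * bdV H (w + 2)) + d k * d l * (a * bdV H w))).
    by do 8! (apply: le_trans (ler_normD _ _) _; apply: lerD => //).
  (* Crossing from distance 1 lands at 1 instead of -1, which costs [bdV H 1 - bdV H (-1) = 4 * H].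
     Meeting, where the oscillation is 0 instead of [bdV H 0 = 4 / c * H], repays it: the left
     walker holds with probability [hk >= c], while [b k <= 1]. *)
  have gain : 0 <= a * H * (4 / c * (hk * d l) - 4 * (b k * d l)).
    apply: mulr_ge0; first exact: mulr_ge0.
    have -> : 4 / c * (hk * d l) - 4 * (b k * d l) = 4 * ((hk / c - b k) * d l) by ring.
    apply: mulr_ge0 => //; apply: mulr_ge0 => //.
    by rewrite subr_ge0; apply: le_trans bk1 _; rewrite ler_pdivlMr // mul1r.
  have gain2 : 0 <= a * H * (4 / c) * (b k * hl) by apply: mulr_ge0; apply: mulr_ge0 => //; exact: mulr_ge0.
  clear decomp t1 t2 t3 t4 t5 t6 t7 t8 t9 z3 z8 var dr dr' wH wH0 wH1 wH2 wHm w1 bk dk mk mk' bl dl ml ml' bk1 hkc hk0 hl0 h4 cg ch.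
  rewrite -subr_ge0; move: ca da gain gain2; rewrite w1E /bdV /p /q /x /y /hk /hl.
  move: (4 / c) => C; lra.
have t9 : `|b k * d l * (F k.+1 - F l.-1)| <= b k * d l * (a * bdV H (w - 2)).
  apply: tri => // _ _; apply: hF'; rewrite ?lpn ?andbT.
  - by rewrite -ltnS prednK.
  - by rewrite eP // eS /w; ring.
  - by rewrite lerBlDr (le_trans wH0) // lerDl.
apply: (@le_trans _ _ (hk * hl * (a * bdV H w) + hk * b l * (a * bdV H (w + 1))
    + hk * d l * (a * bdV H (w - 1))
    + b k * hl * (a * bdV H (w - 1)) + b k * b l * (a * bdV H w) + b k * d l * (a * bdV H (w - 2))
    + d k * hl * (a * bdV H (w + 1)) + d k * b l * (a * bdV H (w + 2)) + d k * d l * (a * bdV H w))).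
  by do 8! (apply: le_trans (ler_normD _ _) _; apply: lerD => //).
clear decomp t1 t2 t3 t4 t5 t6 t7 t8 t9 var dr dr' wH wH0 wH1 wH2 wHm w1 bk dk mk mk' bl dl ml ml' bk1 hkc hk0 hl0 h4 cg ch.
rewrite -subr_ge0; move: ca da; rewrite /bdV /p /q /x /y /hk /hl.
move: (4 / c) => C; lra.
Qed.

(** The two terms correspond to exceeding distance [H] and to not meeting within [s] steps. With [V]
    the certificate, the induction needs [(V - c ^ 2) / (s + 1) <= V / (s + 2)], that is
    [V <= c ^ 2 * (s + 2)]; otherwise, and also when [w > H - 2], the right-hand side is at least
    the trivial bound 2. *)
Lemma bd_coupling_aux s (F : nat -> R) (H : R) k l : 1 <= H ->
  (forall k, (k <= n)%N -> `|F k| <= 1) ->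
  (k < l <= n)%N -> l%:R - k%:R <= H ->
  `|iter s bdstep F k - iter s bdstep F l| <=
    2 * (H ^- 2 + (c ^+ 2 * s.+1%:R)^-1) * bdV H (l%:R - k%:R).
Proof.
move=> H1 F1; have cg := c_gt0; have ch := c_half.
have c2 : 0 < c ^+ 2 by rewrite exprn_gt0.
have c21 : c ^+ 2 <= 1 by rewrite expr_le1 //; lra.
have H2 : 0 < H ^+ 2 by rewrite exprn_gt0; lra.
have C8 : 8 <= 4 / c by rewrite ler_pdivlMr //; lra.
elim: s k l => [|s IH] k l kln wH; set w := l%:R - k%:R in wH *.
all: have [kl ln] := andP kln; have kn : (k <= n)%N by rewrite ltnW // (leq_trans kl).
all: have w1 : 1 <= w by rewrite /w -natrB ?(ltnW kl) // ler1n subn_gt0.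
all: have CH : 8 * H <= 4 / c * H by rewrite ler_wpM2r //; lra.
all: have V1 : c ^+ 2 <= bdV H w by rewrite /bdV; nra.
  have := ler_normB (F k) (F l); have := F1 _ kn; have := F1 _ ln => a1 a2 a3.
  have : 1 <= (c ^+ 2 * 1)^-1 * bdV H w by rewrite mulr1 mulrC ler_pdivlMr ?mul1r.
  have : 0 <= H ^- 2 * bdV H w by rewrite mulr_ge0 ?invr_ge0 ?(ltW H2) // (le_trans (ltW c2)).
  rewrite /=; lra.
have V0 : 0 <= bdV H w by lra.
have triv : 1 <= (H ^- 2 + (c ^+ 2 * s.+2%:R)^-1) * bdV H w ->
    `|iter s.+1 bdstep F k - iter s.+1 bdstep F l| <=
    2 * (H ^- 2 + (c ^+ 2 * s.+2%:R)^-1) * bdV H w.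
  move=> h; apply: (@le_trans _ _ (1 + 1)).
    by apply: le_trans (ler_normB _ _) _; apply: lerD; exact: iter_bdstep_norm.
  by rewrite -mulrA -[1 + 1]/2 ler_peMr.
have Hi : 0 <= H ^- 2 * bdV H w by rewrite mulr_ge0 // invr_ge0 ltW.
have si : 0 <= (c ^+ 2 * s.+2%:R)^-1 * bdV H w.
  by rewrite mulr_ge0 // invr_ge0 mulr_ge0 // ltW.
have [wH2|wH2] := leP w (H - 2); last first.
  apply: triv; rewrite mulrDl; apply: (@le_trans _ _ (H ^- 2 * bdV H w)); last by rewrite lerDl.
  rewrite mulrC ler_pdivlMr // mul1r /bdV; nra.
have [Vs|Vs] := leP (c ^+ 2 * s.+2%:R) (bdV H w).
  apply: triv; rewrite mulrDl.
  apply: (@le_trans _ _ ((c ^+ 2 * s.+2%:R)^-1 * bdV H w)); last by rewrite lerDr.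
  by rewrite mulrC ler_pdivlMr ?mulr_gt0 // mul1r.
have H0 : 0 <= H by lra.
have s1 : 0 < s.+1%:R :> R by [].
have a0 : 0 <= 2 * (H ^- 2 + (c ^+ 2 * s.+1%:R)^-1).
  by rewrite mulr_ge0 // addr_ge0 // invr_ge0 ltW // mulr_gt0.
have := @bdV_step (iter s bdstep F) _ H k l a0 H0 _ kln wH2.
move=> /(_ (fun x y h => IH x y h)) h; apply: le_trans h _; rewrite -/w.
rewrite -!mulrA ler_pM2l // mulrDl [leRHS]mulrDl; apply: lerD.
  by rewrite ler_pM2l ?invr_gt0 //; lra.
rewrite ![_^-1 * _]mulrC ler_pdivrMr ?mulr_gt0 // mulrAC ler_pdivlMr ?mulr_gt0 //.
have e : s.+2%:R = s.+1%:R + 1 :> R by rewrite [in RHS]natr1.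
rewrite e in Vs *; nra.
Qed.

Definition bdK : R := 2 * (1 + c ^- 2) * (4 / c + 2).

(** The choice [H = sqrt (s + 1)] balances the two failure terms, both then of order [V / (s + 1)]
    with [V = O(H * w)]; for [w > H] the bound exceeds 2 and is trivial. *)
Lemma bd_coupling s (F : nat -> R) k l :
  (forall k, (k <= n)%N -> `|F k| <= 1) -> (k <= n)%N -> (l <= n)%N ->
  `|iter s bdstep F k - iter s bdstep F l| <= bdK * `|k%:R - l%:R| / Num.sqrt s.+1%:R.
Proof.
move=> F1; wlog kl : k l / (k <= l)%N.
  move=> hw kn ln; have [kl|/ltnW lk] := leqP k l; first exact: hw.
  by rewrite distrC (distrC k%:R); exact: hw.
move=> kn ln; move: kl; rewrite leq_eqVlt => /orP[/eqP ->|kl].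
  by rewrite !subrr !normr0 mulr0 mul0r.
have cg := c_gt0; have ch := c_half; set H := Num.sqrt _.
have H1 : 1 <= H by rewrite -sqrtr1 ler_sqrt // ler1n.
have HH : H ^+ 2 = s.+1%:R by rewrite sqr_sqrtr.
have c2 : 0 < c ^+ 2 by rewrite exprn_gt0.
have C8 : 8 <= 4 / c by rewrite ler_pdivlMr //; lra.
have Hp : 0 < H by lra.
rewrite (distrC k%:R) (@ger0_norm _ (l%:R - k%:R)) ?subr_ge0 ?ler_nat ?(ltnW kl) //; set w : R := l%:R - k%:R.
have w1 : 1 <= w by rewrite /w -natrB ?(ltnW kl) // ler1n subn_gt0.
have ci : 0 < c ^- 2 by rewrite invr_gt0.
have cw : 0 < c ^- 2 * (4 / c) by rewrite mulr_gt0 //; lra.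
have [wH|/ltW wH] := leP w H; last first.
  have : `|iter s bdstep F k - iter s bdstep F l| <= 2.
    have := ler_normB (iter s bdstep F k) (iter s bdstep F l).
    have := iter_bdstep_norm s F1 kn; have := iter_bdstep_norm s F1 ln; lra.
  move=> h; apply: le_trans h _; rewrite ler_pdivlMr // /bdK; apply: ler_pM; try lra.
have := @bd_coupling_aux s F H k l H1 F1 (introT andP (conj kl ln)) wH.
rewrite -/w -HH => h; apply: le_trans h _; rewrite ler_pdivlMr // /bdK /bdV.
set C := 4 / c in C8 cw *.
have -> : 2 * (H ^- 2 + (c ^+ 2 * H ^+ 2)^-1) * (C * H + 2 * H * w - w ^+ 2) * H =
  2 * (1 + c ^- 2) * ((C * H + 2 * H * w - w ^+ 2) / H).
  by field; rewrite !gt_eqF //.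
rewrite -[leRHS]mulrA ler_pM2l; last by lra.
rewrite ler_pdivrMr //.
have C0 : 0 <= C by apply: le_trans C8.
have hC : 0 <= C * H * (w - 1).
  by apply: mulr_ge0; [apply: mulr_ge0 => //; exact: ltW | rewrite subr_ge0].
have := sqr_ge0 w; lra.
Qed.

End BirthDeathCoupling.

Lemma eq_ler (R : realType) (x y : R) : x = y -> x <= y.
Proof. by move=> ->. Qed.

Section MagnetizationCoupling.
Variables (R : realType) (n : nat) (beta : R).
Hypothesis n_gt0 : (0 < n)%N.
Hypothesis beta01 : 0 <= beta <= 1.

Let n_gt0R : 0 < n%:R :> R.
Proof. by rewrite ltr0n. Qed.

(** One more plus lowers the drift by [1 / n] through the proportion of minuses and raises it by at
    most [(1 - 1 / n) * beta / n] through the local field; [beta <= 1] decides the sign. *)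
Lemma drift_antitone k : (k < n)%N ->
  birth n beta k.+1 - death n beta k.+1 <= birth n beta k - death n beta k.
Proof.
move=> kn; have [b0 b1] := andP beta01; have n0 := n_gt0R.
pose p (x : R) := lg (beta * (2 * x - n%:R - 1) / n%:R).
have inc x : 0 <= p (x + 1) - p x <= beta / n%:R.
  have e : beta * (2 * (x + 1) - n%:R - 1) / n%:R - beta * (2 * x - n%:R - 1) / n%:R
      = 2 * (beta / n%:R) by field; rewrite gt_eqF.
  have h0 : 0 <= beta / n%:R by rewrite divr_ge0 // ltW.
  have xy : beta * (2 * x - n%:R - 1) / n%:R <= beta * (2 * (x + 1) - n%:R - 1) / n%:R.
    by rewrite -subr_ge0 e mulr_ge0.
  by have := ler_lg xy; have := lg_lip xy; rewrite e /p; lra.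
have hup (j : nat) : up_rate n beta j = p (j%:R + 1).
  have e : 2 * (j%:R + 1) - n%:R - 1 = 2 * j%:R - n%:R + 1 :> R by ring.
  by rewrite /up_rate /p e.
have hdo (j : nat) : down_rate n beta j = 1 - p j%:R by rewrite /down_rate /p.
rewrite /birth /death !hup !hdo -natr1; set x : R := k%:R.
have /andP[f0 f1] : 0 <= ((x + 1) / n%:R : R) <= 1.
  by rewrite /x natr1; apply: frac_bound.
have g0 : 0 <= x / n%:R by rewrite divr_ge0 // ltW.
have nv : 0 < n%:R^-1 :> R by rewrite invr_gt0.
have h1 := inc (x + 1); have h2 := inc x.
rewrite -subr_ge0 !(mulrDl x) !mul1r in f0 f1 *.
set q0 := p x in h2 *; set q1 := p (x + 1) in h1 h2 *; set q2 := p (x + 1 + 1) in h1 *.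
set y := x / n%:R in f0 f1 g0 *; set v : R := n%:R^-1 in f0 f1 nv h1 h2 *.
have [h1a h1b] := andP h1; have [h2a h2b] := andP h2.
have k1 : (1 - y - v) * (q2 - q1) <= (1 - y - v) * (beta * v) by apply: ler_wpM2l => //; lra.
have k2 : y * (q1 - q0) <= y * (beta * v) by apply: ler_wpM2l.
have k3 : (1 - v) * (beta * v) <= v.
  have b2 : beta * v <= v by rewrite ler_piMl // ltW.
  have b3 : 0 <= beta * v by rewrite mulr_ge0 // ltW.
  have : 0 <= v * (beta * v) by rewrite mulr_ge0 // ltW.
  lra.
lra.
Qed.

Lemma mstep_coupling s (F : nat -> R) k l :
  (forall k, (k <= n)%N -> `|F k| <= 1) -> (k <= n)%N -> (l <= n)%N ->
  `|iter s (mstep n beta) F k - iter s (mstep n beta) F l|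
     <= bdK (c0 R) * `|k%:R - l%:R| / Num.sqrt s.+1%:R.
Proof.
have H k' := @rates_bound R n beta n_gt0 beta01 k'.
apply: (@bd_coupling R n (birth n beta) (death n beta) (c0 R)).
- exact: c0_gt0.
- exact: c0_le_half.
- by move=> j /H[].
- by move=> j /H[].
- by move=> j /H[].
- by move=> j /H[].
- by rewrite /birth divff ?subrr ?mul0r // gt_eqF.
- by rewrite /death !mul0r.
- exact: drift_antitone.
Qed.

End MagnetizationCoupling.

(** * Coupling of the block counts at equal magnetization *)

Section BlockCoupling.
Variables (R : realType) (n : nat) (beta : R).
Hypothesis n_gt0 : (0 < n)%N.
Hypothesis beta01 : 0 <= beta <= 1.
Variables a b : nat.
Hypothesis abn : (a + b)%N = n.

Let n_gt0R : 0 < n%:R :> R.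
Proof. by rewrite ltr0n. Qed.

(* The two averages are coupled by independent picks; [W + D - 1] and [W - D - 1]
   are the values of the certificate one unit further and one unit closer. *)
Lemma coupled_averages (p1 p2 q1 q2 m N x1 x2 y1 y2 e1 e2 f1 f2 al W D : R) :
  0 <= p1 -> 0 <= p2 -> 0 <= q1 -> 0 <= q2 -> p1 + p2 = m -> q1 + q2 = m ->
  m <= N -> 0 <= al -> 0 <= D -> p1 * q2 <= p2 * q1 ->
  (p1 != 0 -> q1 != 0 -> `|x1 - y1| <= al * W + e1 + f1) ->
  (p1 != 0 -> q2 != 0 -> `|x1 - y2| <= al * (W + D - 1) + e1 + f2) ->
  (p2 != 0 -> q1 != 0 -> `|x2 - y1| <= al * (W - D - 1) + e2 + f1) ->
  (p2 != 0 -> q2 != 0 -> `|x2 - y2| <= al * W + e2 + f2) ->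
  `|(p1 * x1 + p2 * x2) - (q1 * y1 + q2 * y2)| <=
    al * (m * W - p2 * q1 / N) + (p1 * e1 + p2 * e2) + (q1 * f1 + q2 * f2).
Proof.
move=> p10 p20 q10 q20 pm qm mN al0 D0 pq h11 h12 h21 h22.
have tri (p q x y v : R) : 0 <= p -> 0 <= q -> (p != 0 -> q != 0 -> `|x - y| <= v) ->
    `|p * q * (x - y)| <= p * q * v.
  move=> p0 q0 h; rewrite !normrM (ger0_norm p0) (ger0_norm q0).
  have [->|pn] := eqVneq p 0; first by rewrite !mul0r.
  have [->|qn] := eqVneq q 0; first by rewrite mulr0 !mul0r.
  by rewrite ler_wpM2l ?mulr_ge0 ?h.
have m0 : 0 <= m by rewrite -pm addr_ge0.
have [mz|mn] := eqVneq m 0.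
  have /eqP := pm; rewrite mz paddr_eq0 // => /andP[/eqP -> /eqP ->].
  have /eqP := qm; rewrite mz paddr_eq0 // => /andP[/eqP -> /eqP ->].
  by rewrite !mul0r !addr0 subr0 normr0 mulr0.
have mp : 0 < m by rewrite lt_def mn.
have Np : 0 < N by apply: lt_le_trans mN.
rewrite -(ler_pM2l mp) -{1}(gtr0_norm mp) -normrM.
have -> : m * (p1 * x1 + p2 * x2 - (q1 * y1 + q2 * y2)) =
    p1 * q1 * (x1 - y1) + p1 * q2 * (x1 - y2) + p2 * q1 * (x2 - y1) + p2 * q2 * (x2 - y2).
  by rewrite mulrBr -{1}qm -pm; ring.
have t11 := tri _ _ _ _ _ p10 q10 h11; have t12 := tri _ _ _ _ _ p10 q20 h12.
have t21 := tri _ _ _ _ _ p20 q10 h21; have t22 := tri _ _ _ _ _ p20 q20 h22.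
apply: le_trans (_ : _ <= p1 * q1 * (al * W + e1 + f1) + p1 * q2 * (al * (W + D - 1) + e1 + f2)
   + p2 * q1 * (al * (W - D - 1) + e2 + f1) + p2 * q2 * (al * W + e2 + f2)) _.
  by do 3! (apply: le_trans (ler_normD _ _) _; apply: lerD => //).
have g1 : 0 <= al * (D * (p2 * q1 - p1 * q2)) by rewrite !mulr_ge0 // subr_ge0.
have g2 : 0 <= al * (p1 * q2) by rewrite !mulr_ge0.
have g3 : m * (p2 * q1 / N) <= p2 * q1.
  by rewrite mulrA ler_pdivrMr // [leRHS]mulrC ler_wpM2r ?mulr_ge0.
have g4 : 0 <= al * (p2 * q1 - m * (p2 * q1 / N)) by rewrite mulr_ge0 // subr_ge0.
rewrite -subr_ge0.
have -> : m * (al * (m * W - p2 * q1 / N) + (p1 * e1 + p2 * e2) + (q1 * f1 + q2 * f2)) =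
  al * (m * m * W) - al * (m * (p2 * q1 / N)) + (m * (p1 * e1 + p2 * e2) + m * (q1 * f1 + q2 * f2)).
  by ring.
have -> : m * (p1 * e1 + p2 * e2) = (q1 + q2) * (p1 * e1 + p2 * e2) by rewrite qm.
have -> : m * (q1 * f1 + q2 * f2) = (p1 + p2) * (q1 * f1 + q2 * f2) by rewrite pm.
have -> : m * m * W = (p1 + p2) * (q1 + q2) * W by rewrite pm qm.
move: g4 g1 g2; rewrite !mulrBr; move: (al * (m * _)) => t; lra.
Qed.

Lemma predn_balance (x y x' y' : nat) : (x + y = x' + y')%N -> (x' < x)%N ->
  (0 < y' -> [/\ 0 < y -> x + y.-1 = x' + y'.-1, 0 < x -> x.-1 + y = x' + y'.-1 & x' <= x.-1] /\
  (0 < x' -> [/\ 0 < y -> x + y.-1 = x'.-1 + y', x.-1 + y = x'.-1 + y' & x'.-1 <= x.-1]))%N.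
Proof. by move=> *; split=> [|*]; split=> *; lia. Qed.

(** No jump at 0, unlike [bdV]: with synchronized moves the distance changes by at most 1, so the
    two pairs cannot cross. *)
Definition blockW (H x : R) : R := 2 * H * x - x ^+ 2.

(** Both rates depend on [U + V] only, so the two pairs hold, rise or fall together, and only the
    block in which the move happens is picked independently. [E] is an additive error, carried
    through the kernel separately for each pair; it will hold the cost of the time spent where the
    decrease is too small. *)
Lemma blockW_step (G E : nat -> nat -> R) (al H : R) U V U' V' (w := U%:R - U'%:R : R) :
  0 <= al ->
  (forall x y, (x <= a)%N -> (y <= b)%N -> 0 <= E x y) ->
  (forall x y x' y', (x <= a)%N -> (y <= b)%N -> (x' <= a)%N -> (y' <= b)%N ->
     (x + y = x' + y')%N -> (x' < x)%N -> x%:R - x'%:R <= H ->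
     `|G x y - G x' y'| <= al * blockW H (x%:R - x'%:R) + E x y + E x' y') ->
  (U <= a)%N -> (V <= b)%N -> (U' <= a)%N -> (V' <= b)%N ->
  (U + V = U' + V')%N -> (U' < U)%N -> w <= H - 1 ->
  `|bstep n beta a b G U V - bstep n beta a b G U' V'| <=
    al * (blockW H w - up_rate n beta (U + V) / n%:R *
        ((b%:R - V%:R) * (a%:R - U'%:R) / n%:R))
    + bstep n beta a b E U V + bstep n beta a b E U' V'.
Proof.
move=> al0 E0 hG Ua Vb U'a V'b UV U'U wH; have n0 := n_gt0R.
have VV' : (V < V')%N by rewrite -(ltn_add2l U') -UV ltn_add2r.
have [pb1 pb2] := predn_balance UV U'U (leq_ltn_trans (leq0n _) VV').
have [pb3 pb4 pb5] := pb1.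
have le_pred (x y : nat) : (x <= y)%N -> (x.-1 <= y)%N by apply: leq_trans; exact: leq_pred.
have U'U1 := ltnW U'U.
have eV : V'%:R - V%:R = w.
  have : (U + V)%:R = (U' + V')%:R :> R by rewrite UV.
  by rewrite !natrD /w; lra.
have w1 : 1 <= w by rewrite /w -natrB ?(ltnW U'U) // ler1n subn_gt0.
have wH1 : w + 1 <= H by rewrite -lerBrDr.
have wH0 : w <= H by apply: le_trans wH1; rewrite lerDl.
have wHm : w - 1 <= H by apply: le_trans wH0; rewrite gerBl.
have hG' x y x' y' (v : R) : (x <= a)%N -> (y <= b)%N -> (x' <= a)%N -> (y' <= b)%N ->
   (x + y = x' + y')%N -> (x' <= x)%N -> x%:R - x'%:R = v -> v <= H ->
   `|G x y - G x' y'| <= al * blockW H v + E x y + E x' y'.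
  move=> xa yb x'a y'b e; rewrite leq_eqVlt => /orP[/eqP x'x|x'x] <- vH; last exact: hG.
  have y'y : y' = y by apply/esym/eqP; rewrite -(eqn_add2l x) e x'x.
  by rewrite x'x y'y !subrr normr0 /blockW !mulr0 expr0n subr0 mulr0 add0r addr_ge0 // E0.
have nat0 (x y : nat) : (x <= y)%N -> y%:R - x%:R != 0 :> R -> (x < y)%N.
  by move=> xy; rewrite subr_eq0 eqr_nat ltn_neqAle eq_sym => ->.
have natge (x y : nat) : (x <= y)%N -> 0 <= y%:R - x%:R :> R by rewrite subr_ge0 ler_nat.
have natpos (x : nat) : x%:R != 0 :> R -> (0 < x)%N by rewrite pnatr_eq0 lt0n.
have eS j : j.+1%:R = j%:R + 1 :> R by rewrite -natr1.
have eP j : (0 < j)%N -> j.-1%:R = j%:R - 1 :> R by case: j => // j _; rewrite -natr1 addrK.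
have kn : (U + V <= n)%N by rewrite -abn leq_add.
set k := (U + V)%N in kn *.
set u := up_rate n beta k / n%:R; set v := down_rate n beta k / n%:R.
set m : R := n%:R - k%:R.
have [b0 d0 _ bd] := rates_bound n_gt0 beta01 kn.
have eb : birth n beta k = u * m by rewrite /birth /u /m; field; rewrite gt_eqF.
have ed : death n beta k = v * k%:R by rewrite /death /v; field; rewrite gt_eqF.
have hold : 0 <= 1 - u * m - v * k%:R.
  by rewrite -eb -ed; have := c0_gt0 R; lra.
have u0 : 0 <= u by rewrite divr_ge0 // ltW // lg_gt0.
have v0 : 0 <= v by rewrite divr_ge0 // subr_ge0 ltW // lg_lt1.
have mE : (a%:R - U%:R) + (b%:R - V%:R) = m by rewrite /m -abn /k !natrD; ring.
have mE' : (a%:R - U'%:R) + (b%:R - V'%:R) = m by rewrite /m -abn /k UV !natrD; ring.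
have kE : U%:R + V%:R = k%:R :> R by rewrite /k natrD.
have kE' : U'%:R + V'%:R = k%:R :> R by rewrite /k UV natrD.
have mn : m <= n%:R by rewrite /m gerBl.
have kn' : k%:R <= n%:R :> R by rewrite ler_nat.
have D0 : 0 <= 2 * H - 2 * w by rewrite -mulrBr mulr_ge0 // subr_ge0.
have Wp : blockW H (w + 1) = blockW H w + (2 * H - 2 * w) - 1 by rewrite /blockW; ring.
have Wm : blockW H (w - 1) = blockW H w - (2 * H - 2 * w) - 1 by rewrite /blockW; ring.
have bE (f : nat -> nat -> R) x y : (x + y)%N = k -> bstep n beta a b f x y =
   (1 - u * m - v * k%:R) * f x y
   + u * ((a%:R - x%:R) * f x.+1 y + (b%:R - y%:R) * f x y.+1)
   + v * (x%:R * f x.-1 y + y%:R * f x y.-1).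
  move=> xy; rewrite /bstep xy -/u -/v /m.
  have -> : n%:R = a%:R + b%:R :> R by rewrite -abn natrD.
  by rewrite -xy natrD; ring.
have UVk : (U' + V')%N = k by rewrite -UV.
rewrite !bE //.
set Up := `|((a%:R - U%:R) * G U.+1 V + (b%:R - V%:R) * G U V.+1) -
    ((a%:R - U'%:R) * G U'.+1 V' + (b%:R - V'%:R) * G U' V'.+1)|.
have hUp : Up <= al * (m * blockW H w - (b%:R - V%:R) * (a%:R - U'%:R) / n%:R)
    + ((a%:R - U%:R) * E U.+1 V + (b%:R - V%:R) * E U V.+1)
    + ((a%:R - U'%:R) * E U'.+1 V' + (b%:R - V'%:R) * E U' V'.+1).
  apply: (@coupled_averages _ _ _ _ m n%:R _ _ _ _ _ _ _ _ _ _ (2 * H - 2 * w));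
    rewrite ?natge //.
  - rewrite mulrC; apply: ler_pM; rewrite ?natge // lerD2l lerN2 ler_nat ?(ltnW U'U) //.
    exact: ltnW.
  - move=> /(nat0 _ _ Ua) Ua' /(nat0 _ _ U'a) U'a'.
    by apply: (hG' _ _ _ _ w) => //; [rewrite !addSn UV | rewrite !eS /w; ring].
  - move=> /(nat0 _ _ Ua) Ua' /(nat0 _ _ V'b) V'b'; rewrite -Wp.
    by apply: (hG' _ _ _ _ (w + 1)) => //;
      [rewrite addSn addnS UV | exact: leqW | rewrite eS /w; ring].
  - move=> /(nat0 _ _ Vb) Vb' /(nat0 _ _ U'a) U'a'; rewrite -Wm.
    by apply: (hG' _ _ _ _ (w - 1)) => //; [rewrite addSn addnS UV | rewrite eS /w; ring].
  - move=> /(nat0 _ _ Vb) Vb' /(nat0 _ _ V'b) V'b'.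
    by apply: (hG' _ _ _ _ w) => //; rewrite !addnS UV.
set Down := `|(U%:R * G U.-1 V + V%:R * G U V.-1) - (U'%:R * G U'.-1 V' + V'%:R * G U' V'.-1)|.
have hDown : Down <= al * (k%:R * blockW H w - U%:R * V'%:R / n%:R)
    + (U%:R * E U.-1 V + V%:R * E U V.-1) + (U'%:R * E U'.-1 V' + V'%:R * E U' V'.-1).
  rewrite /Down [U%:R * G _ _ + _]addrC [U'%:R * G _ _ + _]addrC.
  rewrite [U%:R * E _ _ + _]addrC [U'%:R * E _ _ + _]addrC.
  apply: (@coupled_averages _ _ _ _ k%:R n%:R _ _ _ _ _ _ _ _ _ _ (2 * H - 2 * w)) => //.
  - by rewrite addrC.
  - by rewrite addrC.
  - by rewrite mulrC; apply: ler_pM; rewrite ?ler_nat // ltnW.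
  - move=> /natpos V0' /natpos V'0'.
    by apply: (hG' _ _ _ _ w) => //; [exact: le_pred | exact: le_pred | exact: pb3].
  - move=> /natpos V0' /natpos U'0'; rewrite -Wp.
    have [pb6 _ _] := pb2 U'0'.
    by apply: (hG' _ _ _ _ (w + 1)) => //; [exact: le_pred | exact: le_pred
      | exact: pb6 | exact: le_pred | rewrite eP // /w; ring].
  - move=> /natpos U0' /natpos V'0'; rewrite -Wm.
    by apply: (hG' _ _ _ _ (w - 1)) => //; [exact: le_pred | exact: le_pred
      | exact: pb4 | rewrite eP // /w; ring].
  - move=> /natpos U0' /natpos U'0'.
    have [_ pb7 pb8] := pb2 U'0'.
    by apply: (hG' _ _ _ _ w) => //; [exact: le_pred | exact: le_pred
      | rewrite !eP // /w; ring].
have hH : `|G U V - G U' V'| <= al * blockW H w + E U V + E U' V'.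
  exact: hG'.
have t0 : 0 <= al * (U%:R * V'%:R / n%:R) by rewrite mulr_ge0 // divr_ge0 ?mulr_ge0 // ltW.
(* The decrease due to down moves is dropped; that of the up moves is enough. *)
have hDown' : Down <= al * (k%:R * blockW H w)
    + (U%:R * E U.-1 V + V%:R * E U V.-1) + (U'%:R * E U'.-1 V' + V'%:R * E U' V'.-1).
  by apply: le_trans hDown _; rewrite !lerD2r mulrBr gerBl.
apply: (@le_trans _ _ ((1 - u * m - v * k%:R) * `|G U V - G U' V'| + u * Up + v * Down)).
  rewrite -[in leRHS](ger0_norm hold) -[X in _ <= _ + X * Up + _](ger0_norm u0).
  rewrite -[X in _ <= _ + _ + X * Down](ger0_norm v0) -!normrM.
  apply: le_trans (lerD (ler_normD _ _) (lexx _)); apply: le_trans (ler_normD _ _).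
  by apply: eq_ler; congr (`|_|); ring.
have k1 := ler_wpM2l hold hH; have k2 := ler_wpM2l u0 hUp; have k3 := ler_wpM2l v0 hDown'.
apply: le_trans (lerD (lerD k1 k2) k3) _; apply: eq_ler; ring.
Qed.

End BlockCoupling.

(** A canonical configuration with [k] pluses: it transfers one-step estimates from configurations
    to levels and provides the starting state of the lower bound. *)
Definition level_config n k : config n := [ffun i : 'I_n => (i < k)%N].

Lemma pluses_level_config n k : (k <= n)%N -> pluses (level_config n k) = k.
Proof.
move=> kn; rewrite /pluses (eq_bigr (fun i : 'I_n => nat_of_bool (i < k)%N)) => [|i _].
  rewrite -(big_mkord xpredT (fun i => nat_of_bool (i < k)%N)) /= (big_cat_nat (leq0n k) kn) /=.
  rewrite (@eq_big_nat _ _ _ 0 k _ (fun=> 1%N)) => [|i /andP[_ ->] //].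
  rewrite (@eq_big_nat _ _ _ k n _ (fun=> 0%N)) => [|i /andP[]]; last by rewrite leqNgt => /negbTE ->.
  by rewrite !sum_nat_const_nat subn0 muln1 muln0 addn0.
by rewrite ffunE.
Qed.

(** * Presence of both spins in both blocks *)

Section BlockSpread.
Variables (R : realType) (n : nat) (beta : R).
Hypothesis n_gt0 : (0 < n)%N.
Hypothesis beta01 : 0 <= beta <= 1.
Variables a b : nat.
Hypothesis abn : (a + b)%N = n.

Let n_gt0R : 0 < n%:R :> R.
Proof. by rewrite ltr0n. Qed.

(* Vanishes when both blocks have the same density of pluses. *)
Definition blockZ (U V : nat) : R := (b%:R * U%:R - a%:R * V%:R) / n%:R.
(* The constants make [blockY < 1] force a positive density of both spins in both
   blocks; see [block_spread]. *)
Definition blockY (U V : nat) : R := (64 * (blockZ U V / n%:R)) ^+ 2 + (4 * sg R n (U + V)) ^+ 2.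

(** The common bias cancels in [blockZ], whose drift is exactly [- (u + v) * Z]. Since
    [up_rate + down_rate >= 1], the rate [u + v] is at least [1 / n] whatever [delta] is; the jumps
    have size at most 1. *)
Lemma bstep_blockZ U V : (U <= a)%N -> (V <= b)%N ->
  bstep n beta a b (fun U V => blockZ U V ^+ 2) U V <= (1 - 2 / n%:R) * blockZ U V ^+ 2 + 1.
Proof.
move=> Ua Vb; have n0 := n_gt0R; have nE : n%:R = a%:R + b%:R :> R by rewrite -abn natrD.
have kn : (U + V <= n)%N by rewrite -abn leq_add.
have [b0 d0 _ bd] := rates_bound n_gt0 beta01 kn.
set k := (U + V)%N in kn b0 d0 bd *.
set u := up_rate n beta k / n%:R; set v := down_rate n beta k / n%:R.
set m : R := n%:R - k%:R.
have eb : birth n beta k = u * m by rewrite /birth /u /m; field; rewrite gt_eqF.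
have ed : death n beta k = v * k%:R by rewrite /death /v; field; rewrite gt_eqF.
have u0 : 0 <= u by rewrite divr_ge0 ?ltW ?lg_gt0.
have v0 : 0 <= v by rewrite divr_ge0 ?subr_ge0 ?(ltW (lg_lt1 _)) // ltW.
have uv : n%:R^-1 <= u + v.
  rewrite /u /v -mulrDl ler_peMl ?invr_ge0 ?(ltW n0) // /up_rate /down_rate.
  have [be0 be1] := andP beta01.
  have : lg (beta * (2 * k%:R - n%:R - 1) / n%:R) <= lg (beta * (2 * k%:R - n%:R + 1) / n%:R).
    apply: ler_lg; rewrite ler_pM2r ?invr_gt0 //; apply: ler_wpM2l => //; lra.
  lra.
set Z := blockZ U V; set p : R := b%:R / n%:R; set q : R := a%:R / n%:R.
have p01 : 0 <= p <= 1.
  by rewrite /p divr_ge0 //= ler_pdivrMr // mul1r ler_nat -abn leq_addl.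
have q01 : 0 <= q <= 1.
  by rewrite /q divr_ge0 //= ler_pdivrMr // mul1r ler_nat -abn leq_addr.
have z1 : blockZ U.+1 V = Z + p by rewrite /Z /p /blockZ -natr1; field; rewrite gt_eqF.
have z2 : blockZ U V.+1 = Z - q by rewrite /Z /q /blockZ -natr1; field; rewrite gt_eqF.
have z3 (f : R -> R) : U%:R * (f (blockZ U.-1 V) - f Z) = U%:R * (f (Z - p) - f Z).
  rewrite /Z; case: (U) => [|U']; rewrite ?mul0r //= /blockZ -natr1 /p.
  by congr (_ * (f _ - _)); field; rewrite gt_eqF.
have z4 (f : R -> R) : V%:R * (f (blockZ U V.-1) - f Z) = V%:R * (f (Z + q) - f Z).
  rewrite /Z; case: (V) => [|V']; rewrite ?mul0r //= /blockZ -natr1 /q.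
  by congr (_ * (f _ - _)); field; rewrite gt_eqF.
have Ua' : 0 <= a%:R - U%:R :> R by rewrite subr_ge0 ler_nat.
have Vb' : 0 <= b%:R - V%:R :> R by rewrite subr_ge0 ler_nat.
have p2 : p ^+ 2 <= 1 by case/andP: p01 => ? ?; rewrite expr_le1.
have q2 : q ^+ 2 <= 1 by case/andP: q01 => ? ?; rewrite expr_le1.
rewrite /bstep -/k -/u -/v z1 z2 (z3 (fun x => x ^+ 2)) (z4 (fun x => x ^+ 2)).
have zE1 : (a%:R - U%:R) * p - (b%:R - V%:R) * q = - Z.
  by rewrite /p /q /Z /blockZ; field; rewrite gt_eqF.
have zE2 : V%:R * q - U%:R * p = - Z.
  by rewrite /p /q /Z /blockZ; field; rewrite gt_eqF.
have -> : Z ^+ 2 + u * ((a%:R - U%:R) * ((Z + p) ^+ 2 - Z ^+ 2) +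
     (b%:R - V%:R) * ((Z - q) ^+ 2 - Z ^+ 2)) +
   v * (U%:R * ((Z - p) ^+ 2 - Z ^+ 2) + V%:R * ((Z + q) ^+ 2 - Z ^+ 2)) =
   Z ^+ 2 + u * (2 * Z * ((a%:R - U%:R) * p - (b%:R - V%:R) * q) +
      ((a%:R - U%:R) * p ^+ 2 + (b%:R - V%:R) * q ^+ 2)) +
    v * (2 * Z * (V%:R * q - U%:R * p) + (U%:R * p ^+ 2 + V%:R * q ^+ 2)) by ring.
rewrite zE1 zE2.
have h1 : u * ((a%:R - U%:R) * p ^+ 2 + (b%:R - V%:R) * q ^+ 2) <= u * m.
  apply: ler_wpM2l => //; rewrite /m nE /k natrD.
  have : (a%:R - U%:R) * p ^+ 2 <= a%:R - U%:R by rewrite ler_piMr.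
  have : (b%:R - V%:R) * q ^+ 2 <= b%:R - V%:R by rewrite ler_piMr.
  lra.
have h2 : v * (U%:R * p ^+ 2 + V%:R * q ^+ 2) <= v * k%:R.
  apply: ler_wpM2l => //; rewrite /k natrD.
  have : U%:R * p ^+ 2 <= U%:R by rewrite ler_piMr.
  have : V%:R * q ^+ 2 <= V%:R by rewrite ler_piMr.
  lra.
have h3 : n%:R^-1 * Z ^+ 2 <= (u + v) * Z ^+ 2 by rewrite ler_wpM2r ?sqr_ge0.
have := c0_gt0 R; rewrite eb ed in bd; lra.
Qed.

Lemma mstep_sg_sqr k : (k <= n)%N ->
  mstep n beta (fun j => sg R n j ^+ 2) k <= sg R n k ^+ 2 + 6 * n%:R^-1 ^+ 2.
Proof.
move=> kn; have := @gstep_sqr_le R n beta n_gt0 beta01 (level_config n k).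
rewrite (@gstep_pluses _ _ _ n_gt0 (fun j => sg R n j ^+ 2)) pluses_level_config //.
move=> h; apply: le_trans h _; rewrite lerD2r ler_piMl ?sqr_ge0 // gerBl.
by have [_ b1] := andP beta01; rewrite !mulr_ge0 ?subr_ge0 ?invr_ge0.
Qed.

Lemma bstep_lin (c d : R) (f g : nat -> nat -> R) U V :
  bstep n beta a b (fun U V => c * f U V + d * g U V) U V =
  c * bstep n beta a b f U V + d * bstep n beta a b g U V.
Proof. by rewrite /bstep; ring. Qed.

Lemma bstep_cst (c : R) U V : bstep n beta a b (fun _ _ => c) U V = c.
Proof. by rewrite /bstep !subrr !mulr0 !addr0 mulr0 addr0 mulr0 addr0. Qed.

(** Per step [blockZ ^ 2] gains at most 1 and [sg ^ 2] at most [6 / n ^ 2] on average; the total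
    [(64 ^ 2 + 16 * 6) / n ^ 2] is below [(68 / n) ^ 2]. *)
Lemma bstep_blockY U V : (U <= a)%N -> (V <= b)%N ->
  bstep n beta a b blockY U V <= blockY U V + (68 * n%:R^-1) ^+ 2.
Proof.
move=> Ua Vb.
have kn : (U + V <= n)%N by rewrite -abn leq_add.
have h1 := bstep_blockZ Ua Vb; have h2 := mstep_sg_sqr kn.
rewrite -(bstep_sum beta n_gt0 (fun j => sg R n j ^+ 2) _ _ abn) in h2.
have -> : bstep n beta a b blockY U V = (64 * n%:R^-1) ^+ 2 *
    bstep n beta a b (fun U V => blockZ U V ^+ 2) U V
    + 16 * bstep n beta a b (fun x y => sg R n (x + y) ^+ 2) U V.
  rewrite -bstep_lin; rewrite /bstep /blockY; ring.
have h3 : bstep n beta a b (fun U V => blockZ U V ^+ 2) U V <= blockZ U V ^+ 2 + 1.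
  by apply: le_trans h1 _; rewrite lerD2r ler_piMl ?sqr_ge0 // gerBl divr_ge0.
have h4 := ler_wpM2l (sqr_ge0 (64 * n%:R^-1 : R)) h3.
rewrite /blockY; move: h2 h4.
have -> : (64 * (blockZ U V / n%:R)) ^+ 2 = (64 * n%:R^-1) ^+ 2 * blockZ U V ^+ 2.
  by rewrite -exprMn; congr (_ ^+ 2); ring.
move: (bstep _ _ _ _ _ _ _) (bstep _ _ _ _ _ _ _) (sqr_ge0 (n%:R^-1 : R)) => A B; lra.
Qed.

Lemma blockY_ge0 U V : 0 <= blockY U V.
Proof. by apply: addr_ge0; exact: sqr_ge0. Qed.

Lemma bstep_norm (G : nat -> nat -> R) :
  (forall U V, (U <= a)%N -> (V <= b)%N -> `|G U V| <= 1) ->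
  forall U V, (U <= a)%N -> (V <= b)%N -> `|bstep n beta a b G U V| <= 1.
Proof.
move=> G1 U V Ua Vb; have n0 := n_gt0R.
have kn : (U + V <= n)%N by rewrite -abn leq_add.
have [_ _ _ bd] := rates_bound n_gt0 beta01 kn.
set k := (U + V)%N in kn bd.
set u := up_rate n beta k / n%:R; set v := down_rate n beta k / n%:R.
set m : R := n%:R - k%:R.
have eb : birth n beta k = u * m by rewrite /birth /u /m; field; rewrite gt_eqF.
have ed : death n beta k = v * k%:R by rewrite /death /v; field; rewrite gt_eqF.
have u0 : 0 <= u by rewrite divr_ge0 ?ltW ?lg_gt0.
have v0 : 0 <= v by rewrite divr_ge0 ?subr_ge0 ?(ltW (lg_lt1 _)) // ltW.
have Ua' : 0 <= a%:R - U%:R :> R by rewrite subr_ge0 ler_nat.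
have Vb' : 0 <= b%:R - V%:R :> R by rewrite subr_ge0 ler_nat.
have hold : 0 <= 1 - u * m - v * k%:R.
  by rewrite -eb -ed; have := c0_gt0 R; lra.
have -> : bstep n beta a b G U V = (1 - u * m - v * k%:R) * G U V
   + u * (a%:R - U%:R) * G U.+1 V + u * (b%:R - V%:R) * G U V.+1
   + v * U%:R * G U.-1 V + v * V%:R * G U V.-1.
  rewrite /bstep -/k -/u -/v /m; have -> : n%:R = a%:R + b%:R :> R by rewrite -abn natrD.
  by rewrite /k natrD; ring.
have one (p x : R) : 0 <= p -> (p != 0 -> `|x| <= 1) -> `|p * x| <= p.
  move=> p0 h; have [->|pn] := eqVneq p 0; first by rewrite mul0r normr0.
  by rewrite normrM ger0_norm // ler_piMr // h.
have e : 1 = (1 - u * m - v * k%:R) + u * (a%:R - U%:R) + u * (b%:R - V%:R) + v * U%:R + v * V%:R.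
  rewrite /m; have -> : n%:R = a%:R + b%:R :> R by rewrite -abn natrD.
  by rewrite /k natrD; ring.
rewrite [leRHS]e.
have le_pred (x y : nat) : (x <= y)%N -> (x.-1 <= y)%N by apply: leq_trans; exact: leq_pred.
have t1 : `|u * (a%:R - U%:R) * G U.+1 V| <= u * (a%:R - U%:R).
  apply: one => [|nz]; first by rewrite mulr_ge0.
  have Une : a != U by apply: contraNneq nz => ->; rewrite subrr mulr0.
  by apply: G1 => //; rewrite ltn_neqAle eq_sym Une.
have t2 : `|u * (b%:R - V%:R) * G U V.+1| <= u * (b%:R - V%:R).
  apply: one => [|nz]; first by rewrite mulr_ge0.
  have Vne : b != V by apply: contraNneq nz => ->; rewrite subrr mulr0.
  by apply: G1 => //; rewrite ltn_neqAle eq_sym Vne.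
have t3 : `|v * U%:R * G U.-1 V| <= v * U%:R.
  by apply: one => [|_]; [rewrite mulr_ge0 | apply: G1 => //; exact: le_pred].
have t4 : `|v * V%:R * G U V.-1| <= v * V%:R.
  by apply: one => [|_]; [rewrite mulr_ge0 | apply: G1 => //; exact: le_pred].
have t5 : `|(1 - u * m - v * k%:R) * G U V| <= 1 - u * m - v * k%:R.
  by apply: one => // _; exact: G1.
by do 4! (apply: le_trans (ler_normD _ _) _; apply: lerD => //).
Qed.

Lemma iter_bstep_norm s (G : nat -> nat -> R) :
  (forall U V, (U <= a)%N -> (V <= b)%N -> `|G U V| <= 1) ->
  forall U V, (U <= a)%N -> (V <= b)%N -> `|iter s (bstep n beta a b) G U V| <= 1.
Proof. by move=> G1; elim: s => [//|s IH]; apply: bstep_norm. Qed.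

Definition cB : R := c0 R * (5 / 64) ^+ 2.

Lemma cB_gt0 : 0 < cB. Proof. by rewrite /cB; apply: mulr_gt0; [exact: c0_gt0 | apply: exprn_gt0; lra]. Qed.

Lemma cB_le1 : cB <= 1. Proof. by have := c0_le_half R; rewrite /cB; lra. Qed.

Hypothesis a_ge : (n <= 4 * a)%N.
Hypothesis b_ge : (n <= 4 * b)%N.

(** [blockY < 1] forces at most [5 n / 8] pluses and [64 * |blockZ| <= n]. A block of size at least
    [n / 4] then contains at least [(n / 4) * (3 / 8) - n / 64 = 5 n / 64] minuses, which explains
    [cB]. *)
Lemma block_spread U V U' V' : (U <= a)%N -> (V <= b)%N -> (U' <= a)%N -> (V' <= b)%N ->
  (U + V = U' + V')%N -> blockY U V < 1 -> blockY U' V' < 1 ->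
  cB <= up_rate n beta (U + V) / n%:R * ((b%:R - V%:R) * (a%:R - U'%:R) / n%:R).
Proof.
move=> Ua Vb U'a V'b UV y1 y2; have n0 := n_gt0R; have nn : n%:R != 0 :> R by rewrite gt_eqF.
have key x y : blockY x y < 1 ->
    - n%:R <= 64 * blockZ x y <= n%:R /\ 4 * sg R n (x + y) <= 1.
  rewrite /blockY => h.
  have h1 : (64 * blockZ x y) ^+ 2 <= n%:R ^+ 2.
    rewrite -[leRHS]mul1r -ler_pdivrMr ?exprn_gt0 //; have := sqr_ge0 (4 * sg R n (x + y)).
    have -> : (64 * blockZ x y) ^+ 2 / n%:R ^+ 2 = (64 * (blockZ x y / n%:R)) ^+ 2 by field.
    lra.
  have h2 : (4 * sg R n (x + y)) ^+ 2 <= 1.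
    by have := sqr_ge0 (64 * (blockZ x y / n%:R)); lra.
  split; first by rewrite -ler_norml -ler_sqr ?nnegrE // real_normK ?num_real.
  apply: le_trans (ler_norm _) _.
  by rewrite -(@ler_sqr _ _ 1) ?nnegrE // real_normK ?num_real // expr1n.
have [/andP[z1 z1'] s1] := key _ _ y1; have [/andP[z2 z2'] s2] := key _ _ y2.
set k := (U + V)%N in s1 *; rewrite -UV -/k in s2.
have k58 : k%:R <= 5 / 8 * n%:R :> R.
  by move: s1; rewrite /sg mulrA ler_pdivrMr // mul1r; lra.
have kn : (k < n)%N by rewrite -(ltr_nat R); lra.
have nE : n%:R = a%:R + b%:R :> R by rewrite -abn natrD.
have eV : n%:R * V%:R = b%:R * k%:R - n%:R * blockZ U V.
  by rewrite /blockZ /k natrD nE; field; rewrite -nE.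
have eU : n%:R * U'%:R = a%:R * k%:R + n%:R * blockZ U' V'.
  by rewrite /blockZ /k UV natrD nE; field; rewrite -nE.
have a4 : n%:R <= 4 * a%:R :> R by rewrite -[4]/(4%:R) -natrM ler_nat.
have b4 : n%:R <= 4 * b%:R :> R by rewrite -[4]/(4%:R) -natrM ler_nat.
have hb : 5 / 64 * n%:R <= b%:R - V%:R :> R.
  rewrite -(ler_pM2l n0) mulrBr eV.
  have : n%:R * (64 * - blockZ U V) <= n%:R * n%:R by rewrite ler_pM2l //; lra.
  have : 0 <= (b%:R - n%:R / 4) * (n%:R - k%:R) :> R by apply: mulr_ge0; lra.
  have : 0 <= n%:R * (5 / 8 * n%:R - k%:R) :> R by apply: mulr_ge0; lra.
  lra.
have ha : 5 / 64 * n%:R <= a%:R - U'%:R :> R.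
  rewrite -(ler_pM2l n0) mulrBr eU.
  have : n%:R * (64 * blockZ U' V') <= n%:R * n%:R by rewrite ler_pM2l //; lra.
  have : 0 <= (a%:R - n%:R / 4) * (n%:R - k%:R) :> R by apply: mulr_ge0; lra.
  have : 0 <= n%:R * (5 / 8 * n%:R - k%:R) :> R by apply: mulr_ge0; lra.
  lra.
have /andP[up _] := up_rate_bound n_gt0 beta01 kn.
have -> : up_rate n beta k / n%:R * ((b%:R - V%:R) * (a%:R - U'%:R) / n%:R) =
   up_rate n beta k * (((b%:R - V%:R) / n%:R) * ((a%:R - U'%:R) / n%:R)) by ring.
rewrite /cB; rewrite [(5 / 64) ^+ 2]expr2.
have c00 := ltW (c0_gt0 R).
apply: ler_pM => //.
by apply: ler_pM; rewrite // ler_pdivlMr.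
Qed.

End BlockSpread.

(** The induction step of [block_coupling_aux], in the case where the bound is not trivial. If the
    certificate gains at least [c], the argument of [bd_coupling_aux] applies; if not, [y >= 1], and
    the growth from [s * y] to [(s + 1) * y] pays for the wasted step. *)
Lemma block_arith (R : realType) (c s W g y om h : R) :
  0 < c -> 0 <= s -> 0 <= W -> 0 <= g -> 0 <= y -> 0 <= om -> 0 <= h ->
  c <= g \/ 1 <= y ->
  (h + (c * (s + 2))^-1) * W + ((s + 1) * y + (s + 1) ^+ 2 * om) / (s + 2) < 1 ->
  (h + (c * (s + 1))^-1) * (W - g) + (s * (y + om) + s ^+ 2 * om) / (s + 1) <=
  (h + (c * (s + 2))^-1) * W + ((s + 1) * y + (s + 1) ^+ 2 * om) / (s + 2).
Proof.
move=> c0 s0 W0 g0 y0 om0 h0 cgy small.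
have s1 : 0 < s + 1 by lra.
have s2 : 0 < s + 2 by lra.
have hW := mulr_ge0 h0 W0; have hg := mulr_ge0 h0 g0.
set N := W / c + s * y + (s ^+ 2 + s) * om.
have e1 : (h + (c * (s + 1))^-1) * (W - g) + (s * (y + om) + s ^+ 2 * om) / (s + 1)
   = h * W - h * g + (N - g / c) / (s + 1).
  by rewrite /N; field; rewrite !gt_eqF.
have e2 : (h + (c * (s + 2))^-1) * W + ((s + 1) * y + (s + 1) ^+ 2 * om) / (s + 2)
   = h * W + (N + y + (s + 1) * om) / (s + 2).
  by rewrite /N; field; rewrite !gt_eqF.
rewrite e1 e2; rewrite e2 in small.
have small2 : N + y + (s + 1) * om < s + 2.
  by rewrite -[ltRHS]mul1r -ltr_pdivrMr //; lra.
suff : (N - g / c) / (s + 1) <= (N + y + (s + 1) * om) / (s + 2) by lra.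
rewrite ler_pdivrMr // mulrAC ler_pdivlMr //.
have gc0 : 0 <= g / c by rewrite divr_ge0 // ltW.
have o0 : 0 <= (s + 1) * om by apply: mulr_ge0 => //; lra.
have o1 : 0 <= (s + 1) * om * (s + 1) by apply: mulr_ge0 => //; lra.
case: cgy => [cg|y1].
  have g1 : 1 <= g / c by rewrite ler_pdivlMr // mul1r.
  have k1 : 0 <= (g / c - 1) * (s + 2) by apply: mulr_ge0; lra.
  have k2 : 0 <= y * (s + 1) by apply: mulr_ge0; lra.
  lra.
have k1 : 0 <= g / c * (s + 2) by apply: mulr_ge0; lra.
have k2 : 0 <= (y - 1) * (s + 1) by apply: mulr_ge0; lra.
lra.
Qed.

Section BlockCouplingTime.
Variables (R : realType) (n : nat) (beta : R).
Hypothesis n_gt0 : (0 < n)%N.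
Hypothesis beta01 : 0 <= beta <= 1.
Variables a b : nat.
Hypothesis abn : (a + b)%N = n.
Hypothesis a_ge : (n <= 4 * a)%N.
Hypothesis b_ge : (n <= 4 * b)%N.

Let n_gt0R : 0 < n%:R :> R.
Proof. by rewrite ltr0n. Qed.

Local Notation Y := (@blockY R n a b).
Local Notation om := (2 * (68 * n%:R^-1) ^+ 2 : R).
Local Notation c := (cB R).

(** The last fraction bounds the proportion of time spent where [block_spread] fails: its indicator
    is at most [Y U V + Y U' V'], and this sum grows by at most [om] per step on average. Elsewhere
    the certificate decreases by at least [c] per step. *)
Lemma block_coupling_aux s (G : nat -> nat -> R) (H : R) U V U' V' :
  (forall U V, (U <= a)%N -> (V <= b)%N -> `|G U V| <= 1) -> 2 <= H ->
  (U <= a)%N -> (V <= b)%N -> (U' <= a)%N -> (V' <= b)%N ->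
  (U + V = U' + V')%N -> (U' < U)%N -> U%:R - U'%:R <= H ->
  `|iter s (bstep n beta a b) G U V - iter s (bstep n beta a b) G U' V'| <=
  2 * ((2 / H ^+ 2 + (c * (s%:R + 1))^-1) * blockW H (U%:R - U'%:R)
       + (s%:R * (Y U V + Y U' V') + s%:R ^+ 2 * om) / (s%:R + 1)).
Proof.
move=> G1 H2.
have cg := cB_gt0 R; have c1 := cB_le1 R.
have HH : 0 < H ^+ 2 by rewrite exprn_gt0; lra.
have h0 : 0 <= 2 / H ^+ 2 by rewrite divr_ge0 // ltW.
have om0 : 0 <= om by rewrite mulr_ge0 ?sqr_ge0.
elim: s U V U' V' => [|s IH] U V U' V' Ua Vb U'a V'b UV U'U wH.
all: set w : R := U%:R - U'%:R in wH *.
all: have w1 : 1 <= w by rewrite /w -natrB ?(ltnW U'U) // ler1n subn_gt0.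
all: have W1 : 1 <= blockW H w by rewrite /blockW; nra.
  have d2 : `|G U V - G U' V'| <= 2.
    by apply: le_trans (ler_normB _ _) _; rewrite -[2]/(1 + 1); apply: lerD; exact: G1.
  apply: le_trans d2 _; rewrite -[leLHS]mulr1 ler_pM2l // !mul0r expr0n !mul0r addr0 add0r mulr1 mul0r addr0.
  rewrite mulrDl; apply: (@le_trans _ _ (c^-1 * blockW H w)); last first.
    by rewrite lerDr mulr_ge0 // (le_trans _ W1).
  by rewrite mulrC ler_pdivlMr // mul1r (le_trans c1).
set Yx := Y U V; set Yy := Y U' V'.
have Yx0 : 0 <= Yx by exact: blockY_ge0.
have Yy0 : 0 <= Yy by exact: blockY_ge0.
have sE : s.+1%:R = s%:R + 1 :> R by rewrite -natr1.
have sE2 : s%:R + 1 + 1 = s%:R + 2 :> R by ring.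
rewrite sE sE2.
set X : R := _ + _ / (s%:R + 2).
have [X1|X1] := leP 1 X.
  apply: (@le_trans _ _ (1 + 1)); last by rewrite -[1 + 1]/2 ler_peMr.
  by apply: le_trans (ler_normB _ _) _; apply: lerD; exact: iter_bstep_norm.
have s0 : 0 <= s%:R :> R by [].
have s1 : 0 < s%:R + 1 :> R by lra.
have s2 : 0 < s%:R + 2 :> R by lra.
have W0 : 0 <= blockW H w by lra.
(* Beyond [H - 1], [2 * H * w - w ^ 2 = H ^ 2 - (H - w) ^ 2 >= H ^ 2 - 1]; the factor [2 / H ^ 2]
   and [H >= 2] bring this above 1. *)
have [wH1|wH1] := leP w (H - 1); last first.
  exfalso; move: X1; rewrite ltNge => /negP; apply; rewrite /X mulrDl -addrA.
  apply: (@le_trans _ _ (2 / H ^+ 2 * blockW H w)); last first.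
    rewrite lerDl addr_ge0 //; first by rewrite mulr_ge0 // invr_ge0 mulr_ge0 // ltW.
    rewrite divr_ge0 ?(ltW s2) // addr_ge0 // mulr_ge0 ?addr_ge0 ?sqr_ge0 //.
  by rewrite mulrAC ler_pdivlMr // mul1r /blockW; nra.
pose E x y : R := (2 * s%:R / (s%:R + 1)) * Y x y + (s%:R ^+ 2 * om / (s%:R + 1)) * 1.
have E0 x y : (x <= a)%N -> (y <= b)%N -> 0 <= E x y.
  move=> _ _; have s1' := ltW s1; rewrite /E mulr1; apply: addr_ge0.
    by apply: mulr_ge0; [apply: divr_ge0 => //; exact: mulr_ge0 | exact: blockY_ge0].
  by apply: divr_ge0 => //; apply: mulr_ge0 => //; exact: sqr_ge0.
pose al : R := 2 * (2 / H ^+ 2 + (c * (s%:R + 1))^-1).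
have al0 : 0 <= al by rewrite mulr_ge0 // addr_ge0 // invr_ge0 mulr_ge0 // ltW.
have := @blockW_step R n beta n_gt0 beta01 a b abn (iter s (bstep n beta a b) G) E al H U V U' V'
  al0 E0 _ Ua Vb U'a V'b UV U'U wH1.
have hE x y x' y' : (x <= a)%N -> (y <= b)%N -> (x' <= a)%N -> (y' <= b)%N ->
     (x + y = x' + y')%N -> (x' < x)%N -> x%:R - x'%:R <= H ->
     `|iter s (bstep n beta a b) G x y - iter s (bstep n beta a b) G x' y'| <=
      al * blockW H (x%:R - x'%:R) + E x y + E x' y'.
  move=> xa yb x'a y'b xy x'x xH; apply: le_trans (IH _ _ _ _ xa yb x'a y'b xy x'x xH) _.
  have -> : 2 * ((2 / H ^+ 2 + (c * (s%:R + 1))^-1) * blockW H (x%:R - x'%:R)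
       + (s%:R * (Y x y + Y x' y') + s%:R ^+ 2 * om) / (s%:R + 1)) =
     al * blockW H (x%:R - x'%:R) + E x y + E x' y'.
    by rewrite /al /E; field; rewrite !gt_eqF //; lra.
  exact: lexx.
move=> /(_ hE) h; apply: le_trans h _.
set g := up_rate _ _ _ / _ * _.
have g0 : 0 <= g.
  have n0 := ltW n_gt0R; apply: mulr_ge0; apply: divr_ge0 => //; first exact/ltW/lg_gt0.
  by apply: mulr_ge0; rewrite subr_ge0 ler_nat.
have cgy : c <= g \/ 1 <= Yx + Yy.
  have [y1|] := leP 1 Yx; first by right; rewrite (le_trans y1) // lerDl.
  have [y1|y2 y1] := leP 1 Yy; first by right; rewrite (le_trans y1) // lerDr.
  by left; apply: (@block_spread R n beta n_gt0 beta01 a b abn a_ge b_ge U V U' V').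
have := block_arith cg s0 W0 g0 (addr_ge0 Yx0 Yy0) om0 h0 cgy X1.
rewrite -/X => fin.
have bx := bstep_blockY n_gt0 beta01 abn Ua Vb; have by_ := bstep_blockY n_gt0 beta01 abn U'a V'b.
rewrite -/Yx -/Yy in bx by_.
have l0 : 0 <= 2 * s%:R / (s%:R + 1) :> R by rewrite divr_ge0 ?mulr_ge0 // ltW.
apply: le_trans (_ : _ <= 2 * ((2 / H ^+ 2 + (c * (s%:R + 1))^-1) * (blockW H w - g) +
   (s%:R * (Yx + Yy + om) + s%:R ^+ 2 * om) / (s%:R + 1))) _; last by rewrite ler_pM2l.
rewrite /E !bstep_lin !bstep_cst.
have := ler_wpM2l l0 bx; have := ler_wpM2l l0 by_.
set Bx := bstep _ _ _ _ _ U V; set By := bstep _ _ _ _ _ U' V' => k1 k2.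
rewrite -subr_ge0.
have -> : 2 * ((2 / H ^+ 2 + (c * (s%:R + 1))^-1) * (blockW H w - g) +
     (s%:R * (Yx + Yy + om) + s%:R ^+ 2 * om) / (s%:R + 1)) -
  (al * (blockW H w - g) + (2 * s%:R / (s%:R + 1) * Bx + s%:R ^+ 2 * om / (s%:R + 1) * 1) +
   (2 * s%:R / (s%:R + 1) * By + s%:R ^+ 2 * om / (s%:R + 1) * 1)) =
   (2 * s%:R / (s%:R + 1) * (Yx + (68 * n%:R^-1) ^+ 2) - 2 * s%:R / (s%:R + 1) * Bx) +
   (2 * s%:R / (s%:R + 1) * (Yy + (68 * n%:R^-1) ^+ 2) - 2 * s%:R / (s%:R + 1) * By).
  by rewrite /al; field; rewrite !gt_eqF //; have := n_gt0R; lra.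
by rewrite addr_ge0 // subr_ge0.
Qed.

Definition bK : R := 4 * (1 + 2 / c).

Lemma block_coupling s (G : nat -> nat -> R) U V U' V' :
  (forall U V, (U <= a)%N -> (V <= b)%N -> `|G U V| <= 1) ->
  (U <= a)%N -> (V <= b)%N -> (U' <= a)%N -> (V' <= b)%N ->
  (U + V = U' + V')%N ->
  `|iter s (bstep n beta a b) G U V - iter s (bstep n beta a b) G U' V'| <=
  bK * `|U%:R - U'%:R| / Num.sqrt s.+1%:R + 2 * (Y U V + Y U' V') + 2 * (s%:R * om).
Proof.
move=> G1; wlog UU : U V U' V' / (U' <= U)%N.
  move=> hw Ua Vb U'a V'b UV; have [UU|/ltnW UU] := leqP U' U; first exact: hw.
  by rewrite distrC (distrC U%:R) [Y U V + _]addrC; exact: hw.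
move=> Ua Vb U'a V'b UV.
have om0 : 0 <= om by rewrite mulr_ge0 ?sqr_ge0.
have Y0 : 0 <= Y U V + Y U' V' by rewrite addr_ge0 ?blockY_ge0.
have r0 : 0 <= 2 * (Y U V + Y U' V') + 2 * (s%:R * om) by rewrite addr_ge0 ?mulr_ge0.
move: UU; rewrite leq_eqVlt => /orP[/eqP e|UU].
  have eV : V' = V by apply/eqP; rewrite -(eqn_add2l U') -UV e.
  by move: r0; rewrite e eV !subrr !normr0 mulr0 mul0r add0r.
have cg := cB_gt0 R; set q := Num.sqrt _.
have q1 : 1 <= q by rewrite -sqrtr1 ler_sqrt // ler1n.
have qq : q ^+ 2 = s%:R + 1 by rewrite sqr_sqrtr // -natr1.
have qp : 0 < q by lra.
rewrite (@ger0_norm _ (U%:R - U'%:R)) ?subr_ge0 ?ler_nat ?(ltnW UU) //.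
set w : R := U%:R - U'%:R.
have w1 : 1 <= w by rewrite /w -natrB ?(ltnW UU) // ler1n subn_gt0.
have ci : 0 < 2 / c by rewrite divr_gt0.
have [wH|/ltW wH] := leP w (2 * q); last first.
  apply: (@le_trans _ _ (1 + 1)).
    by apply: le_trans (ler_normB _ _) _; apply: lerD; exact: iter_bstep_norm.
  rewrite -addrA; apply: (@le_trans _ _ (bK * w / q)); last by rewrite lerDl.
  rewrite ler_pdivlMr //; have : 0 <= 2 / c * w by rewrite mulr_ge0 //; lra.
  by rewrite /bK; lra.
have H2 : 2 <= 2 * q by lra.
apply: le_trans (block_coupling_aux s G1 H2 Ua Vb U'a V'b UV UU wH) _.
rewrite -/w -qq mulrDr -[leRHS]addrA; apply: lerD.
  have -> : 2 * ((2 / (2 * q) ^+ 2 + (c * q ^+ 2)^-1) * blockW (2 * q) w) =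
     (1 + 2 / c) * ((4 * q * w - w ^+ 2) / q ^+ 2).
    by rewrite /blockW; field; rewrite !gt_eqF.
  have -> : bK * w / q = (1 + 2 / c) * (4 * q * w / q ^+ 2).
    by rewrite /bK; field; rewrite !gt_eqF.
  rewrite ler_pM2l; last by lra.
  by rewrite ler_pM2r ?invr_gt0 ?exprn_gt0 // gerBl sqr_ge0.
rewrite -mulrDr ler_pM2l // qq ler_pdivrMr; last by rewrite -qq exprn_gt0.
set y := Y U V + Y U' V' in Y0 *.
have : 0 <= s%:R * om by rewrite mulr_ge0.
have s0 : 0 <= s%:R :> R by [].
have : 0 <= y * s%:R by rewrite mulr_ge0.
lra.
Qed.

End BlockCouplingTime.

(** * Moments along the chain *)

Section Recursions.
Variable R : realType.

Lemma affine_rec (u : nat -> R) (rho c : R) k : 0 < rho <= 1 ->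
  (forall t, u t.+1 <= (1 - rho) * u t + c) -> u k <= (1 - rho) ^+ k * u 0 + c / rho - (1 - rho) ^+ k * (c / rho).
Proof.
move=> /andP[r0 r1] hu; elim: k => [|k IH]; first by rewrite !expr0; lra.
apply: le_trans (hu k) _; rewrite exprS.
have h : 0 <= 1 - rho by lra.
have e : c = rho * (c / rho) by rewrite mulrCA mulfV ?mulr1 // gt_eqF.
have := ler_wpM2l h IH; move: (c / rho) e => d ->; lra.
Qed.

Lemma affine_rec_le (u : nat -> R) (rho c : R) k : 0 < rho <= 1 -> 0 <= c ->
  (forall t, u t.+1 <= (1 - rho) * u t + c) -> u k <= (1 - rho) ^+ k * u 0 + c / rho.
Proof.
move=> r01 c0 hu; have [r0 r1] := andP r01.
apply: le_trans (affine_rec k r01 hu) _; rewrite gerBl mulr_ge0 ?divr_ge0 ?exprn_ge0 //; lra.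
Qed.

(* Discrete analogue of [u' <= - (a / N) u ^ 2]. *)
Lemma quadratic_rec (u : nat -> R) (N al K eta C : R) k :
  1 <= N -> 0 < al -> 1 <= K -> 0 <= eta <= 1 -> 0 <= C ->
  2 <= al * K -> 4 * al * K <= N -> C / N <= al * K ^+ 2 * eta ^+ 2 / 2 ->
  u 0 <= 1 ->
  (forall t, u t.+1 <= u t - al / N * u t ^+ 2 + C / N ^+ 2) ->
  (forall t, 0 <= u t) ->
  u k <= K * (N / (k%:R + N) + eta).
Proof.
move=> N1 al0 K1 /andP[e0 e1] C0 aK aKN CN u0 hu u_ge0.
have N0 : 0 < N by lra.
elim: k => [|k IH].
  by rewrite add0r divff ?gt_eqF //; apply: le_trans u0 _; nra.
have k0 : 0 <= k%:R :> R by [].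
have kN : 0 < k%:R + N by lra.
have kN1 : 0 < k%:R + 1 + N by lra.
set y := N / (k%:R + N) in IH.
have y0 : 0 <= y by rewrite divr_ge0 ?ltW.
have y1 : y <= 1 by rewrite ler_pdivrMr // mul1r; lra.
have yy : y - y ^+ 2 / N <= N / (k.+1%:R + N).
  rewrite -natr1 -subr_ge0.
  have -> : N / (k%:R + 1 + N) - (y - y ^+ 2 / N) = N / ((k%:R + N) ^+ 2 * (k%:R + 1 + N)).
    by rewrite /y; field; rewrite !gt_eqF.
  by rewrite divr_ge0 ?(ltW N0) // mulr_ge0 ?sqr_ge0 ?ltW.
set z := K * (y + eta) in IH.
have zK : z <= 2 * K by rewrite /z; nra.
have mono : u k - al / N * u k ^+ 2 <= z - al / N * z ^+ 2.
  rewrite -subr_ge0.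
  have -> : z - al / N * z ^+ 2 - (u k - al / N * u k ^+ 2) =
    (z - u k) * (1 - al / N * (z + u k)) by ring.
  apply: mulr_ge0; first by rewrite subr_ge0.
  rewrite subr_ge0 mulrAC ler_pdivrMr // mul1r; apply: le_trans aKN.
  have : al * (z + u k) <= al * (4 * K) by rewrite ler_pM2l //; lra.
  by lra.
apply: le_trans (hu k) _; apply: le_trans (lerD mono (lexx _)) _.
have h1 : z - al / N * z ^+ 2 + C / N ^+ 2 <= K * (y - y ^+ 2 / N + eta).
  have Ni : 0 < N^-1 by rewrite invr_gt0.
  have Ni0 := ltW Ni; have al0' := ltW al0; have K0 : 0 <= K by lra.
  have sq0 (t : R) : 0 <= t ^+ 2 by exact: sqr_ge0.
  have -> : C / N ^+ 2 = N^-1 * (C / N) by field; rewrite gt_eqF.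
  have k1 : N^-1 * (C / N) <= N^-1 * (al * K ^+ 2 * eta ^+ 2 / 2) by rewrite ler_pM2l.
  have k2 : K * (2 * y ^+ 2) <= K * (al * K * y ^+ 2).
    by rewrite ler_pM2l; [rewrite ler_wpM2r ?sqr_ge0 | lra].
  have k3 : N^-1 * (K * (2 * y ^+ 2)) <= N^-1 * (K * (al * K * y ^+ 2)) by rewrite ler_pM2l.
  have k4 : 0 <= N^-1 * (al * K ^+ 2 * (2 * y * eta)).
    by repeat (apply: mulr_ge0 => //).
  have k5 : 0 <= N^-1 * (al * K ^+ 2 * eta ^+ 2) by repeat (apply: mulr_ge0 => //).
  have k6 : 0 <= N^-1 * (K * y ^+ 2) by repeat (apply: mulr_ge0 => //).
  rewrite /z; lra.
by apply: le_trans h1 _; rewrite ler_pM2l ?lerD2r //; lra.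
Qed.

Lemma exprn_le_expR (x : R) k : x <= 1 -> (1 - x) ^+ k <= expR (- (x * k%:R)).
Proof.
move=> x1; rewrite -mulNr mulrC expRM_natl lerXn2r ?nnegrE ?expR_ge0 ?subr_ge0 //.
exact: expR_ge1Dx.
Qed.

End Recursions.

Section ChainMoments.
Variables (R : realType) (n : nat) (delta : R).
Hypothesis n_gt1 : (1 < n)%N.
Hypothesis delta01 : 0 < delta <= 1.
Implicit Types (s A : config n).

Let n_gt0 : (0 < n)%N. Proof. exact: ltnW. Qed.
Let beta01 : 0 <= 1 - delta <= 1.
Proof. by case/andP: delta01 => d0 d1; apply/andP; split; lra. Qed.
Let n_gt0R : 0 < n%:R :> R.
Proof. by rewrite ltr0n. Qed.
Let n_ge2 : 2 <= n%:R :> R.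
Proof. by rewrite -[2]/(2%:R) ler_nat. Qed.

Local Notation nu := (n%:R^-1 : R).
Local Notation S s := (sg R n (pluses s)).
Local Notation E := (Ex (1 - delta)).
(* The order of the stationary variance of the magnetization. *)
Local Notation kap := ((delta * n%:R)^-1).

Let rho01 : 0 < 2 * delta * nu <= 1.
Proof.
have n2 := n_ge2; have n0 := n_gt0R; have [d0 d1] := andP delta01.
by rewrite divr_gt0 ?mulr_gt0 //= ler_pdivrMr // mul1r; lra.
Qed.

Lemma S_sqr_le1 s : S s ^+ 2 <= 1.
Proof.
have := sg_bound R n_gt0 (pluses_le s); rewrite -ler_norml => h.
by rewrite -real_normK ?num_real // expr_le1.
Qed.

Lemma Ex_sqr_lin k s : E k (fun t => S t ^+ 2) s <= (1 - 2 * delta * nu) ^+ k * S s ^+ 2 + 3 * kap.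
Proof.
have [d0 d1] := andP delta01; have n0 := n_gt0R.
have := @affine_rec_le R (fun k => E k (fun t => S t ^+ 2) s) _ (6 * nu ^+ 2) k rho01.
have -> : 6 * nu ^+ 2 / (2 * delta * nu) = 3 * kap by field; rewrite !gt_eqF.
apply; first by rewrite mulr_ge0 ?sqr_ge0.
move=> t; apply: Ex_step => // s'.
by have := gstep_sqr_le n_gt0 beta01 s'; rewrite subKr.
Qed.

Lemma Emu_sqr_le_kap : Emu (1 - delta) (fun t : config n => S t ^+ 2) <= 3 * kap.
Proof.
have [d0 d1] := andP delta01; have n0 := n_gt0R.
have := @Emu_step R n (1 - delta) n_gt0 (1 - 2 * delta * nu) (6 * nu ^+ 2) (fun t => S t ^+ 2).
have h : forall t : config n, gstep (1 - delta) (fun t0 => S t0 ^+ 2) t <=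
   (1 - 2 * delta * nu) * S t ^+ 2 + 6 * nu ^+ 2.
  by move=> t; have := gstep_sqr_le n_gt0 beta01 t; rewrite subKr.
move=> /(_ h); set m := Emu _ _ => hm.
have : 2 * delta * nu * m <= 6 * nu ^+ 2 by lra.
rewrite -ler_pdivlMl; last by case/andP: rho01.
move=> h2; apply: le_trans h2 _; apply: eq_ler; field; rewrite !gt_eqF //.
Qed.

(** Integrating [gstep_quartic_le] against [mu] leaves [4 * delta * nu * m4 <= 132 * nu ^ 2 * kap +
    32 * nu ^ 4] with [132 = 44 * 3], and [41 = (132 + 32) / 4]. *)
Lemma Emu_quartic_le_kap : Emu (1 - delta) (fun t : config n => S t ^+ 4) <= 41 * kap ^+ 2.
Proof.
have [d0 d1] := andP delta01; have n0 := n_gt0R.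
have := @Emu_gstep R n (1 - delta) n_gt0 (fun t => S t ^+ 4).
have h := Emu_le (1 - delta) (fun t => gstep_quartic_le n_gt0 beta01 t).
move=> e; rewrite e !EmuD !EmuZ Emu_cst subKr in h.
have h2 := Emu_sqr_le_kap.
move: h h2; set m4 := Emu _ _; set m2 := Emu _ _ => h h2.
have nk : nu <= kap by rewrite lef_pV2 ?posrE ?mulr_gt0 // ler_piMl // ltW.
have nv0 : 0 < nu by rewrite invr_gt0.
have k0 : 0 < kap by rewrite invr_gt0 mulr_gt0.
have h3 : nu ^+ 2 * m2 <= nu ^+ 2 * (3 * kap) by rewrite ler_wpM2l ?sqr_ge0.
have h4 : 4 * delta * nu * m4 <= 132 * nu ^+ 2 * kap + 32 * nu ^+ 4 by lra.
have h5 : nu ^+ 4 <= nu ^+ 2 * kap.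
  rewrite (_ : nu ^+ 4 = nu ^+ 2 * (nu * nu)); last by ring.
  rewrite ler_wpM2l ?sqr_ge0 //; apply: le_trans nk; rewrite ler_piMl ?(ltW nv0) //.
  by rewrite invf_le1 // ler1n.
have h6 : 4 * delta * nu * m4 <= 4 * delta * nu * (41 * kap ^+ 2).
  have -> : 4 * delta * nu * (41 * kap ^+ 2) = 164 * (nu ^+ 2 * kap) by field; rewrite !gt_eqF.
  lra.
by rewrite ler_pM2l ?mulr_gt0 // in h6.
Qed.

(** [quadratic_rec] with [al = 8 / 27] and [C = 6] requires [al * Knl >= 2] and
    [6 <= al * Knl ^ 2 / 2]; 54 satisfies both amply. *)
Definition Knl : R := 54.

(** By Jensen's inequality the quartic dissipation decreases the second moment [u] by
    [(8 / 27) * nu * u ^ 2] per step, at a rate free of [delta]; the noise [6 * nu ^ 2] stops the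
    decay at order [1 / sqrt n]. *)
Lemma Ex_sqr_nonlin k s : 8 * Knl <= n%:R :> R ->
  E k (fun t => S t ^+ 2) s <= Knl * (n%:R / (k%:R + n%:R) + (Num.sqrt n%:R)^-1).
Proof.
move=> nK; have n0 := n_gt0R; have n2 := n_ge2.
have sn : 0 < Num.sqrt n%:R :> R by rewrite sqrtr_gt0.
apply: (@quadratic_rec R (fun k => E k (fun t => S t ^+ 2) s) n%:R (8 / 27) _ _ 6) => //.
- lra.
- by rewrite /Knl; lra.
- have q1 : 1 <= Num.sqrt n%:R :> R by rewrite -[leLHS]sqrtr1 ler_sqrt //; lra.
  by rewrite invr_ge0 (ltW sn) /= invf_le1.
- by rewrite /Knl; lra.
- by move: nK; rewrite /Knl; lra.
- rewrite exprVn sqr_sqrtr ?(ltW n0) //; rewrite [leRHS]mulrAC ler_pM2r ?invr_gt0 // /Knl; lra.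
- exact: S_sqr_le1.
- move=> t; rewrite ExS.
  apply: (@le_trans _ _ (E t (fun s' => S s' ^+ 2 - 8 / 27 * nu * S s' ^+ 4 + 6 * nu ^+ 2) s)).
    by apply: Ex_le => // s'; exact: (gstep_sqr_le_quartic n_gt0 beta01 s').
  have key : E t (fun s' => S s' ^+ 2) s ^+ 2 <= E t (fun s' => S s' ^+ 4) s.
    apply: le_trans (Ex_sqr_le _ n_gt0 _ _ _) _.
    by apply: Ex_le => // s'; rewrite -exprM.
  have nu0 : 0 <= 8 / 27 * nu by rewrite mulr_ge0 // invr_ge0 ltW.
  rewrite ExDf ExB (@ExZ R n _ t (8 / 27 * nu) (fun s' => S s' ^+ 4)) Ex_cst // -[_ ^- 2]exprVn.
  by have := ler_wpM2l nu0 key; lra.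
- by move=> t; apply: Ex_ge0 => // s'; exact: sqr_ge0.
Qed.

Section BlockMoments.
Variable A : config n.
Local Notation Z s := (blockZ R n (pluses A) (minuses A) (pluses_in A s) (pluses_out A s)).

Lemma gstep_blockZ s :
  gstep (1 - delta) (fun t => Z t ^+ 2) s <= (1 - 2 * nu) * Z s ^+ 2 + 1.
Proof.
have := @bstep_blockZ R n (1 - delta) n_gt0 beta01 _ _ (pluses_minuses A) _ _
  (pluses_in_le A s) (pluses_out_le A s).
by rewrite -(gstep_lump (1 - delta) n_gt0 A (fun U V => blockZ R n (pluses A) (minuses A) U V ^+ 2)).
Qed.

Lemma Ex_blockZ k s : E k (fun t => Z t ^+ 2) s <= (1 - 2 * nu) ^+ k * Z s ^+ 2 + n%:R / 2.
Proof.
have n0 := n_gt0R; have n2 := n_ge2.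
have r01 : 0 < 2 * nu <= 1 by rewrite divr_gt0 //= ler_pdivrMr // mul1r.
have := @affine_rec_le R (fun k => E k (fun t => Z t ^+ 2) s) _ 1 k r01 ler01.
have -> : 1 / (2 * nu) = n%:R / 2 by field; rewrite gt_eqF.
by apply => t; apply: Ex_step => // s'; exact: gstep_blockZ.
Qed.

Lemma Emu_blockZ : Emu (1 - delta) (fun t => Z t ^+ 2) <= n%:R / 2.
Proof.
have n0 := n_gt0R.
have := Emu_step n_gt0 gstep_blockZ; set m := Emu _ _ => hm.
have : nu * m <= nu * (n%:R / 2) by rewrite mulKf ?gt_eqF //; lra.
by rewrite ler_pM2l ?invr_gt0.
Qed.

Lemma blockZ_self_sqr : Z A ^+ 2 <= n%:R ^+ 2.
Proof.
have n0 := n_gt0R.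
rewrite pluses_in_self pluses_out_self /blockZ mulr0 subr0.
have a0 : 0 <= (pluses A)%:R :> R by [].
have b0 : 0 <= (minuses A)%:R :> R by [].
have e : (pluses A)%:R + (minuses A)%:R = n%:R :> R by rewrite -natrD pluses_minuses.
rewrite lerXn2r ?nnegrE ?divr_ge0 ?mulr_ge0 ?(ltW n0) //.
by rewrite ler_pdivrMr // -e; nra.
Qed.

End BlockMoments.

End ChainMoments.

(** * Upper bound on the mixing time *)

Section TotalVariation.
Variables (R : realType) (n : nat) (beta : R).
Hypothesis n_gt0 : (0 < n)%N.
Implicit Types (s t A : config n).

Local Notation ind t := (fun u : config n => (u == t)%:R : R).

Lemma dist_Ex k s t : glauber_dist beta s k t = Ex beta k (ind t) s.
Proof.
rewrite -glauber_distE // (bigD1 t) //= eqxx mulr1 big1 ?addr0 // => u /negbTE ->.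
by rewrite mulr0.
Qed.

Lemma tvE k s : tv_to_stat beta s k =
  2^-1 * \sum_t `|Ex beta k (ind t) s - cw_mu beta t|.
Proof. by congr (_ * _); apply: eq_bigr => t _; rewrite dist_Ex. Qed.

Lemma dist_ge0 k s t : 0 <= glauber_dist beta s k t.
Proof. by rewrite dist_Ex; apply: Ex_ge0 => // u; case: eqP. Qed.

Lemma dist_sum1 k s : \sum_t glauber_dist beta s k t = 1.
Proof.
rewrite -[RHS](Ex_cst beta n_gt0 k 1 s) -glauber_distE //.
by apply: eq_bigr => t _; rewrite mulr1.
Qed.

Lemma tv_le1 k s : tv_to_stat beta s k <= 1.
Proof.
rewrite /tv_to_stat ler_pdivrMl // mulr1 -[2]/(1 + 1).
rewrite -{1}(dist_sum1 k s) -(mu_sum1 n beta) -big_split /=; apply: ler_sum => t _.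
by apply: le_trans (ler_normB _ _) _; rewrite (ger0_norm (dist_ge0 _ _ _)) gtr0_norm ?mu_gt0.
Qed.

Lemma Ex_sum k (I : Type) (r : seq I) (F : I -> config n -> R) s :
  Ex beta k (fun u => \sum_(i <- r) F i u) s = \sum_(i <- r) Ex beta k (F i) s.
Proof.
elim: r => [|i r IH].
  rewrite big_nil -[RHS](Ex_cst beta n_gt0 k 0 s); apply: eq_Ex => u.
  by rewrite big_nil.
rewrite big_cons -IH -ExDf; apply: eq_Ex => u; by rewrite big_cons.
Qed.

Lemma tv_convex k l s :
  tv_to_stat beta s (k + l) <= Ex beta k (fun u => tv_to_stat beta u l) s.
Proof.
rewrite (@eq_Ex _ _ beta k _ (fun u => 2^-1 * \sum_t `|Ex beta l (ind t) u - cw_mu beta t|)).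
  rewrite ExZ Ex_sum tvE ler_pM2l ?invr_gt0 //; apply: ler_sum => t _.
  rewrite ExD -{1}(Ex_cst beta n_gt0 k (cw_mu beta t) s) -ExB.
  exact: Ex_norm.
by move=> u; rewrite tvE.
Qed.

(* The law of the chain started at [A] is invariant under the permutations that
   preserve [A], so the extremal test function only depends on the two block counts. *)
Lemma tv_block_test A k : exists G : nat -> nat -> R, (forall U V, `|G U V| <= 1) /\
  tv_to_stat beta A k =
    2^-1 * (Ex beta k (fun t => G (pluses_in A t) (pluses_out A t)) A
            - Emu beta (fun t => G (pluses_in A t) (pluses_out A t))).
Proof.
pose G0 U V : R := ((U == pluses A) && (V == 0%N))%:R.
pose H := iter k (bstep n beta (pluses A) (minuses A)) G0.
pose G U V := Num.sg (H U V / cw_mu beta A - 1).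
have muA := mu_gt0 beta A.
have mun : cw_mu beta A != 0 by rewrite gt_eqF.
have ind_block t : ind A t = G0 (pluses_in A t) (pluses_out A t).
  rewrite /G0; congr (nat_of_bool _)%:R; apply/eqP/andP => [->|[/eqP h1 /eqP h2]].
    by rewrite pluses_in_self pluses_out_self !eqxx.
  exact: pluses_in_out_self.
have hH t : Ex beta k (ind A) t = H (pluses_in A t) (pluses_out A t).
  by rewrite (eq_Ex beta k ind_block) Ex_lump.
(* Reversibility expresses the law from [A] through the probability of reaching [A], which depends
   on the block counts only. The sign of the density minus 1 is then the extremal test function. *)
have rev t : glauber_dist beta A k t = cw_mu beta t * (H (pluses_in A t) (pluses_out A t) / cw_mu beta A).
  rewrite dist_Ex; apply: (mulfI mun).
  have := Emu_ExA beta n_gt0 k (ind A) (ind t).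
  rewrite /Emu (bigD1 A) //= eqxx mul1r big1 ?addr0 => [|u /negbTE ->]; last by rewrite mul0r mulr0.
  rewrite [in X in _ = X](bigD1 t) //= eqxx mulr1 big1 ?addr0 => [|u /negbTE ->]; last by rewrite !mulr0.
  by move=> ->; rewrite hH; field; rewrite gt_eqF.
exists G; split.
  by move=> U V; rewrite /G normr_sg; case: (_ != 0).
rewrite -glauber_distE // /Emu -sumrB; congr (_ * _); apply: eq_bigr => t _.
rewrite -mulrBl rev /G; set x := H _ _ / _.
have -> : cw_mu beta t * x - cw_mu beta t = cw_mu beta t * (x - 1) by ring.
by rewrite normrM gtr0_norm ?mu_gt0 // normrEsg; ring.
Qed.

Lemma dmix_le (eps : R) k : 0 <= eps -> (forall s, tv_to_stat beta s k <= eps) -> dmix n beta k <= eps.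
Proof.
move=> e0 h; rewrite /dmix; elim/big_ind: _ => // x y hx hy.
by rewrite ge_max hx hy.
Qed.

Lemma dmix_ge s k : tv_to_stat beta s k <= dmix n beta k.
Proof. by rewrite /dmix (bigD1 s) //= le_max lexx. Qed.

Lemma tmix_le (eps : R) k : dmix n beta k <= eps -> (tmix n beta eps <= k)%N.
Proof.
move=> h; rewrite /tmix; case: pselect => [P|P]; last by [].
by case: ex_minnP => m _; apply.
Qed.

(** The existence hypothesis excludes the default value 0 that [tmix] takes when the level is never
    reached. *)
Lemma tmix_ge (eps : R) k : (exists m, dmix n beta m <= eps) ->
  (forall m, (m < k)%N -> eps < dmix n beta m) -> (k <= tmix n beta eps)%N.
Proof.
move=> ex h; rewrite /tmix; case: pselect => [P|P //].
case: ex_minnP => m hm _; rewrite leqNgt; apply/negP => mk.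
by have := h m mk; rewrite ltNge hm.
Qed.

End TotalVariation.

Section Mean.
Variables (R : realType) (n : nat).
Implicit Types (f g : config n -> R) (L : (config n -> R) -> R).

(** A positive normalized linear functional; the same estimates are applied to the law of the chain
    and to [mu]. *)
Definition is_mean L := [/\ forall f g, (forall s, f s <= g s) -> L f <= L g,
  forall f g, L (fun s => f s + g s) = L f + L g,
  forall (c : R) f, L (fun s => c * f s) = c * L f & forall c : R, L (fun=> c) = c].

Lemma is_mean_Ex beta k s : (0 < n)%N -> is_mean (fun f => Ex beta k f s).
Proof.
move=> n_gt0; split=> [f g fg|f g|c f|c].
- exact: Ex_le.
- exact: ExDf.
- exact: ExZ.
- exact: Ex_cst.
Qed.

Lemma is_mean_Emu beta : is_mean (@Emu R n beta).
Proof.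
split=> [f g fg|f g|c f|c].
- exact: Emu_le.
- exact: EmuD.
- exact: EmuZ.
- exact: Emu_cst.
Qed.

Lemma mean_dist L f g : is_mean L -> `|L f - L g| <= L (fun s => `|f s - g s|).
Proof.
case=> Lle LD LZ Lc.
have LB : L f - L g = L (fun s => f s - g s).
  have -> : (fun s => f s - g s) = (fun s => f s + (-1) * g s).
    by apply/funext => s; rewrite mulN1r.
  by rewrite LD LZ mulN1r.
rewrite LB ler_norml; apply/andP; split; last by apply: Lle => s; exact: ler_norm.
rewrite -mulN1r -LZ; apply: Lle => s; rewrite mulN1r lerNl -normrN; exact: ler_norm.
Qed.

Lemma mean_norm L f (v : R) : is_mean L -> 0 <= v -> L (fun s => f s ^+ 2) <= v ->
  L (fun s => `|f s|) <= Num.sqrt v.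
Proof.
case=> Lle LD LZ Lc v0 hv; set m := L (fun s => `|f s|).
have m0 : 0 <= m by rewrite -(Lc 0); apply: Lle => s.
have : 0 <= L (fun s => `|f s| ^+ 2 + ((- 2 * m) * `|f s| + m ^+ 2)).
  rewrite -(Lc 0); apply: Lle => s; have := sqr_ge0 (`|f s| - m); lra.
rewrite !LD LZ Lc -/m => h.
have e : L (fun s => `|f s| ^+ 2) <= v.
  by apply: le_trans hv; apply: Lle => s; rewrite real_normK ?num_real.
rewrite -(@ler_sqr _ m) ?nnegrE ?sqrtr_ge0 // sqr_sqrtr //; lra.
Qed.

End Mean.

(** * Starts with many spins of each sign *)

Section GoodStart.
Variables (R : realType) (n : nat) (delta : R).
Hypothesis n_gt1 : (1 < n)%N.
Hypothesis delta01 : 0 < delta <= 1.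

Let n_gt0 : (0 < n)%N. Proof. exact: ltnW. Qed.
Let beta01 : 0 <= 1 - delta <= 1.
Proof. by case/andP: delta01 => d0 d1; apply/andP; split; lra. Qed.
Let n_gt0R : 0 < n%:R :> R.
Proof. by rewrite ltr0n. Qed.

Local Notation S s := (sg R n (pluses s)).
Local Notation q s := (Num.sqrt s.+1%:R : R).

(** Running [s] steps from a random level is compared with running them from the fixed level [n./2],
    at typical distance [n / 2 * sqrt v]; the law of the chain and [mu] are compared through this
    common reference. The [+ 1] covers the parity of [n]. *)
Lemma mean_pluses (L : (config n -> R) -> R) (F : nat -> R) (v : R) s : is_mean L ->
  (forall k, (k <= n)%N -> `|F k| <= 1) -> 0 <= v -> L (fun t => S t ^+ 2) <= v ->
  `|L (fun t => iter s (mstep n (1 - delta)) F (pluses t)) - iter s (mstep n (1 - delta)) F n./2|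
   <= bdK (c0 R) * (n%:R / 2 * Num.sqrt v + 1) / q s.
Proof.
move=> mL F1 v0 hv; have [Lle LD LZ Lc] := mL; have n0 := n_gt0R.
set l := n./2; set F' := iter s _ F.
have ln : (l <= n)%N by rewrite /l; lia.
rewrite -(Lc (F' l)); apply: le_trans (mean_dist _ _ mL) _.
have q0 : 0 < q s by rewrite sqrtr_gt0.
have K0 : 0 <= bdK (c0 R) / q s.
  rewrite divr_ge0 ?(ltW q0) // /bdK !mulr_ge0 ?addr_ge0 ?invr_ge0 ?sqr_ge0 //.
  by rewrite divr_ge0 // ltW // c0_gt0.
have pt (t : config n) : `|F' (pluses t) - F' l| <= (bdK (c0 R) / q s) * (n%:R / 2 * `|S t| + 1).
  have := mstep_coupling n_gt0 beta01 s F1 (pluses_le t) ln.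
  rewrite -/F' mulrAC => h; apply: le_trans h _; apply: ler_wpM2l => //.
  have hl : `|n%:R / 2 - l%:R| <= 1 :> R.
    have e : n%:R = (odd n)%:R + 2 * l%:R :> R.
      by rewrite -[in LHS](odd_double_half n) natrD -mul2n natrM.
    rewrite e; case: (odd n); rewrite ler_norml /=; lra.
  have -> : (pluses t)%:R - l%:R = n%:R / 2 * S t + (n%:R / 2 - l%:R) :> R.
    by rewrite /sg; field; rewrite gt_eqF.
  apply: le_trans (ler_normD _ _) _; apply: lerD => //.
  by rewrite normrM ger0_norm // divr_ge0 // ltW.
apply: le_trans (Lle _ _ pt) _; rewrite LZ LD LZ Lc [leRHS]mulrAC.
apply: ler_wpM2l => //; rewrite lerD2r; apply: ler_wpM2l; first by rewrite divr_ge0 // ltW.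
exact: mean_norm.
Qed.

Variable A : config n.
Local Notation a := (pluses A).
Local Notation b := (minuses A).
Hypothesis a_ge : (n <= 4 * a)%N.
Hypothesis b_ge : (n <= 4 * b)%N.

Local Notation Z s := (blockZ R n a b (pluses_in A s) (pluses_out A s)).
Local Notation om := (2 * (68 * n%:R^-1) ^+ 2 : R).

Let abn : (a + b)%N = n. Proof. exact: pluses_minuses. Qed.

(* Block counts with total [k] at which [blockZ] is within 1 of zero. *)
Definition rep_in k : nat := (a * k) %/ n.
Definition rep_out k : nat := k - rep_in k.

Lemma rep_in_le k : (k <= n)%N -> (rep_in k <= a)%N.
Proof. by move=> kn; rewrite /rep_in -[leqRHS](mulnK a n_gt0) leq_div2r // leq_mul2l kn orbT. Qed.

Lemma rep_in_le_k k : (rep_in k <= k)%N.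
Proof.
have an := pluses_le A.
by rewrite /rep_in -[leqRHS](mulKn k n_gt0) leq_div2r // leq_mul2r an orbT.
Qed.

Lemma rep_sum k : (rep_in k + rep_out k)%N = k.
Proof. by rewrite /rep_out subnKC // rep_in_le_k. Qed.

Lemma rep_out_le k : (k <= n)%N -> (rep_out k <= b)%N.
Proof.
move=> kn; rewrite /rep_out leq_subLR addnC -leq_subLR /rep_in leq_divRL //.
have [kb|bk] := leqP k b; first by move: kb; rewrite -subn_eq0 => /eqP ->; rewrite mul0n.
have := abn; move: (pluses A) (minuses A) bk => x y bk e; rewrite -e in kn *; nia.
Qed.

Lemma rep_dist t :
  `|(pluses_in A t)%:R - (rep_in (pluses t))%:R : R| <= `|Z t| + 1 /\
  `|blockZ R n a b (rep_in (pluses t)) (rep_out (pluses t))| <= 1.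
Proof.
have n0 := n_gt0R; have nn : n%:R != 0 :> R by rewrite gt_eqF.
set k := pluses t; set U := pluses_in A t; set V := pluses_out A t.
have kE : (U + V)%N = k by exact: pluses_split.
have nE : n%:R = a%:R + b%:R :> R by rewrite -natrD abn.
have rep : (rep_in k)%:R = a%:R * k%:R / n%:R - ((a * k) %% n)%:R / n%:R :> R.
  have e : a%:R * k%:R = (rep_in k)%:R * n%:R + ((a * k) %% n)%:R :> R.
    by rewrite -!natrM -natrD -divn_eq.
  by rewrite e; field.
set r : R := ((a * k) %% n)%:R / n%:R in rep.
have r01 : 0 <= r <= 1.
  by rewrite /r divr_ge0 //= ler_pdivrMr // mul1r ler_nat ltnW // ltn_mod.
have [r0 r1] := andP r01.
have zE : U%:R = a%:R * k%:R / n%:R + Z t :> R.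
  by rewrite /blockZ -/U -/V -kE natrD nE; field; rewrite -nE.
split.
  have -> : U%:R - (rep_in k)%:R = Z t + r :> R by rewrite zE rep; ring.
  by apply: le_trans (ler_normD _ _) _; rewrite lerD2l ger0_norm.
have -> : blockZ R n a b (rep_in k) (rep_out k) = - r.
  have e : (rep_out k)%:R = k%:R - (rep_in k)%:R :> R.
    by apply/eqP; rewrite eq_sym subr_eq -natrD addnC rep_sum.
  by rewrite /blockZ e rep nE; field; rewrite -nE.
by rewrite normrN ger0_norm.
Qed.

(** The counts are replaced by the representative pair with the same total, at typical distance
    [sqrt w]; what remains is a function of the magnetization alone. *)
Lemma mean_block (L : (config n -> R) -> R) (G : nat -> nat -> R) (v w : R) s
  (g := iter s (bstep n (1 - delta) a b) G) : is_mean L ->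
  (forall U V, `|G U V| <= 1) -> 0 <= v -> 0 <= w ->
  L (fun t => S t ^+ 2) <= v -> L (fun t => Z t ^+ 2) <= w ->
  `|L (fun t => g (pluses_in A t) (pluses_out A t)) -
    L (fun t => g (rep_in (pluses t)) (rep_out (pluses t)))| <=
  bK R * (Num.sqrt w + 1) / q s + (2 * ((64 * n%:R^-1) ^+ 2 * (w + 1) + 32 * v) + 2 * (s%:R * om)).
Proof.
move=> mL G1 v0 w0 hv hw; have [Lle LD LZ Lc] := mL; have n0 := n_gt0R.
apply: le_trans (mean_dist _ _ mL) _.
have q0 : 0 < q s by rewrite sqrtr_gt0.
have cg := cB_gt0 R.
have K0 : 0 <= bK R / q s.
  by rewrite divr_ge0 ?(ltW q0) // /bK mulr_ge0 // addr_ge0 // divr_ge0 // ltW.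
set nn := (64 * n%:R^-1) ^+ 2.
have nn0 : 0 <= nn by exact: sqr_ge0.
pose psi t : R := (bK R / q s) * (`|Z t| + 1) + ((2 * nn) * (Z t ^+ 2 + 1) + (64 * S t ^+ 2 + 2 * (s%:R * om))).
have pt t : `|g (pluses_in A t) (pluses_out A t) - g (rep_in (pluses t)) (rep_out (pluses t))| <= psi t.
  have kn := pluses_le t.
  have sumE : (pluses_in A t + pluses_out A t = rep_in (pluses t) + rep_out (pluses t))%N.
    by rewrite rep_sum pluses_split.
  have := @block_coupling R n (1 - delta) n_gt0 beta01 a b abn a_ge b_ge s G _ _ _ _
    (fun U V _ _ => G1 U V) (pluses_in_le A t) (pluses_out_le A t) (rep_in_le kn) (rep_out_le kn) sumE.
  rewrite -/g => h; apply: le_trans h _.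
  have [h1 h2] := rep_dist t.
  have hK : bK R * `|(pluses_in A t)%:R - (rep_in (pluses t))%:R : R| / q s <= bK R / q s * (`|Z t| + 1).
    by rewrite mulrAC; apply: ler_wpM2l.
  have e1 : blockY R n a b (pluses_in A t) (pluses_out A t) = nn * Z t ^+ 2 + 16 * S t ^+ 2.
    by rewrite /blockY /nn pluses_split; ring.
  have e2 : blockY R n a b (rep_in (pluses t)) (rep_out (pluses t)) <= nn + 16 * S t ^+ 2.
    rewrite /blockY rep_sum; set z := blockZ _ _ _ _ _ _ in h2 *.
    have -> : (64 * (z / n%:R)) ^+ 2 = nn * z ^+ 2 by rewrite /nn; ring.
    have z1 : z ^+ 2 <= 1 by rewrite -real_normK ?num_real // expr_le1.
    have : nn * z ^+ 2 <= nn by rewrite ler_piMr.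
    by lra.
  rewrite /psi e1; move: (blockY _ _ _ _ _ _) e2 hK => y e2 hK; lra.
apply: le_trans (Lle _ _ pt) _; rewrite /psi !(LD, LZ, Lc).
have hz := mean_norm mL w0 hw.
have k1 : bK R / q s * (L (fun t => `|Z t|) + 1) <= bK R / q s * (Num.sqrt w + 1).
  by apply: ler_wpM2l => //; rewrite lerD2r.
have k2 : nn * L (fun t => Z t ^+ 2) <= nn * w by apply: ler_wpM2l.
move: (L _) (L _) k1 k2 hv => x y k1 k2 hv.
rewrite [bK R * _ / _]mulrAC; lra.
Qed.

(** Read backwards in time: the last [s] steps remove the dependence on the block counts given their
    sum, the [s] steps before that the dependence on the sum. Stationarity inserts the same steps
    under [mu]. Each comparison is made once per law, and the factor 1/2 of total variation absorbs
    the doubling. *)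
Lemma good_start_tv (T0 s : nat) (v w : R) : 0 <= v -> 0 <= w ->
  Ex (1 - delta) T0 (fun t => S t ^+ 2) A <= v ->
  Ex (1 - delta) (T0 + s) (fun t => S t ^+ 2) A <= v ->
  Emu (1 - delta) (fun t : config n => S t ^+ 2) <= v ->
  Ex (1 - delta) (T0 + s) (fun t => Z t ^+ 2) A <= w ->
  Emu (1 - delta) (fun t => Z t ^+ 2) <= w ->
  tv_to_stat (1 - delta) A (T0 + s + s) <=
  bK R * (Num.sqrt w + 1) / q s + (2 * ((64 * n%:R^-1) ^+ 2 * (w + 1) + 32 * v) + 2 * (s%:R * om))
  + bdK (c0 R) * (n%:R / 2 * Num.sqrt v + 1) / q s.
Proof.
move=> v0 w0 v1 v2 v3 w1 w2.
have [G [G1 ->]] := tv_block_test (1 - delta) n_gt0 A (T0 + s + s).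
pose g := iter s (bstep n (1 - delta) a b) G.
pose gbar k := g (rep_in k) (rep_out k).
pose ghat := iter s (mstep n (1 - delta)) gbar.
have lump t : Ex (1 - delta) s (fun u => G (pluses_in A u) (pluses_out A u)) t =
    g (pluses_in A t) (pluses_out A t) by exact: Ex_lump.
have lump2 (t : config n) : Ex (1 - delta) s (fun u => gbar (pluses u)) t = ghat (pluses t)
  by exact: (@Ex_pluses R n (1 - delta) n_gt0 gbar s t).
rewrite ExD (eq_Ex _ _ lump) -(Emu_Ex _ n_gt0 s) (eq_Emu _ lump).
have gbar1 k : (k <= n)%N -> `|gbar k| <= 1.
  move=> kn; apply: (iter_bstep_norm n_gt0 beta01 abn) => [U V _ _||]; first exact: G1.
  - exact: rep_in_le.
  - exact: rep_out_le.
have m1 := is_mean_Ex (1 - delta) (T0 + s) A n_gt0.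
have m2 := is_mean_Emu n (1 - delta).
have m3 := is_mean_Ex (1 - delta) T0 A n_gt0.
have b1 := mean_block s m1 G1 v0 w0 v2 w1; have b2 := mean_block s m2 G1 v0 w0 v3 w2.
rewrite -/g in b1 b2.
have e1 : Ex (1 - delta) (T0 + s) (fun t => g (rep_in (pluses t)) (rep_out (pluses t))) A =
    Ex (1 - delta) T0 (fun t => ghat (pluses t)) A.
  by rewrite ExD; apply: eq_Ex => t; exact: lump2.
have e2 : Emu (1 - delta) (fun t : config n => g (rep_in (pluses t)) (rep_out (pluses t))) =
    Emu (1 - delta) (fun t : config n => ghat (pluses t)).
  by rewrite -(Emu_Ex _ n_gt0 s); apply: eq_Emu => t; exact: lump2.
have c1 := mean_pluses s m3 gbar1 v0 v1; have c2 := mean_pluses s m2 gbar1 v0 v3.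
rewrite -/ghat -e1 in c1; rewrite -/ghat -e2 in c2.
move: b1 b2 c1 c2; rewrite !ler_norml.
move=> /andP[b1 b1'] /andP[b2 b2'] /andP[c1 c1'] /andP[c2 c2'].
by rewrite ler_pdivrMl //; lra.
Qed.

End GoodStart.

Lemma nat_ceil (R : realType) (y : R) : 0 <= y -> exists m : nat, y <= m%:R <= y + 1.
Proof.
move=> y0; have /andP[h1 h2] := truncn_itv y0; exists (Num.truncn y).+1.
by rewrite (ltW h2) /= -natr1 lerD2r.
Qed.

(** * Burn-in times and explicit constants *)

Section Upper.
Variables (R : realType) (n : nat) (delta : R).
Hypothesis n_gt1 : (1 < n)%N.
Hypothesis delta01 : 0 < delta <= 1.
Implicit Types A : config n.

Let n_gt0 : (0 < n)%N. Proof. exact: ltnW. Qed.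
Let n_gt0R : 0 < n%:R :> R.
Proof. by rewrite ltr0n. Qed.

Local Notation S s := (sg R n (pluses s)).
Local Notation x := (delta ^+ 2 * n%:R).
Local Notation kap := ((delta * n%:R)^-1).
Local Notation tn := (2^-1 * (n%:R / delta) * ln x).
Local Notation wn := (n%:R / delta).

Definition Kburn : R := 2 * Knl R + 3.

Lemma decay_factor (t : nat) (r : R) : r <= 1 -> ln x <= r * t%:R -> 0 < x -> (1 - r) ^+ t <= x^-1.
Proof.
move=> r1 h x0; apply: le_trans (exprn_le_expR t r1) _.
by rewrite -[leRHS](@lnK R) ?posrE ?invr_gt0 // lnV ?posrE // ler_expR lerN2.
Qed.

(** After [wn] steps both [n / (t1 + n)] and [1 / sqrt n] are at most [delta], the latter because
    [x >= 1]; then [tn] steps contract by at least the factor [1 / x], and [delta / x] is [kap]. The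
    3 in [Kburn] is the noise term of [Ex_sqr_lin]. *)
Lemma Ex_sqr_kap A t1 t2 : 8 * Knl R <= n%:R -> 1 <= x ->
  wn <= t1%:R -> tn <= t2%:R ->
  Ex (1 - delta) (t1 + t2) (fun t => S t ^+ 2) A <= Kburn * kap.
Proof.
move=> nK x1 h1 h2; have n0 := n_gt0R; have [d0 d1] := andP delta01.
have n2 : 2 <= n%:R :> R by rewrite -[2]/(2%:R) ler_nat.
have x0 : 0 < x by rewrite (lt_le_trans _ x1).
set rho := 1 - 2 * delta * n%:R^-1.
have r1 : 2 * delta * n%:R^-1 <= 1 by rewrite ler_pdivrMr // mul1r; lra.
have rho0 : 0 <= rho by rewrite subr_ge0.
rewrite ExD; apply: (@le_trans _ _ (Ex (1 - delta) t1 (fun t => rho ^+ t2 * S t ^+ 2 + 3 * kap) A)).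
  by apply: Ex_le => // t; exact: Ex_sqr_lin.
rewrite ExDf ExZ Ex_cst //.
have dec : rho ^+ t2 <= x^-1.
  apply: decay_factor => //.
  have e : ln x = 2 * delta * n%:R^-1 * tn by field; rewrite !gt_eqF.
  by rewrite {1}e ler_pM2l // !mulr_gt0 ?invr_gt0.
have nl := Ex_sqr_nonlin n_gt1 delta01 t1 A nK.
have t10 : 0 < t1%:R :> R by apply: lt_le_trans h1; rewrite divr_gt0.
have f1 : n%:R / (t1%:R + n%:R) <= delta.
  rewrite ler_pdivrMr ?addr_gt0 //; move: h1; rewrite ler_pdivrMr // => h1.
  have : 0 <= delta * n%:R by rewrite mulr_ge0 ?ltW.
  by lra.
have f2 : (Num.sqrt n%:R)^-1 <= delta.
  rewrite -[leRHS]invrK lef_pV2 ?posrE ?sqrtr_gt0 ?invr_gt0 //.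
  rewrite -(@ler_sqr _ (delta^-1)) ?nnegrE ?sqrtr_ge0 ?invr_ge0 ?(ltW d0) // sqr_sqrtr ?(ltW n0) //.
  by rewrite exprVn -[leLHS]mul1r ler_pdivrMr ?exprn_gt0 // mulrC.
have K0 : 0 < Knl R by rewrite /Knl.
set m := Ex _ t1 _ A in nl *.
have m1 : m <= 2 * Knl R * delta.
  apply: le_trans nl _; have : Knl R * (n%:R / (t1%:R + n%:R) + (Num.sqrt n%:R)^-1) <= Knl R * (delta + delta).
    by rewrite ler_pM2l // lerD.
  lra.
have m0 : 0 <= m by apply: Ex_ge0 => // t; exact: sqr_ge0.
have : rho ^+ t2 * m <= x^-1 * (2 * Knl R * delta) by apply: ler_pM; rewrite ?exprn_ge0.
have -> : x^-1 * (2 * Knl R * delta) = 2 * Knl R * kap by field; rewrite !gt_eqF.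
rewrite /Kburn; lra.
Qed.

Lemma Ex_blockZ_2n A t : ln (n%:R : R) <= 2 / n%:R * t%:R ->
  Ex (1 - delta) t (fun u => blockZ R n (pluses A) (minuses A) (pluses_in A u) (pluses_out A u) ^+ 2) A
   <= 2 * n%:R :> R.
Proof.
move=> h; have n0 := n_gt0R.
have n2 : 2 <= n%:R :> R by rewrite -[2]/(2%:R) ler_nat.
apply: le_trans (Ex_blockZ n_gt1 delta01 A t A) _.
have r1 : 2 / n%:R <= 1 :> R by rewrite ler_pdivrMr // mul1r.
have dec : (1 - 2 / n%:R) ^+ t <= n%:R^-1 :> R.
  apply: le_trans (exprn_le_expR t r1) _.
  by rewrite -[leRHS](@lnK R) ?posrE ?invr_gt0 // lnV ?posrE // ler_expR lerN2.
have z := blockZ_self_sqr R n_gt1 A.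
have : (1 - 2 / n%:R) ^+ t * blockZ R n (pluses A) (minuses A) (pluses_in A A) (pluses_out A A) ^+ 2
    <= n%:R^-1 * n%:R ^+ 2.
  by apply: ler_pM => //; rewrite ?sqr_ge0 // exprn_ge0 // subr_ge0.
have -> : n%:R^-1 * n%:R ^+ 2 = n%:R :> R by field; rewrite gt_eqF.
lra.
Qed.

(** The block counts need about [(n / 2) * ln n] steps to relax, and these fit into [wn + tn]:
    [ln n = ln x + 2 * ln (1 / delta)], and [ln (1 / delta) <= 1 / delta]. *)
Lemma ln_n_bound : 1 <= x -> ln (n%:R : R) <= 2 / n%:R * (wn + tn).
Proof.
move=> x1; have n0 := n_gt0R; have [d0 d1] := andP delta01.
have e : n%:R = x * delta^-1 ^+ 2 by field; rewrite gt_eqF.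
have x0 : 0 < x by rewrite (lt_le_trans _ x1).
have di : 1 <= delta^-1 by rewrite invf_ge1.
have di0 : 0 < delta^-1 by rewrite invr_gt0.
have -> : ln (n%:R : R) = ln x + ln delta^-1 *+ 2.
  by rewrite {1}e lnM ?posrE ?exprn_gt0 // lnXn.
have -> : 2 / n%:R * (wn + tn) = delta^-1 * ln x + 2 * delta^-1 by field; rewrite !gt_eqF.
have l0 := ln_ge0 x1; have l1 := ln_sublinear di0.
have : ln x <= delta^-1 * ln x by rewrite ler_peMl.
rewrite -mulr_natl; lra.
Qed.

(** The 3 comes from [sqrt (2 n) + 1 <= 3 * sqrt wn]; the 7 is [12 / 2 + 1], with 12 an upper bound
    for [sqrt Kburn]. *)
Definition Cg : R := 3 * bK R + 7 * bdK (c0 R).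

Lemma good_tv A (gam : R) t1 t2 s : 8 * Knl R <= n%:R -> 1 <= x -> 1 <= gam ->
  wn <= t1%:R -> tn <= t2%:R -> gam * wn <= s%:R <= gam * wn + 1 ->
  (n <= 4 * pluses A)%N -> (n <= 4 * minuses A)%N ->
  tv_to_stat (1 - delta) A (t1 + t2 + s + s) <= Cg / Num.sqrt gam + 270 ^+ 2 * gam * kap.
Proof.
move=> nK x1 g1 h1 h2 /andP[s1 s2] a4 b4; have n0 := n_gt0R; have [d0 d1] := andP delta01.
have n2 : 2 <= n%:R :> R by rewrite -[2]/(2%:R) ler_nat.
have k0 : 0 < kap by rewrite invr_gt0 mulr_gt0.
have w1 : 1 <= wn by rewrite ler_pdivlMr // mul1r; lra.
have w0 : 0 < wn by lra.
have K0 : 0 <= Kburn by rewrite /Kburn /Knl; lra.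
have Kkap3 : 3 * kap <= Kburn * kap by rewrite ler_pM2r // /Kburn /Knl; lra.
have v0 : 0 <= Kburn * kap by rewrite mulr_ge0 // ltW.
have ww0 : 0 <= 2 * n%:R :> R by rewrite mulr_ge0 // ltW.
have st : tn <= (t2 + s)%:R by rewrite natrD; apply: le_trans h2 _; rewrite lerDl.
have v2 : Ex (1 - delta) (t1 + t2 + s) (fun t => S t ^+ 2) A <= Kburn * kap.
  by rewrite -addnA; exact: Ex_sqr_kap.
have z1 : Ex (1 - delta) (t1 + t2 + s) (fun u => blockZ R n (pluses A) (minuses A)
     (pluses_in A u) (pluses_out A u) ^+ 2) A <= 2 * n%:R.
  apply: Ex_blockZ_2n; apply: le_trans (ln_n_bound x1) _; rewrite ler_pM2l ?divr_gt0 //.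
  by rewrite !natrD; have : 0 <= s%:R :> R by []; lra.
have z2 : Emu (1 - delta) (fun u => blockZ R n (pluses A) (minuses A)
     (pluses_in A u) (pluses_out A u) ^+ 2) <= 2 * n%:R.
  by apply: le_trans (Emu_blockZ n_gt1 delta01 A) _; lra.
apply: le_trans (good_start_tv n_gt1 delta01 a4 b4 v0 ww0 (Ex_sqr_kap A nK x1 h1 h2) v2
  (le_trans (Emu_sqr_le_kap n_gt1 delta01) Kkap3) z1 z2) _.
clear z1 z2 v2 v0 ww0 Kkap3 st nK h1 h2.
set q := Num.sqrt s.+1%:R.
have sg0 : 0 < Num.sqrt gam by rewrite sqrtr_gt0; lra.
have sw0 : 0 < Num.sqrt wn by rewrite sqrtr_gt0.
have q1 : Num.sqrt gam * Num.sqrt wn <= q.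
  rewrite -sqrtrM; last by lra.
  rewrite ler_sqrt // -natr1; lra.
have gw0 : 0 < Num.sqrt gam * Num.sqrt wn by rewrite mulr_gt0.
have q0 : 0 < q by apply: lt_le_trans q1.
have bK0 : 0 <= bK R.
  by have := cB_gt0 R => cg; rewrite /bK mulr_ge0 // addr_ge0 // divr_ge0 // ltW.
have bdK0 : 0 <= bdK (c0 R).
  have cg := c0_gt0 R; rewrite /bdK mulr_ge0 ?mulr_ge0 // addr_ge0 ?invr_ge0 ?sqr_ge0 //.
  by rewrite divr_ge0 // ltW.
have big X Y : 0 <= X -> X <= Y * Num.sqrt wn -> X / q <= Y / Num.sqrt gam.
  move=> X0 XY; have Y0 : 0 <= Y by rewrite -(pmulr_lge0 _ sw0) (le_trans X0).
  rewrite ler_pdivrMr //; apply: le_trans XY _.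
  rewrite mulrAC ler_pdivlMr // -mulrA; apply: ler_wpM2l => //.
  by rewrite mulrC.
have sn : Num.sqrt n%:R <= Num.sqrt wn.
  have nw : n%:R <= wn by rewrite ler_pdivlMr // ler_piMr // ltW.
  exact: ler_wsqrtr.
have sn1 : 1 <= Num.sqrt n%:R :> R by rewrite -[leLHS]sqrtr1 ler_wsqrtr // ler1n ltnW.
have T1 : bK R * (Num.sqrt (2 * n%:R) + 1) / q <= 3 * bK R / Num.sqrt gam.
  apply: big; first by rewrite mulr_ge0 // addr_ge0 // sqrtr_ge0.
  have -> : 3 * bK R * Num.sqrt wn = bK R * (3 * Num.sqrt wn) by ring.
  apply: ler_wpM2l => //.
  have : Num.sqrt (2 * n%:R) <= 2 * Num.sqrt n%:R :> R.
    rewrite -[leRHS]ger0_norm ?mulr_ge0 ?sqrtr_ge0 // -sqrtr_sqr ler_sqrt ?sqr_ge0 //.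
    by rewrite exprMn sqr_sqrtr ?(ltW n0) // ler_pM2r // expr2 ler_peMl // ler1n.
  lra.
have sk : n%:R * Num.sqrt kap = Num.sqrt wn.
  rewrite -{1}[n%:R]ger0_norm ?(ltW n0) // -sqrtr_sqr -sqrtrM ?sqr_ge0 //.
  by congr Num.sqrt; field; rewrite !gt_eqF.
have T4 : bdK (c0 R) * (n%:R / 2 * Num.sqrt (Kburn * kap) + 1) / q <= 7 * bdK (c0 R) / Num.sqrt gam.
  apply: big.
    by rewrite mulr_ge0 // addr_ge0 // mulr_ge0 ?sqrtr_ge0 // divr_ge0 // ltW.
  have -> : 7 * bdK (c0 R) * Num.sqrt wn = bdK (c0 R) * (7 * Num.sqrt wn) by ring.
  apply: ler_wpM2l => //.
  have s12 : Num.sqrt Kburn <= 12.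
    rewrite -[leRHS]ger0_norm // -sqrtr_sqr ler_sqrt ?sqr_ge0 // /Kburn /Knl; lra.
  rewrite sqrtrM // mulrCA; have -> : n%:R / 2 * Num.sqrt kap = Num.sqrt wn / 2.
    by rewrite -sk; ring.
  have : Num.sqrt Kburn * (Num.sqrt wn / 2) <= 12 * (Num.sqrt wn / 2).
    by apply: ler_wpM2r => //; rewrite divr_ge0 // ltW.
  lra.
clear big sk sn q1 gw0 q0 sw0 sg0 K0 bK0 bdK0.
have nuk : n%:R^-1 <= kap by rewrite lef_pV2 ?posrE ?mulr_gt0 // ler_piMl // ltW.
have nu0 : 0 < n%:R^-1 :> R by rewrite invr_gt0.
have T2 : 2 * ((64 * n%:R^-1) ^+ 2 * (2 * n%:R + 1) + 32 * (Kburn * kap)) <= 2 * ((64 ^+ 2 * 3 + 32 * 111) * kap).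
  have -> : (64 * n%:R^-1) ^+ 2 * (2 * n%:R + 1) = 64 ^+ 2 * (2 * n%:R^-1 + n%:R^-1 * n%:R^-1) :> R.
    by field; rewrite gt_eqF.
  have : n%:R^-1 * n%:R^-1 <= n%:R^-1 :> R by rewrite ler_piMl ?(ltW nu0) // invf_le1 //; lra.
  have -> : Kburn = 111 by rewrite /Kburn /Knl; ring.
  lra.
have T3 : 2 * (s%:R * (2 * (68 * n%:R^-1) ^+ 2)) <= 8 * 68 ^+ 2 * (gam * kap).
  have s3 : s%:R <= 2 * (gam * wn) :> R.
    have : 1 <= gam * wn by rewrite (le_trans w1) // ler_peMl // ltW.
    lra.
  have -> : 2 * (s%:R * (2 * (68 * n%:R^-1) ^+ 2)) = 4 * 68 ^+ 2 * (n%:R^-1 ^+ 2 * s%:R) :> R by ring.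
  have -> : 8 * 68 ^+ 2 * (gam * kap) = 4 * 68 ^+ 2 * (n%:R^-1 ^+ 2 * (2 * (gam * wn))).
    by field; rewrite !gt_eqF.
  rewrite ler_pM2l; last by rewrite mulr_gt0 // exprn_gt0.
  by apply: ler_wpM2l => //; exact: sqr_ge0.
have gk : kap <= gam * kap by rewrite ler_peMl // ltW.
have gk0 : 0 <= gam * kap := le_trans (ltW k0) gk.
(* The errors in [kap] add up to [2 * (3 * 64 ^ 2 + 32 * 111) + 8 * 68 ^ 2 = 68672], below
   [270 ^ 2]. *)
apply: le_trans (lerD (lerD T1 (lerD T2 T3)) T4) _; rewrite /Cg.
clear T1 T2 T3 T4 sn1 nuk nu0.
move: (Num.sqrt gam)^-1 => g'; lra.
Qed.

End Upper.

(** * Upper bound from arbitrary starts *)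

Section UpperBound.
Variables (R : realType) (n : nat) (delta : R).
Hypothesis n_gt1 : (1 < n)%N.
Hypothesis delta01 : 0 < delta <= 1.
Implicit Types A s : config n.

Let n_gt0 : (0 < n)%N. Proof. exact: ltnW. Qed.
Let n_gt0R : 0 < n%:R :> R.
Proof. by rewrite ltr0n. Qed.

Local Notation S s := (sg R n (pluses s)).
Local Notation x := (delta ^+ 2 * n%:R).
Local Notation kap := ((delta * n%:R)^-1).
Local Notation tn := (2^-1 * (n%:R / delta) * ln x).
Local Notation wn := (n%:R / delta).

Lemma quarter_of_sg A : 4 * S A ^+ 2 <= 1 ->
  (n <= 4 * pluses A)%N /\ (n <= 4 * minuses A)%N.
Proof.
move=> h; have n0 := n_gt0R.
have h1 : `|2 * S A| <= 1.
  by rewrite -(@ler_sqr _ _ 1) ?nnegrE // real_normK ?num_real // expr1n; lra.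
have e : n%:R = (pluses A)%:R + (minuses A)%:R :> R by rewrite -natrD pluses_minuses.
move: h1; rewrite ler_norml => /andP[].
rewrite /sg mulrA ler_pdivlMr // ler_pdivrMr // => h2 h3.
by split; rewrite -(ler_nat R) natrM; lra.
Qed.

Lemma tmix_upper (gam eps : R) : 8 * Knl R <= n%:R -> 1 <= x -> 1 <= gam ->
  Cg R / Num.sqrt gam + 270 ^+ 2 * gam * kap + 4 * (Knl R * (gam^-1 + (Num.sqrt n%:R)^-1)) <= eps ->
  (exists m, dmix n (1 - delta) m <= eps) /\
  (tmix n (1 - delta) eps)%:R <= tn + (3 * gam + 6) * wn.
Proof.
move=> nK x1 g1 heps; have n0 := n_gt0R; have [d0 d1] := andP delta01.
have n2 : 2 <= n%:R :> R by rewrite -[2]/(2%:R) ler_nat.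
have w1 : 1 <= wn by rewrite ler_pdivlMr // mul1r; lra.
have w0 : 0 <= wn by lra.
have gw0 : 0 <= gam * wn by rewrite mulr_ge0 //; lra.
have tn0 : 0 <= tn by rewrite !mulr_ge0 ?ln_ge0 ?invr_ge0 // ltW.
have [s hs] := nat_ceil gw0; have [t1 /andP[t1a t1b]] := nat_ceil w0.
have [t2 /andP[t2a t2b]] := nat_ceil tn0; have [s1 s2] := andP hs.
set T := (t1 + t2 + s + s)%N.
set eta := Cg R / Num.sqrt gam + 270 ^+ 2 * gam * kap in heps.
have good A : (n <= 4 * pluses A)%N -> (n <= 4 * minuses A)%N ->
    tv_to_stat (1 - delta) A T <= eta.
  by move=> a4 b4; apply: good_tv.
have k0 : 0 < kap by rewrite invr_gt0 mulr_gt0.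
have eta0 : 0 <= eta.
  have cb := cB_gt0 R; have cc := c0_gt0 R; rewrite /eta.
  have b0 : 0 <= bK R by rewrite /bK mulr_ge0 // addr_ge0 // divr_ge0 // ltW.
  have bd0 : 0 <= bdK (c0 R).
    rewrite /bdK mulr_ge0 ?mulr_ge0 // addr_ge0 ?invr_ge0 ?sqr_ge0 //.
    by rewrite divr_ge0 // ltW.
  have cg0 : 0 <= Cg R by rewrite /Cg addr_ge0 // mulr_ge0.
  have g0 : 0 <= gam by lra.
  apply: addr_ge0; first by rewrite divr_ge0 ?sqrtr_ge0.
  by apply: mulr_ge0 (ltW k0); apply: mulr_ge0 g0; exact: sqr_ge0.
(* Starts with too few spins of one sign have [4 * S ^ 2 > 1], so [4 * S ^ 2] itself bounds their
   total variation distance; a burn-in of [s] steps makes its mean small. *)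
have tvle A : tv_to_stat (1 - delta) A T <= eta + 4 * S A ^+ 2.
  have [h|h] := leP (4 * S A ^+ 2) 1.
    have [h1 h2] := quarter_of_sg h; apply: le_trans (good _ h1 h2) _.
    by rewrite lerDl mulr_ge0 // sqr_ge0.
  by have := tv_le1 (1 - delta) n_gt0 T A; lra.
have all_tv A : tv_to_stat (1 - delta) A (s + T) <= eps.
  apply: le_trans (tv_convex _ n_gt0 _ _ _) _.
  apply: le_trans (@Ex_le R n _ n_gt0 s _ _ tvle A) _.
  rewrite ExDf Ex_cst // ExZ.
  have nl := Ex_sqr_nonlin n_gt1 delta01 s A nK.
  have f1 : n%:R / (s%:R + n%:R) <= gam^-1.
    have g0 : 0 < gam by lra.
    have gn : gam * n%:R <= s%:R.
      apply: le_trans s1; apply: ler_wpM2l; first by lra.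
      by rewrite ler_pdivlMr // ler_piMr // ltW.
    rewrite ler_pdivrMr; last by have : 0 <= s%:R :> R by []; lra.
    by rewrite mulrC ler_pdivlMr // mulrC; lra.
  apply: le_trans _ heps; rewrite lerD2l ler_pM2l //; apply: le_trans nl _.
  by rewrite ler_pM2l ?lerD2r // /Knl.
have e0 : 0 <= eps by apply: le_trans (all_tv (level_config n 0)); rewrite /tv_to_stat mulr_ge0 // sumr_ge0.
have dm : dmix n (1 - delta) (s + T) <= eps by apply: dmix_le.
split; first by exists (s + T)%N.
apply: (@le_trans _ _ (s + T)%:R); first by rewrite ler_nat; apply: tmix_le.
(* Rounding up costs 1 for each of [t1], [t2] and the three copies of [s]; with the [wn] in [t1]
   this makes [6 * wn], as [wn >= 1]. *)
rewrite /T !natrD; lra.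
Qed.

End UpperBound.

(** * Lower bound on the mixing time *)

Section Lower.
Variables (R : realType) (n : nat) (delta : R).
Hypothesis n_ge4 : (4 <= n)%N.
Hypothesis delta01 : 0 < delta <= 1.
Implicit Types s : config n.

Let n_gt1 : (1 < n)%N. Proof. by apply: leq_trans n_ge4. Qed.
Let n_gt0 : (0 < n)%N. Proof. exact: ltnW. Qed.
Let n_gt0R : 0 < n%:R :> R.
Proof. by rewrite ltr0n. Qed.
Let n_ge4R : 4 <= n%:R :> R.
Proof. by rewrite -[4]/(4%:R) ler_nat. Qed.
Let beta01 : 0 <= 1 - delta <= 1.
Proof. by case/andP: delta01 => d0 d1; apply/andP; split; lra. Qed.

Local Notation S s := (sg R n (pluses s)).
Local Notation x := (delta ^+ 2 * n%:R).
Local Notation nu := (n%:R^-1 : R).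
Local Notation kap := ((delta * n%:R)^-1).
Local Notation tn := (2^-1 * (n%:R / delta) * ln x).
Local Notation wn := (n%:R / delta).
Local Notation E := (Ex (1 - delta)).

Definition contr : R := 1 - delta / n%:R.

Lemma contr_bounds : 1 / 2 <= contr <= 1.
Proof.
have n4 := n_ge4R; have n0 := n_gt0R; have [d0 d1] := andP delta01.
have h0 : 0 <= delta / n%:R by rewrite divr_ge0 // ltW.
have h1 : delta / n%:R <= 1 / 2 by rewrite ler_pdivrMr //; lra.
by rewrite /contr; apply/andP; split; lra.
Qed.

Lemma Ex_sqr_contr k s : E k (fun t => S t ^+ 2) s <= (contr ^+ k * S s) ^+ 2 + 3 * kap.
Proof.
have n4 := n_ge4R; have n0 := n_gt0R; have [d0 d1] := andP delta01.
apply: le_trans (Ex_sqr_lin n_gt1 delta01 k s) _; rewrite lerD2r [(contr ^+ k * _) ^+ 2]exprMn.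
apply: ler_wpM2r; first exact: sqr_ge0.
rewrite exprAC lerXn2r ?nnegrE ?sqr_ge0 //.
  by rewrite subr_ge0 ler_pdivrMr // mul1r; lra.
by rewrite /contr; have := sqr_ge0 (delta / n%:R); lra.
Qed.

(** The 11 comes from the cross term of the induction: with [y = delta * nu], [22 * (1 - 4 * y) + 44
    * y = 22 * (1 - 2 * y)] is at most [22 * (1 - y) ^ 2]. *)
Lemma Ex_quartic_contr k s : E k (fun t => S t ^+ 4) s <= ((contr ^+ k * S s) ^+ 2 + 11 * kap) ^+ 2.
Proof.
have n4 := n_ge4R; have n0 := n_gt0R; have [d0 d1] := andP delta01.
have k0 : 0 < kap by rewrite invr_gt0 mulr_gt0.
have nuk : nu <= kap by rewrite lef_pV2 ?posrE ?mulr_gt0 // ler_piMl // ltW.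
have nu0 : 0 < nu by rewrite invr_gt0.
have nu1 : nu <= 1 by rewrite invf_le1 //; lra.
elim: k => [|k IH].
  rewrite expr0 mul1r /Ex /=; set y := S s.
  have := sqr_ge0 y; have : 0 <= y ^+ 2 * kap by rewrite mulr_ge0 ?sqr_ge0 // ltW.
  have := sqr_ge0 kap; lra.
have h2 := Ex_sqr_contr k s.
set z := (contr ^+ k * S s) ^+ 2 in IH h2 *.
have z0 : 0 <= z by exact: sqr_ge0.
have step : E k.+1 (fun t => S t ^+ 4) s <= (1 - 4 * delta * nu) * E k (fun t => S t ^+ 4) s
    + (44 * nu ^+ 2 * E k (fun t => S t ^+ 2) s + 32 * nu ^+ 4).
  rewrite ExS -(Ex_cst (1 - delta) n_gt0 k (32 * nu ^+ 4) s) -!ExZ -!ExDf.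
  apply: Ex_le => // t; have := gstep_quartic_le n_gt0 beta01 t; rewrite subKr; lra.
apply: le_trans step _.
have f0 : 0 <= 1 - 4 * delta * nu by rewrite subr_ge0 ler_pdivrMr // mul1r; lra.
have k1 := ler_wpM2l f0 IH.
have k2 : 44 * nu ^+ 2 * E k (fun t => S t ^+ 2) s <= 44 * nu ^+ 2 * (z + 3 * kap).
  by apply: ler_wpM2l h2; rewrite mulr_ge0 // sqr_ge0.
have zS : (contr ^+ k.+1 * S s) ^+ 2 = contr ^+ 2 * z by rewrite /z [contr ^+ k.+1]exprS -mulrA exprMn.
rewrite zS.
set y := delta * nu.
have yk : y * kap = nu ^+ 2 by rewrite /y; field; rewrite !gt_eqF.
have y0 : 0 <= y by rewrite mulr_ge0 // ltW.
have y4 : 4 * y <= 1 by move: f0; rewrite -mulrA -/y; lra.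
have cE : contr = 1 - y by [].
have e1 : 1 - 4 * delta * nu = 1 - 4 * y by rewrite /y; ring.
rewrite e1 in k1 *.
apply: le_trans (lerD k1 (lerD k2 (lexx _))) _.
have n4k : nu ^+ 4 <= nu ^+ 2 * kap.
  rewrite (_ : nu ^+ 4 = nu ^+ 2 * (nu * nu)); last by ring.
  rewrite ler_wpM2l ?sqr_ge0 //; apply: le_trans nuk; by rewrite ler_piMl // ltW.
rewrite cE -yk in n4k *.
have a1 : 0 <= y * y * z ^+ 2.
  by apply: mulr_ge0; [exact: mulr_ge0 | exact: sqr_ge0].
have a2 : 0 <= y * y * (z * kap).
  by apply: mulr_ge0; apply: mulr_ge0 => //; exact: ltW.
have a3 : 0 <= y * kap ^+ 2 by rewrite mulr_ge0 ?sqr_ge0.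
have a4 : (1 - 4 * y) * z ^+ 2 <= ((1 - y) ^+ 2 * z) ^+ 2.
  have -> : ((1 - y) ^+ 2 * z) ^+ 2 = (1 - y) ^+ 4 * z ^+ 2 by ring.
  apply: ler_wpM2r; first exact: sqr_ge0.
  have := sqr_ge0 y; have : 0 <= y ^+ 2 * (1 - y) by rewrite mulr_ge0 ?sqr_ge0 //; lra.
  have := sqr_ge0 (y ^+ 2); lra.
have a5 : (1 - 2 * y) * (z * kap) <= (1 - y) ^+ 2 * (z * kap).
  apply: ler_wpM2r; first by rewrite mulr_ge0 // ltW.
  by have := sqr_ge0 y; lra.
lra.
Qed.

(** Interpolation between the second and fourth moments, [|u| ^ 3 <= y / 2 * u ^ 2 + u ^ 4 / (2 *
    y)] at the common scale [y = rs + om], then [(rs + om) ^ 3 <= 4 * (rs ^ 3 + om ^ 3)]. *)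
Lemma Ex_cube_contr k s (rs := contr ^+ k * S s) (om := Num.sqrt (11 * kap)) : 0 <= S s ->
  E k (fun t => `|S t| ^+ 3) s <= 4 * (rs ^+ 3 + om ^+ 3).
Proof.
move=> s0; have n0 := n_gt0R; have [d0 d1] := andP delta01.
have k0 : 0 < kap by rewrite invr_gt0 mulr_gt0.
have [c12 c1] := andP contr_bounds.
have rs0 : 0 <= rs by rewrite mulr_ge0 // exprn_ge0; lra.
have om0 : 0 < om by rewrite sqrtr_gt0 mulr_gt0.
have om2 : om ^+ 2 = 11 * kap by rewrite sqr_sqrtr // mulr_ge0 // ltW.
set y := rs + om; have y0 : 0 < y by rewrite /y; lra.
have hy : rs ^+ 2 + 11 * kap <= y ^+ 2.
  have ro : 0 <= rs * om by rewrite mulr_ge0 // ltW.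
  by rewrite -om2 /y; lra.
have e2 := Ex_sqr_contr k s; have e4 := Ex_quartic_contr k s; rewrite -/rs in e2 e4.
have e2' : E k (fun t => S t ^+ 2) s <= y ^+ 2 by lra.
have e4' : E k (fun t => S t ^+ 4) s <= y ^+ 4.
  apply: le_trans e4 _; rewrite (_ : y ^+ 4 = (y ^+ 2) ^+ 2); last by rewrite -exprM.
  apply: lerXn2r => //; rewrite nnegrE ?sqr_ge0 //; have := sqr_ge0 rs; lra.
apply: (@le_trans _ _ (y ^+ 3)).
  apply: (@le_trans _ _ (E k (fun t => y / 2 * S t ^+ 2 + (2 * y)^-1 * S t ^+ 4) s)).
    apply: Ex_le => // t; set u := S t.
    have u2 : u ^+ 2 = `|u| ^+ 2 by rewrite real_normK ?num_real.
    have -> : u ^+ 4 = (`|u| ^+ 2) ^+ 2 by rewrite -u2 -exprM.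
    rewrite u2; set w := `|u|; rewrite -subr_ge0.
    have -> : y / 2 * w ^+ 2 + (2 * y)^-1 * (w ^+ 2) ^+ 2 - w ^+ 3 =
      (2 * y)^-1 * (w * (y - w)) ^+ 2 by field; rewrite gt_eqF.
    by rewrite mulr_ge0 ?sqr_ge0 // invr_ge0 mulr_ge0 // ltW.
  rewrite ExDf !ExZ.
  have h1 : y / 2 * E k (fun t => S t ^+ 2) s <= y / 2 * y ^+ 2.
    by apply: ler_wpM2l => //; rewrite divr_ge0 // ltW.
  have h2 : (2 * y)^-1 * E k (fun t => S t ^+ 4) s <= (2 * y)^-1 * y ^+ 4.
    by apply: ler_wpM2l => //; rewrite invr_ge0 mulr_ge0 // ltW.
  have e : y / 2 * y ^+ 2 + (2 * y)^-1 * y ^+ 4 = y ^+ 3 by field; rewrite gt_eqF.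
  by rewrite -e; apply: lerD.
rewrite -subr_ge0.
have -> : 4 * (rs ^+ 3 + om ^+ 3) - y ^+ 3 = 3 * ((rs + om) * (rs - om) ^+ 2) by rewrite /y; ring.
by rewrite mulr_ge0 // mulr_ge0 ?sqr_ge0 // ltW.
Qed.

(** Variation of constants. The third-moment error has a part decaying like [rho ^ 3] and an
    equilibrium part. Since [rho ^ 3] decays faster than the linear dynamics, the term [a * rho ^ 3]
    leaves a surplus at each step that pays for the first part; [e] is the fixed point for the
    second. The value of [a] leaves slack for the discreteness of time. *)
Lemma Ex_mean_lower k s (rho := contr ^+ k) (a := 8 / 3 * S s ^+ 3 / delta)
    (e := (4 / 3 * Num.sqrt (11 * kap) ^+ 3 + nu) / delta) : 0 <= S s ->
  rho * S s - a * (rho - rho ^+ 3) - e <= E k (fun t => S t) s.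
Proof.
move=> s0; have n0 := n_gt0R; have [d0 d1] := andP delta01.
have [c12 c1] := andP contr_bounds.
have a0 : 0 <= a by rewrite /a divr_ge0 ?(ltW d0) // mulr_ge0 ?exprn_ge0.
have nu0 : 0 < nu by rewrite invr_gt0.
pose om := Num.sqrt (11 * kap).
have om0 : 0 <= om by rewrite sqrtr_ge0.
have e0 : 0 <= e.
  by rewrite /e -/om divr_ge0 ?(ltW d0) // addr_ge0 ?(ltW nu0) // mulr_ge0 ?exprn_ge0.
rewrite {}/rho; elim: k => [|k IH].
  by rewrite expr0 expr1n subrr mulr0 subr0 mul1r gerBl.
set rho := contr ^+ k in IH *; rewrite exprS -/rho.
have rho0 : 0 <= rho by rewrite exprn_ge0 //; lra.
have step : contr * E k (fun t => S t) s - (E k (fun t => `|S t| ^+ 3) s / 3 + nu) * nu <=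
    E k.+1 (fun t => S t) s.
  rewrite ExS; apply: (@le_trans _ _ (E k (fun t => contr * S t + (- (nu / 3) * `|S t| ^+ 3 + - (nu * nu))) s)).
    rewrite ExDf ExZ ExDf ExZ Ex_cst //; apply: eq_ler; field.
    by rewrite gt_eqF.
  apply: Ex_le => // t; have := gstep_mean_ge n_gt0 beta01 t; rewrite subKr /contr; lra.
apply: le_trans step.
have h3 := Ex_cube_contr k s0; rewrite -/om -/rho in h3.
have h3' : (E k (fun t => `|S t| ^+ 3) s / 3 + nu) * nu <=
   (4 / 3 * ((rho * S s) ^+ 3 + om ^+ 3) + nu) * nu by apply: ler_wpM2r; [exact: ltW | lra].
have k1 : contr * (rho * S s - a * (rho - rho ^+ 3) - e) <= contr * E k (fun t => S t) s.
  by apply: ler_wpM2l => //; lra.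
have ey : e * (delta * nu) = (4 / 3 * om ^+ 3 + nu) * nu by rewrite /e -/om; field; rewrite gt_eqF ?gt_eqF.
have ay : 4 / 3 * S s ^+ 3 * nu = a * (delta * nu) / 2 by rewrite /a; field; rewrite gt_eqF ?gt_eqF.
have cE : delta * nu = 1 - contr by rewrite /contr; ring.
rewrite cE in ey ay.
have gain : 0 <= a * rho ^+ 3 * ((1 - contr) * (contr * (1 + contr) - 1 / 2)).
  apply: mulr_ge0; first by rewrite mulr_ge0 // exprn_ge0.
  by apply: mulr_ge0; nra.
have : 4 / 3 * (rho * S s) ^+ 3 * nu = rho ^+ 3 * (a * (1 - contr) / 2) by rewrite -ay; ring.
move=> ay'.
have : (4 / 3 * ((rho * S s) ^+ 3 + om ^+ 3) + nu) * nu = 4 / 3 * (rho * S s) ^+ 3 * nu + e * (1 - contr).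
  by rewrite ey; ring.
rewrite ay' => tot.
move: (E k _ s) (E k _ s) h3' k1 => X Y h3' k1; rewrite tot in h3'; lra.
Qed.

Lemma lipc_sg : lipc (2 * nu) (fun t : config n => S t).
Proof.
move=> i s; have n0 := n_gt0R.
have h (t : config n) : sg R n (pluses t) = magn R t / n%:R by rewrite magnE.
rewrite !h !magn_setspin /sp -mulrBl normrM (@ger0_norm _ nu) ?invr_ge0 ?(ltW n0) //.
apply: ler_wpM2r; first by rewrite invr_ge0 ltW.
by rewrite (_ : _ - _ = 2) ?ger0_norm //; ring.
Qed.

Lemma Ex_var_sg k s : E k (fun t => S t ^+ 2) s - E k (fun t => S t) s ^+ 2 <= 4 * kap.
Proof.
have n0 := n_gt0R; have [d0 d1] := andP delta01.
have nu0 : 0 < nu by rewrite invr_gt0.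
have L0 : 0 <= 2 * nu by rewrite mulr_ge0 // ltW.
apply: le_trans (Ex_var n_gt0 k s beta01 lipc_sg L0) _.
rewrite subKr -/contr.
have [c12 c1] := andP contr_bounds.
have y0 : 0 < delta / n%:R by rewrite divr_gt0.
have : \sum_(j < k) contr ^+ j <= (delta / n%:R)^-1.
  rewrite -[leRHS]mulr1 ler_pdivlMl //.
  have -> : delta / n%:R = 1 - contr by rewrite /contr; ring.
  have -> : (1 - contr) * \sum_(i < k) contr ^+ i = 1 - contr ^+ k.
    by rewrite -[1 in RHS](expr1n _ k) subrXX; congr (_ * _); apply: eq_bigr => i _; rewrite expr1n mul1r.
  by rewrite gerBl exprn_ge0 //; lra.
move=> h; have := ler_wpM2l (sqr_ge0 (2 * nu)) h; set Sg := \sum_(j < k) _.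
have -> : (2 * nu) ^+ 2 * (delta / n%:R)^-1 = 4 * kap by field; rewrite !gt_eqF.
by [].
Qed.

(* Chebyshev's inequality for the magnetization under both laws. *)
Lemma tv_lower k s (m := E k (fun t => S t) s) : 0 < m ->
  1 - 28 * kap / m ^+ 2 <= tv_to_stat (1 - delta) s k.
Proof.
move=> m0; have n0 := n_gt0R.
pose f (t : config n) : R := if m / 2 <= S t then 1 else -1.
have f1 t : `|f t| <= 1 by rewrite /f; case: ifP; rewrite ?normrN normr1.
have low t : 1 - 8 / m ^+ 2 * (S t - m) ^+ 2 <= f t.
  have q0 : 0 <= 8 / m ^+ 2 * (S t - m) ^+ 2 by rewrite mulr_ge0 ?sqr_ge0 // divr_ge0 ?sqr_ge0.
  rewrite /f; case: (leP (m / 2) (S t)) => h; first by lra.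
  suff : 2 <= 8 / m ^+ 2 * (S t - m) ^+ 2 by move: (8 / m ^+ 2 * (S t - m) ^+ 2) => Q; lra.
  rewrite mulrAC ler_pdivlMr ?exprn_gt0 //; nra.
have upp t : f t <= -1 + 8 / m ^+ 2 * S t ^+ 2.
  have q0 : 0 <= 8 / m ^+ 2 * S t ^+ 2 by rewrite mulr_ge0 ?sqr_ge0 // divr_ge0 ?sqr_ge0.
  rewrite /f; case: (leP (m / 2) (S t)) => h; last by lra.
  suff : 2 <= 8 / m ^+ 2 * S t ^+ 2 by move: (8 / m ^+ 2 * S t ^+ 2) => Q; lra.
  rewrite mulrAC ler_pdivlMr ?exprn_gt0 //; nra.
have tvf : E k f s - Emu (1 - delta) f <= 2 * tv_to_stat (1 - delta) s k.
  rewrite -glauber_distE // /Emu -sumrB /tv_to_stat mulrA mulfV // mul1r.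
  apply: ler_sum => t _; rewrite -mulrBl; apply: le_trans (ler_norm _) _.
  by rewrite normrM ler_piMr.
have e1 : 1 - 8 / m ^+ 2 * (4 * kap) <= E k f s.
  apply: (@le_trans _ _ (E k (fun t => 1 - 8 / m ^+ 2 * (S t - m) ^+ 2) s)); last exact: Ex_le.
  rewrite ExB Ex_cst // (ExZ (1 - delta) k (8 / m ^+ 2) (fun t => (S t - m) ^+ 2)) lerD2l lerN2.
  apply: ler_wpM2l; first by rewrite divr_ge0 ?sqr_ge0.
  rewrite (@eq_Ex _ _ (1 - delta) k _ (fun t => S t ^+ 2 + ((- 2 * m) * S t + m ^+ 2))).
    by rewrite ExDf ExDf (ExZ (1 - delta) k (-2 * m)) Ex_cst // -/m; have := Ex_var_sg k s; rewrite -/m; lra.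
  by move=> t /=; ring.
have e2 : Emu (1 - delta) f <= -1 + 8 / m ^+ 2 * (3 * kap).
  apply: (@le_trans _ _ (Emu (1 - delta) (fun t => -1 + 8 / m ^+ 2 * S t ^+ 2))); first exact: Emu_le.
  rewrite EmuD Emu_cst (EmuZ (1 - delta) (8 / m ^+ 2)) lerD2l.
  apply: ler_wpM2l; first by rewrite divr_ge0 ?sqr_ge0.
  exact: Emu_sqr_le_kap.
have e3 : 28 * kap / m ^+ 2 = (8 / m ^+ 2 * (4 * kap) + 8 / m ^+ 2 * (3 * kap)) / 2.
  by field; case/andP: delta01 => d0 _; rewrite !gt_eqF.
rewrite e3; move: (8 / _ * _) (8 / _ * _) e1 e2 => X Y; lra.
Qed.

End Lower.

(** * Choice of the start and Chebyshev bound *)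

Section LowerBound.
Variables (R : realType) (n : nat) (delta : R).
Hypothesis n_ge4 : (4 <= n)%N.
Hypothesis delta01 : 0 < delta <= 1.

Let n_gt1 : (1 < n)%N. Proof. by apply: leq_trans n_ge4. Qed.
Let n_gt0 : (0 < n)%N. Proof. exact: ltnW. Qed.
Let n_gt0R : 0 < n%:R :> R.
Proof. by rewrite ltr0n. Qed.
Let n_ge4R : 4 <= n%:R :> R.
Proof. by rewrite -[4]/(4%:R) ler_nat. Qed.

Local Notation x := (delta ^+ 2 * n%:R).
Local Notation kap := ((delta * n%:R)^-1).
Local Notation tn := (2^-1 * (n%:R / delta) * ln x).
Local Notation wn := (n%:R / delta).

(** With [y = delta / n], [1 - y >= exp (- y / (1 - y))] and [y / (1 - y) <= y + 2 * y ^ 2]. Over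
    the whole time the quadratic remainder is at most [y * ln x <= delta ^ 3 <= 1], the 1 lost in
    [gam - 1]. *)
Lemma contr_exp_lower (gam : R) (t : nat) : 1 <= x -> t%:R <= tn - gam * wn -> 0 <= gam ->
  expR (gam - 1) / Num.sqrt x <= contr n delta ^+ t.
Proof.
move=> x1 ht g0; have n0 := n_gt0R; have n4 := n_ge4R; have [d0 d1] := andP delta01.
have x0 : 0 < x by lra.
set y := delta / n%:R.
have y0 : 0 < y by rewrite divr_gt0.
have y4 : 4 * y <= 1 by rewrite /y mulrA ler_pdivrMr // mul1r; lra.
have r0 : 0 < 1 - y by lra.
have base : expR (- (y / (1 - y))) <= contr n delta.
  rewrite expRN -[leRHS]invrK lef_pV2 ?posrE ?expR_gt0 ?invr_gt0 //.
  have e : (contr n delta)^-1 = 1 + y / (1 - y) by rewrite /contr -/y; field; rewrite gt_eqF.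
  by rewrite [leLHS]e expR_ge1Dx.
have step : expR (- (y / (1 - y)) * t%:R) <= contr n delta ^+ t.
  by rewrite mulrC expRM_natl lerXn2r ?nnegrE ?expR_ge0 // ltW.
apply: le_trans step.
have -> : expR (gam - 1) / Num.sqrt x = expR (gam - 1 - ln x / 2).
  have e : x = expR (ln x / 2) ^+ 2 by rewrite -expRM_natl mulrCA mulfV ?mulr1 ?lnK ?posrE.
  by rewrite expRB {1}e sqrtr_sqr ger0_norm ?expR_ge0.
rewrite ler_expR.
have lx := ln_ge0 x1.
have ty : t%:R * y <= ln x / 2 - gam.
  have -> : ln x / 2 - gam = (tn - gam * wn) * y by rewrite /y; field; rewrite !gt_eqF.
  by apply: ler_wpM2r => //; exact: ltW.
have t0 : 0 <= t%:R :> R by [].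
have f1 : y / (1 - y) <= y + 2 * y ^+ 2.
  by rewrite ler_pdivrMr //; have := mulr_ge0 (sqr_ge0 y) (ltW y0); have := sqr_ge0 y; nra.
have yln : y * ln x <= 1.
  have l1 := ln_sublinear x0.
  have h1 : y * ln x <= y * x by rewrite ler_pM2l // ltW.
  apply: le_trans h1 _; have -> : y * x = delta ^+ 3 by rewrite /y; field; rewrite gt_eqF.
  by rewrite exprn_ile1 // ltW.
have f2 : t%:R * (y / (1 - y)) <= t%:R * (y + 2 * y ^+ 2) by apply: ler_wpM2l.
have f3 : (t%:R * y) * (1 + 2 * y) <= (ln x / 2 - gam) * (1 + 2 * y).
  by apply: ler_wpM2r => //; lra.
have f4 : 0 <= gam * y by rewrite mulr_ge0 // ltW.
lra.
Qed.

(** The start must be of order [sqrt delta] for the decay to last [tn], yet small enough for the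
    cubic correction in [mean_lower] to cost only a sixth. Levels are [2 / n] apart, which [x >= 16]
    makes finer than the interval. *)
Lemma start_level : 16 <= x -> exists2 j, (j <= n)%N &
  Num.sqrt delta / 8 <= sg R n j <= Num.sqrt delta / 4.
Proof.
move=> x16; have n0 := n_gt0R; have [d0 d1] := andP delta01.
set r := Num.sqrt delta.
have r0 : 0 < r by rewrite sqrtr_gt0.
have r1 : r <= 1 by rewrite -[leRHS]sqrtr1 ler_wsqrtr.
have rr : r ^+ 2 = delta by rewrite sqr_sqrtr // ltW.
have nr : 16 <= n%:R * r.
  have h : r ^+ 3 <= 1 by rewrite exprn_ile1 // ltW.
  have : n%:R * r * r ^+ 3 <= n%:R * r by rewrite ler_piMr // mulr_ge0 // ltW.
  have -> : n%:R * r * r ^+ 3 = x by rewrite -rr; ring.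
  lra.
have y0 : 0 <= n%:R * (1 + r / 8) / 2.
  by rewrite divr_ge0 // mulr_ge0 ?(ltW n0) //; lra.
have [j /andP[j1 j2]] := nat_ceil y0.
exists j.
  rewrite -(ler_nat R); apply: le_trans j2 _; have n4 := n_ge4R; nra.
by rewrite /sg ler_pdivlMr // ler_pdivrMr //; apply/andP; split; lra.
Qed.

(** [1 / 24] rounds down [(5 / 6) * (1 / 8)], the start [sqrt delta / 8] reduced by the cubic
    correction; 51 generously covers the error [e] in units of [sqrt kap]. *)
Lemma mean_lower (gam : R) (j t : nat) : (j <= n)%N -> 16 <= x ->
  Num.sqrt delta / 8 <= sg R n j <= Num.sqrt delta / 4 -> 0 <= gam ->
  t%:R <= tn - gam * wn ->
  (expR (gam - 1) / 24 - 51) * Num.sqrt kap <=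
    Ex (1 - delta) t (fun u => sg R n (pluses u)) (level_config n j).
Proof.
move=> jn x16 /andP[s1 s2] g0 ht; have n0 := n_gt0R; have [d0 d1] := andP delta01.
have n4 := n_ge4R.
have sj : sg R n (pluses (level_config n j)) = sg R n j by rewrite pluses_level_config.
have r0 : 0 < Num.sqrt delta by rewrite sqrtr_gt0.
have rr : Num.sqrt delta ^+ 2 = delta by rewrite sqr_sqrtr // ltW.
have s0 : 0 <= sg R n (pluses (level_config n j)) by rewrite sj; lra.
have := Ex_mean_lower n_ge4 delta01 t s0; rewrite sj.
set s := sg R n j in s1 s2 *; set rho := contr n delta ^+ t.
set e := (_ + _) / delta.
set m := Ex _ _ _ _ => hm; apply: le_trans hm.
have [c12 c1] := andP (contr_bounds n_ge4 delta01).
have rho0 : 0 <= rho by rewrite exprn_ge0 //; lra.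
have sp : 0 < s by lra.
have a6 : 8 / 3 * s ^+ 3 / delta <= s / 6.
  rewrite ler_pdivrMr // -rr.
  have h : s * s ^+ 2 <= s * (Num.sqrt delta / 4) ^+ 2.
    rewrite ler_pM2l // lerXn2r ?nnegrE ?(ltW sp) // divr_ge0 // ltW.
  lra.
have rl : expR (gam - 1) / Num.sqrt x <= rho by apply: contr_exp_lower => //; lra.
set k := Num.sqrt kap.
have kap0 : 0 < kap by rewrite invr_gt0 mulr_gt0.
have k0 : 0 < k by rewrite sqrtr_gt0.
have kk : k ^+ 2 = kap by rewrite sqr_sqrtr // ltW.
have sx : Num.sqrt x = Num.sqrt delta / k.
  have -> : x = delta * (delta * n%:R) by ring.
  by rewrite sqrtrM ?(ltW d0) // /k sqrtrV ?invrK // mulr_ge0 ?ltW.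
have x0 : 0 < x by lra.
have rs : expR (gam - 1) / 8 * k <= rho * s.
  have -> : expR (gam - 1) / 8 * k = expR (gam - 1) / Num.sqrt x * (Num.sqrt delta / 8).
    by rewrite sx; field; rewrite !gt_eqF.
  apply: ler_pM => //; rewrite divr_ge0 ?expR_ge0 ?sqrtr_ge0 //; exact: ltW.
have rho3 : 0 <= rho ^+ 3 by rewrite exprn_ge0.
have aa : 8 / 3 * s ^+ 3 / delta * (rho - rho ^+ 3) <= s / 6 * rho.
  have a0 : 0 <= 8 / 3 * s ^+ 3 / delta.
    by rewrite divr_ge0 ?(ltW d0) // mulr_ge0 // exprn_ge0 // ltW.
  apply: (@le_trans _ _ (8 / 3 * s ^+ 3 / delta * rho)).
    by apply: ler_wpM2l => //; lra.
  by apply: ler_wpM2r.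
have he : e <= 51 * k.
  have k1 : k <= 1 / 4.
    rewrite -(@ler_sqr _ k) ?nnegrE ?(ltW k0) // kk.
    have -> : kap = delta / x by field; rewrite !gt_eqF.
    rewrite ler_pdivrMr //; lra.
  have s11 : Num.sqrt (11 * kap) <= 10 / 3 * k.
    rewrite -[leRHS]ger0_norm; last by rewrite mulr_ge0 // ltW.
    by rewrite -sqrtr_sqr ler_wsqrtr // exprMn kk; lra.
  have s3 : Num.sqrt (11 * kap) ^+ 3 <= (10 / 3 * k) ^+ 3.
    by rewrite lerXn2r ?nnegrE ?sqrtr_ge0 // mulr_ge0 // ltW.
  have kx : k ^+ 2 / delta <= 1 / 16.
    rewrite kk; have -> : kap / delta = x^-1 by field; rewrite !gt_eqF.
    by rewrite -[leRHS]invrK lef_pV2 ?posrE //; lra.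
  have nk : n%:R^-1 / delta = k ^+ 2 by rewrite kk; field; rewrite !gt_eqF.
  rewrite /e mulrDl nk.
  have p1 : 4 / 3 * Num.sqrt (11 * kap) ^+ 3 / delta <= 4 / 3 * (10 / 3) ^+ 3 * (k * (k ^+ 2 / delta)).
    have -> : 4 / 3 * (10 / 3) ^+ 3 * (k * (k ^+ 2 / delta)) = 4 / 3 * (10 / 3 * k) ^+ 3 / delta.
      by field; rewrite gt_eqF.
    by rewrite ler_pM2r ?invr_gt0 // ler_pM2l.
  have p2 : k * (k ^+ 2 / delta) <= k * (1 / 16) by rewrite ler_pM2l.
  have p3 : k * k <= k * (1 / 4) by rewrite ler_pM2l.
  rewrite expr2; lra.
have Xk : 0 <= expR (gam - 1) * k by rewrite mulr_ge0 ?expR_ge0 // ltW.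
have e' : (expR (gam - 1) / 24 - 51) * k <= 5 / 6 * (rho * s) - e by lra.
apply: le_trans e' _; rewrite lerD2r; lra.
Qed.

Lemma tmix_lower (gam eps : R) (M := expR (gam - 1) / 24 - 51) : 16 <= x -> 0 <= gam -> 0 < M ->
  28 / M ^+ 2 < 1 - eps -> (exists m, dmix n (1 - delta) m <= eps) ->
  tn - gam * wn <= (tmix n (1 - delta) eps)%:R.
Proof.
move=> x16 g0 M0 hM ex; have n0 := n_gt0R; have [d0 d1] := andP delta01.
have [neg|pos] := leP (tn - gam * wn) 0; first by apply: le_trans neg _.
have [k /andP[k1 k2]] := nat_ceil (ltW pos).
apply: le_trans k1 _; rewrite ler_nat; apply: tmix_ge => // t tk.
have ht : t%:R <= tn - gam * wn.
  have : t%:R + 1 <= k%:R :> R by rewrite natr1 ler_nat.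
  lra.
have [j jn sj] := start_level x16.
have := mean_lower jn x16 sj g0 ht; rewrite -/M; set m := Ex _ _ _ _ => hm.
have kap0 : 0 < kap by rewrite invr_gt0 mulr_gt0.
have k0 : 0 < Num.sqrt kap by rewrite sqrtr_gt0.
have Mk0 : 0 < M * Num.sqrt kap by rewrite mulr_gt0.
have m0 : 0 < m by lra.
apply: lt_le_trans (dmix_ge _ (level_config n j) t).
apply: lt_le_trans (tv_lower n_ge4 delta01 m0).
suff : 28 * kap / m ^+ 2 <= 28 / M ^+ 2 by lra.
have -> : 28 / M ^+ 2 = 28 * kap / (M * Num.sqrt kap) ^+ 2.
  by rewrite exprMn sqr_sqrtr ?(ltW kap0) //; field; rewrite !gt_eqF.
rewrite ler_pM2l; last by rewrite mulr_gt0.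
rewrite lef_pV2 ?posrE ?exprn_gt0 //.
by rewrite lerXn2r ?nnegrE // ltW.
Qed.

End LowerBound.

(** * Spectral gap *)

Section TopEigenvector.
Variables (R : realType) (T : finType) (mu : T -> R) (K : T -> T -> R).
Hypothesis mu_pos : forall t, 0 < mu t.
Hypothesis K_selfadjoint : forall f g : T -> R,
  \sum_t mu t * (f t * \sum_u K t u * g u) = \sum_t mu t * ((\sum_u K t u * f u) * g t).
Hypothesis K_stochastic : forall t, \sum_u K t u = 1.
Implicit Types f g : T -> R.

Let ip f g : R := \sum_t mu t * (f t * g t).
Let act f t : R := \sum_u K t u * f u.

Let ipC f g : ip f g = ip g f.
Proof. by apply: eq_bigr => t _; rewrite [f t * _]mulrC. Qed.

Let ip_lin (c d : R) f g h : ip (fun t => c * f t + d * g t) h = c * ip f h + d * ip g h.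
Proof. by rewrite /ip !mulr_sumr -big_split; apply: eq_bigr => t _ /=; ring. Qed.

Let ip_linr (c d : R) f g h : ip h (fun t => c * f t + d * g t) = c * ip h f + d * ip h g.
Proof. by rewrite ipC ip_lin !(ipC h). Qed.

Let act_lin (c d : R) f g t : act (fun t => c * f t + d * g t) t = c * act f t + d * act g t.
Proof. by rewrite /act !mulr_sumr -big_split; apply: eq_bigr => u _ /=; ring. Qed.

Let eq_ip f f' g g' : f =1 f' -> g =1 g' -> ip f g = ip f' g'.
Proof. by move=> e e'; apply: eq_bigr => t _; rewrite e e'. Qed.

Let ip_ge0 f : 0 <= ip f f.
Proof. by apply: sumr_ge0 => t _; rewrite mulr_ge0 ?(ltW (mu_pos t)) // -expr2 sqr_ge0. Qed.

Let ip_eq0 f : ip f f = 0 -> forall t, f t = 0.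
Proof.
move=> /eqP; rewrite psumr_eq0 => [/allP h t|t _]; last first.
  by rewrite mulr_ge0 ?(ltW (mu_pos t)) // -expr2 sqr_ge0.
have := h t (mem_index_enum t); rewrite mulf_eq0 gt_eqF ?mu_pos //= mulf_eq0 orbb.
by move/eqP.
Qed.

Let mean_act f : ip (act f) (fun=> 1) = ip f (fun=> 1).
Proof.
rewrite ipC /ip; have := K_selfadjoint (fun=> 1) f; rewrite -/(act f) => ->.
apply: eq_bigr => t _; rewrite [RHS]mulrC mulr1 mulrC; congr (_ * _).
rewrite (eq_bigr (K t)) ?K_stochastic ?mul1r // => u _; exact: mulr1.
Qed.

(* Maximize the Rayleigh quotient over the unit sphere of the orthogonal of the
   constants, which is compact. *)
Lemma exists_top_eigenvector phi : (exists t, phi t != 0) -> \sum_t mu t * phi t = 0 ->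
  exists (a : R) (f : T -> R), [/\ exists t, f t != 0, forall t, \sum_u K t u * f u = a * f t,
    \sum_t mu t * f t = 0 &
    \sum_t mu t * (phi t * \sum_u K t u * phi u) <= a * \sum_t mu t * phi t ^+ 2].
Proof.
move=> [t0 phi0] mphi.
have mE f : ip f (fun=> 1) = \sum_t mu t * f t by apply: eq_bigr => t _; rewrite mulr1.
pose fn (v : 'rV[R]_(#|T|)) t : R := v ord0 (enum_rank t).
pose row f : 'rV[R]_(#|T|) := \row_i f (enum_val i).
have rowK f : fn (row f) =1 f by move=> t; rewrite /fn mxE enum_rankK.
have contS (F : T -> 'rV[R]_(#|T|) -> R) : (forall t, continuous (F t)) ->
    continuous (fun v => \sum_t F t v).
  move=> h; apply: (@continuous_big R T +%R 0 xpredT _ _ (index_enum T) F) => //.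
  exact: add_continuous.
have contM (F G : 'rV[R]_(#|T|) -> R) : continuous F -> continuous G ->
    continuous (fun v => F v * G v).
  by move=> hF hG v; apply: continuousM; [exact: hF | exact: hG].
have contC (c : R) : continuous (fun _ : 'rV[R]_(#|T|) => c) by exact: cst_continuous.
have contfn t : continuous (fun v => fn v t) by exact: coord_continuous.
pose N v := ip (fn v) (fn v).
pose M v := ip (fn v) (fun=> 1).
pose q v := ip (fn v) (act (fn v)).
have contip (F G : 'rV[R]_(#|T|) -> T -> R) : (forall t, continuous (fun v => F v t)) ->
    (forall t, continuous (fun v => G v t)) -> continuous (fun v => ip (F v) (G v)).
  move=> hF hG; apply: contS => t.
  exact: (contM (fun=> mu t) (fun v => F v t * G v t) (contC _) (contM _ _ (hF t) (hG t))).
have contact t : continuous (fun v => act (fn v) t).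
  by apply: contS => u; exact: (contM (fun=> K t u) (fun v => fn v u) (contC _) (contfn u)).
have Nc : continuous N := contip fn fn contfn contfn.
have Mc : continuous M := contip fn (fun=> fun=> 1) contfn (fun=> contC 1).
have qc : continuous q := contip fn (fun v => act (fn v)) contfn contact.
pose A : set 'rV[R]_(#|T|) := [set v | N v = 1 /\ M v = 0].
have Acl : closed A.
  have -> : A = (N @^-1` [set y : R | y = 1]) `&` (M @^-1` [set y : R | y = 0]) by [].
  apply: closedI; apply: preimage_closed => [v _|].
  - exact: Nc.
  - exact: closed_eq.
  - exact: Mc.
  - exact: closed_eq.
(* On the unit sphere [|v t| ^ 2 <= 1 / mu t], so each coordinate is at most [1 + 1 / mu t]; the sum
   is a common bound. *)
pose B : R := \sum_t (1 + (mu t)^-1).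
have Bt t : 1 + (mu t)^-1 <= B.
  rewrite /B (bigD1 t) //= lerDl; apply: sumr_ge0 => u _.
  by rewrite addr_ge0 // invr_ge0 ltW.
have Ac : compact A.
  have Bc : compact [set v : 'rV[R]_(#|T|) | forall i, `[(- B), B]%classic (v ord0 i)].
    apply: (@rV_compact _  _ (fun=> `[(- B), B]%classic)).
    by move=> _; apply: segment_compact.
  apply: subclosed_compact Acl Bc _ => v [Nv _] i /=.
  set t := enum_val i; have vi : v ord0 i = fn v t by rewrite /fn /t enum_valK.
  rewrite /= in_itv /= -ler_norml vi; apply: le_trans (Bt t).
  have m0 := mu_pos t.
  have h : mu t * fn v t ^+ 2 <= 1.
    rewrite -Nv /N /ip (bigD1 t) //= -expr2 lerDl; apply: sumr_ge0 => u _.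
    by rewrite mulr_ge0 ?(ltW (mu_pos u)) // -expr2 sqr_ge0.
  have h2 : fn v t ^+ 2 <= (mu t)^-1 by rewrite -[leRHS]mulr1 ler_pdivlMl.
  have i0 : 0 < (mu t)^-1 by rewrite invr_gt0.
  rewrite -(@ler_sqr _ `|_|) ?nnegrE ?addr_ge0 ?(ltW i0) // real_normK ?num_real //.
  by apply: le_trans h2 _; have := sqr_ge0 (mu t)^-1; lra.
have ip_phi : 0 < ip phi phi.
  rewrite lt_def ip_ge0 andbT; apply/eqP => h.
  by move: phi0; rewrite (ip_eq0 h) eqxx.
(* The summand [0 * f t] gives the rescaling the shape that [ip_lin] and [act_lin] expect. *)
have normalize f : 0 < ip f f -> ip f (fun=> 1) = 0 ->
    A (row (fun t => (Num.sqrt (ip f f))^-1 * f t + 0 * f t)).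
  move=> p m; have s2 : Num.sqrt (ip f f) ^+ 2 = ip f f by rewrite sqr_sqrtr // ltW.
  have s0 : 0 < Num.sqrt (ip f f) by rewrite sqrtr_gt0.
  split; rewrite /N /M.
    rewrite (eq_ip (rowK _) (rowK _)) ip_lin ipC ip_lin.
    set s := Num.sqrt _ in s2 s0 *; clearbody s; rewrite -s2.
    by field; rewrite gt_eqF.
  by rewrite (eq_ip (rowK _) (frefl _)) ip_lin m !mulr0 addr0.
have mphi' : ip phi (fun=> 1) = 0 by rewrite mE.
have A0 : A !=set0 by exists (row (fun t => (Num.sqrt (ip phi phi))^-1 * phi t + 0 * phi t)); exact: normalize.
have [c cA cmax] := EVT_max_rV A0 Ac (continuous_subspaceT qc).
move: cA; rewrite inE => -[Nc1 Mc0].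
pose a := q c; pose f := fn c.
have ray g : ip g (fun=> 1) = 0 -> ip g (act g) <= a * ip g g.
  move=> m; have [z|nz] := eqVneq (ip g g) 0.
    rewrite z mulr0 /ip big1 // => t _; by rewrite (ip_eq0 z) mul0r mulr0.
  have p : 0 < ip g g by rewrite lt_def nz ip_ge0.
  have := normalize g p m => hA.
  have := cmax _ (mem_set hA); rewrite -/a /q.
  set s := Num.sqrt (ip g g).
  have s2 : s ^+ 2 = ip g g by rewrite sqr_sqrtr // ltW.
  have s0 : 0 < s by rewrite sqrtr_gt0.
  have eA : act (fn (row (fun t => s^-1 * g t + 0 * g t))) =1 (fun t => s^-1 * act g t + 0 * act g t).
    by move=> t; rewrite -act_lin; apply: eq_bigr => u _; rewrite rowK.
  rewrite (eq_ip (rowK _) eA) ip_lin ipC ip_lin [ip (act g) g]ipC => h.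
  have e : s^-1 * (s^-1 * ip g (act g) + 0 * ip g (act g)) + 0 * (s^-1 * ip g (act g) + 0 * ip g (act g))
     = ip g (act g) / s ^+ 2 by field; rewrite gt_eqF.
  by move: h; rewrite [X in X <= _]e s2 ler_pdivrMr.
have mean0 : ip f (fun=> 1) = 0 by exact: Mc0.
have aE : ip f (act f) = a by [].
have ff : ip f f = 1 by exact: Nc1.
(* [w] is the residual of the eigenvalue equation. Inserting [f + e * w] into the Rayleigh
   inequality gives [2 * e * W + e ^ 2 * D >= 0] for every [e], with [W] the squared norm of [w]; a
   suitable negative [e] contradicts [W > 0]. *)
have [w wE] : exists w : T -> R, w = (fun t => a * f t + (-1) * act f t) by eexists.
have mw : ip w (fun=> 1) = 0 by rewrite wE ip_lin mean_act mean0 !mulr0 addr0.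
have ww0 : ip w w = 0.
  apply/eqP; rewrite eq_le ip_ge0 andbT leNgt; apply/negP => W0.
  set W := ip w w in W0.
  pose D := a * W - ip w (act w).
  have Ww : W = a * ip f w - ip w (act f).
    by rewrite /W {1}wE ip_lin [ip (act f) w]ipC; ring.
  have wf : ip f (act w) = ip w (act f).
    by rewrite [RHS]/ip K_selfadjoint -/(ip (act w) f) ipC.
  have key (e : R) : 0 <= 2 * e * W + e ^+ 2 * D.
    have m : ip (fun t => 1 * f t + e * w t) (fun=> 1) = 0.
      by rewrite ip_lin mean0 mw !mulr0 addr0.
    have := ray _ m; rewrite (eq_ip (frefl _) (act_lin 1 e f w)) !ip_lin !ip_linr.
    rewrite ff aE wf [ip w f]ipC -/W /D.
    move: Ww; move: (ip f w) (ip w (act f)) (ip w (act w)) => p q' r ->; lra.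
  have [D0|D0] := leP D 0.
    have := key (-1); lra.
  have := key (- (W / D)).
  have -> : 2 * - (W / D) * W + (- (W / D)) ^+ 2 * D = - (W ^+ 2 / D) by field; rewrite gt_eqF.
  have : 0 < W ^+ 2 / D by rewrite divr_gt0 // exprn_gt0.
  lra.
exists a, f; split.
- case: (pselect (exists t, f t != 0)) => [//|h].
  have z t : f t = 0 by case: (eqVneq (f t) 0) => // ft; case: h; exists t.
  have : ip f f = 0 by rewrite /ip big1 // => t _; rewrite z !mulr0.
  by move=> ff0; have := oner_neq0 R; rewrite -ff ff0 eqxx.
- move=> t; have := ip_eq0 ww0 t; rewrite wE /act; lra.
- by rewrite -mE.
- have := ray phi mphi'; rewrite /ip /act.
  by under [X in _ <= _ * X]eq_bigr do rewrite -expr2.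
Qed.

End TopEigenvector.

(** * The gap of the dynamics *)

Section SpectralGap.
Variables (R : realType) (n : nat) (delta : R).
Hypothesis n_gt1 : (1 < n)%N.
Hypothesis delta01 : 0 < delta <= 1.

Let n_gt0 : (0 < n)%N. Proof. exact: ltnW. Qed.
Let n_gt0R : 0 < n%:R :> R.
Proof. by rewrite ltr0n. Qed.
Let beta01 : 0 <= 1 - delta <= 1.
Proof. by case/andP: delta01 => d0 d1; apply/andP; split; lra. Qed.

Local Notation S s := (sg R n (pluses s)).
Local Notation x := (delta ^+ 2 * n%:R).
Local Notation nu := (n%:R^-1 : R).
Local Notation kap := ((delta * n%:R)^-1).
Local Notation Em := (@Emu R n (1 - delta)).

Lemma Emu_sg : Em (fun t => S t) = 0.
Proof.
pose neg (s : config n) : config n := [ffun i => ~~ s i].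
have negK : involutive neg by move=> s; apply/ffunP => i; rewrite !ffunE negbK.
have magn_neg s : magn R (neg s) = - magn R s.
  by rewrite /magn -sumrN; apply: eq_bigr => i _; rewrite /spin ffunE; case: (s i); rewrite ?opprK.
have sgE (s : config n) : S s = magn R s / n%:R by rewrite magnE.
have mu_neg s : cw_mu (1 - delta) (neg s) = cw_mu (1 - delta) s.
  by rewrite /cw_mu /cw_weight !energyE // magn_neg sqrrN.
have h : Em (fun t => S t) = - Em (fun t => S t).
  rewrite {1}/Emu (reindex_inj (inv_inj negK)) -EmuN; apply: eq_bigr => s _ /=.
  by rewrite mu_neg !sgE magn_neg mulNr.
lra.
Qed.

(** [eta] measures the cubic and discreteness errors in the drift of [S] at equilibrium, relative to
    [nu]; 14 rounds up [41 / 3] and 2 rounds up [sqrt 3]. *)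
Lemma sg_moments (eta := (14 / x + 2 / Num.sqrt x)) : 1 <= x ->
  Em (fun t => S t ^+ 4) / 3 + Em (fun t => `|S t|) * nu <= eta * nu.
Proof.
move=> x1; have n0 := n_gt0R; have [d0 d1] := andP delta01.
have k0 : 0 < kap by rewrite invr_gt0 mulr_gt0.
have x0 : 0 < x by lra.
have m4 := Emu_quartic_le_kap n_gt1 delta01.
have v0 : 0 <= 3 * kap by rewrite mulr_ge0 // ltW.
have m1 := mean_norm (is_mean_Emu n (1 - delta)) v0 (Emu_sqr_le_kap n_gt1 delta01).
have e4 : kap ^+ 2 = nu / x by field; rewrite !gt_eqF.
have s1 : Num.sqrt (3 * kap) <= 2 / Num.sqrt x.
  rewrite -[leRHS]ger0_norm ?divr_ge0 ?sqrtr_ge0 // -sqrtr_sqr ler_wsqrtr //.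
  rewrite exprMn exprVn sqr_sqrtr ?(ltW x0) //.
  have : kap <= x^-1.
    rewrite lef_pV2 ?posrE ?mulr_gt0 ?exprn_gt0 //.
    have -> : x = delta * (delta * n%:R) by ring.
    by rewrite ler_piMl // mulr_ge0 ?(ltW d0) ?(ltW n0).
  have : 0 < x^-1 by rewrite invr_gt0.
  lra.
rewrite /eta mulrDl; apply: lerD.
  move: m4; rewrite e4; have : 0 <= nu / x by rewrite divr_ge0 ?invr_ge0 // ltW.
  have -> : 14 / x * nu = 14 * (nu / x) by ring.
  lra.
by rewrite ler_wpM2r ?invr_ge0 ?(ltW n0) // (le_trans m1).
Qed.

(** At equilibrium the noise [4 * c0 * nu ^ 2] of each step is balanced by dissipation, so the
    variance of [S] is at least of order [kap]. This makes errors of relative size [eta] negligible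
    in the Rayleigh quotient. *)
Lemma Emu_sqr_ge : 1 <= x -> 14 / x + 2 / Num.sqrt x <= c0 R ->
  c0 R * nu <= delta * Em (fun t => S t ^+ 2).
Proof.
move=> x1 small; have n0 := n_gt0R; have nu0 : 0 < nu by rewrite invr_gt0.
have mom := sg_moments x1.
have h := Emu_le (1 - delta) (fun t => gstep_sqr_ge n_gt0 beta01 t).
rewrite Emu_gstep // in h.
have e : Em (fun s => S s ^+ 2 - 2 * nu * ((1 - (1 - delta)) * S s ^+ 2 + S s ^+ 4 / 3 + `|S s| * nu)
     + 4 * c0 R * nu ^+ 2) =
   Em (fun t => S t ^+ 2) - 2 * nu * (delta * Em (fun t => S t ^+ 2) +
     (Em (fun t => S t ^+ 4) / 3 + Em (fun t => `|S t|) * nu)) + 4 * c0 R * nu ^+ 2.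
  rewrite EmuD Emu_cst EmuB (EmuZ (1 - delta) (2 * nu)); congr (_ - _ * _ + _).
  rewrite EmuD EmuD EmuZ subKr -addrA; congr (_ + (_ + _)).
    by rewrite mulrC -EmuZ; apply: eq_Emu => t; rewrite mulrC.
  by rewrite mulrC -EmuZ; apply: eq_Emu => t; rewrite mulrC.
rewrite e in h.
move: h mom; move: (_ / 3 + _) => m; move: (Em _) => m2 h mom.
have h2 : nu * (2 * c0 R * nu) <= nu * (delta * m2 + m) by lra.
rewrite ler_pM2l // in h2.
have : (14 / x + 2 / Num.sqrt x) * nu <= c0 R * nu by rewrite ler_pM2r.
lra.
Qed.

Lemma eigenvalue_bound (a : R) f : ~ (forall s t : config n, f s = f t) ->
  (forall s, \sum_(t : config n) glauber (1 - delta) s t * f t = a * f s) ->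
  `|a| <= 1 - delta / n%:R.
Proof.
move=> nc ef; have [b0 _] := andP beta01.
have := lipc_abs_eigen n_gt0 b0 nc; rewrite subKr; apply => s.
by rewrite -ef glauber_gstep.
Qed.

(** [glauber_lambda] is a supremum over actual eigenvalues, so the Rayleigh quotient of [S] is first
    turned into an eigenvalue [a] above it. Its eigenfunction is nonzero with mean zero, hence not
    constant; the contraction bound applies and shows [a != 1]. *)
Lemma gap_bounds : 1 <= x -> 14 / x + 2 / Num.sqrt x <= c0 R ->
  1 <= spectral_gap n (1 - delta) / (delta / n%:R)
    <= 1 + (14 / x + 2 / Num.sqrt x) / c0 R.
Proof.
move=> x1 small; have n0 := n_gt0R; have [d0 d1] := andP delta01.
have nu0 : 0 < nu by rewrite invr_gt0.
have c00 := c0_gt0 R.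
set eta := _ + _ in small *.
set m2 := Em (fun t => S t ^+ 2).
have m2ge : c0 R * nu <= delta * m2 := Emu_sqr_ge x1 small.
have m2p : 0 < m2 by rewrite -(pmulr_rgt0 _ d0); apply: lt_le_trans m2ge; rewrite mulr_gt0.
have sa (f g : config n -> R) :
    \sum_t cw_mu (1 - delta) t * (f t * \sum_u glauber (1 - delta) t u * g u) =
    \sum_t cw_mu (1 - delta) t * ((\sum_u glauber (1 - delta) t u * f u) * g t).
  have h := Emu_gstepA (1 - delta) n_gt0 f g; rewrite /Emu in h.
  rewrite -(eq_bigr _ (fun t _ => _ : cw_mu (1 - delta) t * (f t * gstep (1 - delta) g t) = _)).
    rewrite h; apply: eq_bigr => t _; by rewrite glauber_gstep.
  by move=> t _; rewrite glauber_gstep.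
have st (t : config n) : \sum_u glauber (1 - delta) t u = 1.
  rewrite -[RHS](gstep_cst (1 - delta) n_gt0 1 t) -glauber_gstep //.
  by apply: eq_bigr => u _; rewrite mulr1.
have phi0 : exists t : config n, S t != 0.
  case: (pselect (exists t : config n, S t != 0)) => [//|h].
  have z (t : config n) : S t = 0 by case: (eqVneq (S t) 0) => // ft; case: h; exists t.
  have : m2 = 0 by rewrite /m2 (@eq_Emu _ _ _ _ (fun=> 0)) ?Emu_cst // => t; rewrite z expr0n.
  by move=> e; move: m2p; rewrite e ltxx.
have [a [f [fn0 ef mf ray]]] := exists_top_eigenvector (mu_gt0 (1 - delta)) sa st phi0 Emu_sg.
have fnc : ~ (forall s t : config n, f s = f t).
  move=> fc; case: fn0 => t0; apply/negP; rewrite negbK; apply/eqP.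
  have := Emu_cst n (1 - delta) (f t0); rewrite /Emu => <-; rewrite -[RHS]mf.
  by apply: eq_bigr => t _; rewrite (fc t0 t).
have abound := eigenvalue_bound fnc ef.
have dn : 0 < delta / n%:R by rewrite divr_gt0.
have ane : a != 1 by apply/eqP => a1; move: abound; rewrite a1 normr1; lra.
set X := [set `|b| | b in [set b | glauber_eigenvalue n (1 - delta) b /\ b != 1]].
have aX : X `|a| by exists a => //; split => //; exists f.
have ubX : ubound X (1 - delta / n%:R).
  move=> _ [b [[g [[t0 g0] eg]] b1] <-]; apply: (eigenvalue_bound (f := g)) => // gc.
  move: b1; apply/negP; rewrite negbK; apply/eqP.
  have := eg t0; rewrite (eq_bigr (fun t => glauber (1 - delta) t0 t * g t0)) => [|t _].
    by rewrite -mulr_suml st => /(mulIf g0) <-.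
  by rewrite (gc t t0).
have l1 : glauber_lambda n (1 - delta) <= 1 - delta / n%:R by apply: ge_sup ubX; exists `|a|.
have l2 : a <= glauber_lambda n (1 - delta).
  by apply: le_trans (ler_norm a) _; apply: ub_le_sup aX; exists (1 - delta / n%:R).
rewrite /spectral_gap ler_pdivlMr // ler_pdivrMr //; apply/andP; split; first by lra.
suff : 1 - a <= (1 + eta / c0 R) * (delta / n%:R) by lra.
have ray2 : (1 - delta * nu) * m2 - eta * nu * nu <= a * m2.
  apply: le_trans ray.
  have mom := sg_moments x1; rewrite -/eta in mom.
  have h := Emu_le (1 - delta) (fun t => gstep_corr_ge n_gt0 beta01 t).
  have e : Em (fun s => (1 - (1 - (1 - delta)) * nu) * S s ^+ 2 - (S s ^+ 4 / 3 + `|S s| * nu) * nu) =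
     (1 - delta * nu) * m2 - (Em (fun t => S t ^+ 4) / 3 + Em (fun t => `|S t|) * nu) * nu.
    rewrite EmuB subKr (EmuZ (1 - delta) (1 - delta * nu)); congr (_ - _).
    rewrite [RHS]mulrC mulrDr [_ / 3]mulrC [Em _ * nu]mulrC -!EmuZ -EmuD.
    by apply: eq_Emu => t; ring.
  rewrite e in h.
  have h2 : Em (fun s => S s * gstep (1 - delta) (fun t => S t) s) =
     \sum_(t : config n) cw_mu (1 - delta) t * (S t * \sum_(u : config n) glauber (1 - delta) t u * S u).
    by apply: eq_bigr => t _; rewrite glauber_gstep //.
  rewrite -h2; apply: le_trans h; rewrite lerD2l lerN2.
  by rewrite ler_pM2r.
have k1 : (1 - a) * m2 <= delta * nu * m2 + eta * nu * nu by lra.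
rewrite -(ler_pM2r m2p); apply: le_trans k1 _.
have eta0 : 0 <= eta.
  have x0 : 0 < x by lra.
  by rewrite /eta addr_ge0 // divr_ge0 ?sqrtr_ge0 // ltW.
have k2 : eta * nu / c0 R * (c0 R * nu) <= eta * nu / c0 R * (delta * m2).
  by apply: ler_wpM2l => //; rewrite divr_ge0 ?(ltW c00) // mulr_ge0 // ltW.
have e1 : eta * nu / c0 R * (c0 R * nu) = eta * nu * nu by field; rewrite !gt_eqF.
rewrite e1 in k2; lra.
Qed.

End SpectralGap.

(** * Cutoff *)

(** [gam] is chosen to beat the terms in [1 / sqrt gam] and [1 / gam], then [B], depending on [gam],
    to beat those in [v] and [w]. Taking [gam = b1 ^ 2] makes the square root explicit. *)
Lemma upper_error_small (R : realType) (eps a c K : R) : 0 < eps -> 0 <= c -> 0 <= K ->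
  exists gam B : R, [/\ 1 <= gam, 1 <= B & forall v w, v <= B^-1 -> w <= B^-1 ->
    a / Num.sqrt gam + c * gam * v + 4 * (K * (gam^-1 + w)) <= eps].
Proof.
move=> e0 c0 K0.
have large A : 0 <= A -> exists2 b : R, 1 <= b & A <= eps * b.
  move=> A0; exists (1 + A / eps); first by rewrite lerDl divr_ge0 // ltW.
  have -> : eps * (1 + A / eps) = eps + A by field; rewrite gt_eqF.
  by rewrite lerDr ltW.
have small A b (q : R) : 0 <= A -> 1 <= b -> A * q <= eps * b -> 0 < q -> A / b <= eps / q.
  move=> A0 b1 Ab q0; rewrite ler_pdivrMr; last by rewrite (lt_le_trans _ b1).
  by rewrite mulrAC ler_pdivlMr.
have [b1 b11 hb1] : exists2 b : R, 1 <= b & `|a| * 4 + 4 * K * 4 <= eps * b.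
  by apply: large; rewrite addr_ge0 ?mulr_ge0.
have g1 : 1 <= b1 ^+ 2 by rewrite exprn_ege1.
have s0 : 0 <= c * b1 ^+ 2 + 4 * K.
  by apply: addr_ge0; apply: mulr_ge0 => //; exact: sqr_ge0.
have [B B1 hB] : exists2 b : R, 1 <= b & (c * b1 ^+ 2 + 4 * K) * 2 <= eps * b.
  by apply: large; rewrite mulr_ge0.
have b10 : 0 < b1 by rewrite (lt_le_trans _ b11).
exists (b1 ^+ 2), B; split => // v w hv hw.
have h1 : a / b1 <= eps / 4.
  apply: le_trans (_ : `|a| / b1 <= _); first by rewrite ler_pM2r ?invr_gt0 // ler_norm.
  apply: small => //; apply: le_trans hb1; rewrite lerDl ?mulr_ge0 //.
have h2 : 4 * K / b1 <= eps / 4.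
  apply: small; rewrite ?mulr_ge0 //; apply: le_trans hb1; rewrite lerDr ?mulr_ge0 //.
have h3 : (c * b1 ^+ 2 + 4 * K) / B <= eps / 2.
  by apply: small.
have h4 : c * b1 ^+ 2 * v <= c * b1 ^+ 2 / B by rewrite ler_wpM2l // mulr_ge0 ?sqr_ge0.
have h5 : K * w <= K / B by rewrite ler_wpM2l.
have h6 : K * (b1 ^+ 2)^-1 <= K / b1.
  by rewrite ler_wpM2l // lef_pV2 ?posrE ?exprn_gt0 // expr2 ler_peMl // ltW.
rewrite sqrtr_sqr gtr0_norm //.
move: h1 h2 h3 h4 h5 h6; clear => *; lra.
Qed.

Lemma tmix_upper_uniform (R : realType) (eps : R) : 0 < eps ->
  exists C X : R, forall n delta, (1 < n)%N -> 0 < delta <= 1 -> X <= delta ^+ 2 * n%:R ->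
    (exists m, dmix n (1 - delta) m <= eps) /\
    (tmix n (1 - delta) eps)%:R <=
      2^-1 * (n%:R / delta) * ln (delta ^+ 2 * n%:R) + C * (n%:R / delta).
Proof.
move=> e0.
have [||gam [B [g1 B1 err]]] := @upper_error_small _ eps (Cg R) (270 ^+ 2) (Knl R) e0.
- exact: sqr_ge0.
- by rewrite /Knl.
exists (3 * gam + 6), (Num.max (8 * Knl R) (B ^+ 2)) => n delta n1 d01.
rewrite ge_max => /andP[xK xB]; have [d0 d1] := andP d01.
have B0 : 0 < B by rewrite (lt_le_trans _ B1).
have BB : B <= B ^+ 2 by rewrite expr2 ler_peMl // ltW.
have n0 : 0 < n%:R :> R by rewrite ltr0n; apply: ltnW.
have xdn : delta ^+ 2 * n%:R <= delta * n%:R by rewrite ler_pM2r // expr2 ler_piMl // ltW.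
have dnn : delta * n%:R <= n%:R by rewrite ler_piMl // ltW.
have xn := le_trans xdn dnn.
apply: tmix_upper => //.
- exact: le_trans xK xn.
- exact: le_trans B1 (le_trans BB xB).
- apply: err.
    rewrite lef_pV2 ?posrE ?mulr_gt0 //; exact: le_trans BB (le_trans xB xdn).
  rewrite lef_pV2 ?posrE ?sqrtr_gt0 // -[leLHS]ger0_norm ?(ltW B0) // -sqrtr_sqr.
  exact/ler_wsqrtr/(le_trans xB).
Qed.

Lemma tmix_lower_uniform (R : realType) (eps : R) : 0 < eps < 1 ->
  exists C : R, forall n delta, (4 <= n)%N -> 0 < delta <= 1 -> 16 <= delta ^+ 2 * n%:R ->
    (exists m, dmix n (1 - delta) m <= eps) ->
    2^-1 * (n%:R / delta) * ln (delta ^+ 2 * n%:R) - C * (n%:R / delta)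
      <= (tmix n (1 - delta) eps)%:R.
Proof.
move=> /andP[e0 e1]; set r := (1 - eps)^-1.
have r1 : 1 <= r by rewrite /r invf_ge1; lra.
(* [expR (gam - 1) >= gam] yields [M >= 28 * r + 1], hence [28 / M ^ 2 <= 28 / M < 1 - eps]. *)
set gam := 24 * (28 * r + 52) + 1; exists gam => n delta n4 d01 x16 ex.
have hM : 28 * r + 1 <= expR (gam - 1) / 24 - 51.
  have := expR_ge1Dx (gam - 1); rewrite {1}/gam => h.
  by lra.
apply: tmix_lower => //; [by rewrite /gam; lra | lra |].
set M := _ - _ in hM *; have M1 : 1 <= M by lra.
apply: (@le_lt_trans _ _ (28 / M)).
  rewrite ler_pM2l // lef_pV2 ?posrE ?exprn_gt0 //; [|lra|lra].
  by rewrite expr2 ler_peMl; lra.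
rewrite ltr_pdivrMr; last lra.
have -> : (1 - eps) * M = 28 + (1 - eps) * (M - 28 * r) by rewrite /r; field; rewrite gt_eqF; lra.
by rewrite ltrDl mulr_gt0; lra.
Qed.

(** The upper bound also supplies the time at which level [eps] is reached, which the lower bound
    takes as a hypothesis. *)
Lemma tmix_window (R : realType) (eps : R) : 0 < eps < 1 ->
  exists C X : R, forall n delta, 0 < delta <= 1 -> X <= delta ^+ 2 * n%:R ->
    `|(tmix n (1 - delta) eps)%:R - 2^-1 * (n%:R / delta) * ln (delta ^+ 2 * n%:R)|
      <= C * (n%:R / delta).
Proof.
move=> e01; have /andP[e0 _] := e01.
have [C1 [X1 h1]] := tmix_upper_uniform e0.
have [C2 h2] := tmix_lower_uniform e01.
exists (Num.max C1 C2), (Num.max X1 16) => n delta d01; rewrite ge_max => /andP[x1 x16].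
have [d0 d1] := andP d01.
have n4 : (4 <= n)%N.
  rewrite -(ler_nat R); apply: le_trans (_ : 16 <= _); first by rewrite -[16]/(16%:R) ler_nat.
  apply: le_trans x16 _; rewrite ler_piMl //; apply: exprn_ile1 => //; exact: ltW.
have [ex up] := h1 n delta (leq_trans (isT : (1 < 4)%N) n4) d01 x1.
have low := h2 n delta n4 d01 x16 ex.
have w0 : 0 <= n%:R / delta by apply: divr_ge0 => //; exact: ltW.
have c1 : C1 * (n%:R / delta) <= Num.max C1 C2 * (n%:R / delta).
  by rewrite ler_wpM2r // le_max lexx.
have c2 : C2 * (n%:R / delta) <= Num.max C1 C2 * (n%:R / delta).
  by rewrite ler_wpM2r // le_max lexx orbT.
rewrite ler_norml; apply/andP; split; lra.
Qed.

(** [cutoff] asks for a bound at every [n >= 1], while the estimates hold for large [n]; the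
    constant absorbs the finitely many other indices through the sum of their ratios. *)
Lemma eventually_bound_all (R : realType) (F w : nat -> R) (C : R) :
  (forall n, (1 <= n)%N -> 0 < w n) ->
  (\forall n \near \oo, F n <= C * w n) ->
  exists2 c, 0 < c & forall n, (1 <= n)%N -> F n <= c * w n.
Proof.
move=> w0 [N _ hN].
have term0 (i : 'I_N) : 0 <= `|F i| / `|w i| by rewrite divr_ge0.
have S0 : 0 <= \sum_(i < N) `|F i| / `|w i| by rewrite sumr_ge0.
exists (`|C| + 1 + \sum_(i < N) `|F i| / `|w i|); first by have := normr_ge0 C; lra.
move=> n n1; have wn := w0 n n1; have cC := ler_norm C; have c0 := normr_ge0 C.
have [Nn|nN] := leqP N n.
  by apply: le_trans (hN n Nn) _; rewrite ler_pM2r //; lra.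
rewrite -ler_pdivrMr //; apply: (@le_trans _ _ (`|F n| / `|w n|)).
  by rewrite [`|w n|]gtr0_norm // ler_pM2r ?invr_gt0 // ler_norm.
rewrite (bigD1 (Ordinal nN)) //=.
have : 0 <= \sum_(i < N | i != Ordinal nN) `|F i| / `|w i| by rewrite sumr_ge0.
by lra.
Qed.

Lemma window_vanishes (R : realType) (delta : nat -> R) :
  (forall n, 0 < delta n) ->
  (fun n => delta n ^+ 2 * n%:R) @ \oo --> +oo ->
  (fun n => n%:R / delta n / (2^-1 * (n%:R / delta n) * ln (delta n ^+ 2 * n%:R))) @ \oo --> 0.
Proof.
move=> d0 hlim; apply/cvgrPdist_le => e e0; near=> n.
have hx : expR (2 / e) <= delta n ^+ 2 * n%:R.
  by near: n; move/cvgryPge : hlim; apply.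
have n0 : 0 < n%:R :> R by rewrite ltr0n; near: n; exists 1%N.
have hl : 2 / e <= ln (delta n ^+ 2 * n%:R).
  by rewrite -ler_expR lnK // posrE mulr_gt0 // exprn_gt0.
have l0 : 0 < ln (delta n ^+ 2 * n%:R) by apply: lt_le_trans hl; rewrite divr_gt0.
have -> : n%:R / delta n / (2^-1 * (n%:R / delta n) * ln (delta n ^+ 2 * n%:R)) =
    2 / ln (delta n ^+ 2 * n%:R).
  by field; rewrite !gt_eqF.
rewrite sub0r normrN ger0_norm; last by rewrite divr_ge0 // ltW.
by rewrite ler_pdivrMr // mulrC -ler_pdivrMr.
Unshelve. all: by end_near.
Qed.

Lemma spectral_gap_asymptotic (R : realType) (delta : nat -> R) :
  (forall n, 0 < delta n <= 1) ->
  (fun n => delta n ^+ 2 * n%:R) @ \oo --> +oo ->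
  (fun n => spectral_gap n (1 - delta n) / (delta n / n%:R)) @ \oo --> (1 : R).
Proof.
move=> d01 hlim; have c00 := c0_gt0 R.
apply/cvgrPdist_le => e e0.
(* Chosen so that [c0 * B = c0 + 16 + 16 / e]: then [16 / B], which bounds the error since
   [16 = 14 + 2], is below both [c0] and [e * c0]. *)
set B := 1 + 16 / c0 R + 16 / (c0 R * e).
have b1 : 0 <= 16 / c0 R by rewrite divr_ge0 // ltW.
have b2 : 0 <= 16 / (c0 R * e) by rewrite divr_ge0 // mulr_ge0 ?ltW.
have B1 : 1 <= B by rewrite /B; lra.
have BB : B <= B ^+ 2 by rewrite expr2 ler_peMl //; lra.
near=> n.
have hx : B ^+ 2 <= delta n ^+ 2 * n%:R.
  by near: n; move/cvgryPge : hlim; apply.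
have n1 : (1 < n)%N by near: n; exists 2%N.
set x := delta n ^+ 2 * n%:R in hx *.
have sB : B <= Num.sqrt x.
  have : Num.sqrt (B ^+ 2) <= Num.sqrt x by apply: ler_wsqrtr; lra.
  by rewrite sqrtr_sqr ger0_norm //; lra.
have h3 : x^-1 <= B^-1 by rewrite lef_pV2 ?posrE //; lra.
have h4 : (Num.sqrt x)^-1 <= B^-1 by rewrite lef_pV2 ?posrE //; lra.
have eta : 14 / x + 2 / Num.sqrt x <= 16 / B by lra.
have B0 : 0 < B by lra.
have hB1 : c0 R * B = c0 R + 16 + 16 / e by rewrite /B; field; rewrite !gt_eqF.
have e1 : 16 / B <= c0 R.
  have : 0 <= 16 / e by rewrite divr_ge0 // ltW.
  by rewrite ler_pdivrMr // hB1; lra.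
have e2 : 16 / B <= e * c0 R.
  have -> : 16 / B = e * (16 / e / B) by field; rewrite !gt_eqF.
  rewrite ler_pM2l // ler_pdivrMr // hB1; lra.
have x1 : 1 <= x by lra.
have small : 14 / x + 2 / Num.sqrt x <= c0 R by lra.
have /andP[g1 g2] := gap_bounds n1 (d01 n) x1 small.
rewrite distrC ger0_norm; last by rewrite subr_ge0.
rewrite lerBlDl; apply: le_trans g2 _; rewrite lerD2l ler_pdivrMr //; exact: le_trans e2.
Unshelve. all: by end_near.
Qed.

Theorem theorem1 (R : realType) (delta : nat -> R)
  (hdelta : forall n, 0 < delta n <= 1)
  (hlim : (fun n => delta n ^+ 2 * n%:R) @ \oo --> +oo) :
  cutoff (fun n => 1 - delta n)
    (fun n => 2^-1 * (n%:R / delta n) * ln (delta n ^+ 2 * n%:R))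
    (fun n => n%:R / delta n)
  /\
  ((fun n => spectral_gap n (1 - delta n) / (delta n / n%:R)) @ \oo --> (1 : R)).
Proof.
have d0 n : 0 < delta n by have /andP[] := hdelta n.
split; last exact: spectral_gap_asymptotic.
split; first exact: window_vanishes.
move=> eps /tmix_window[C [X bound]].
apply: (@eventually_bound_all _ _ _ C) => [n n1|].
  by rewrite divr_gt0 // ltr0n.
by near=> n; apply: bound => //; near: n; move/cvgryPge : hlim; apply.
Unshelve. all: by end_near.
Qed.
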